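(* There exists an open dense subset $\mathcal{O} \subset PU(4) = U(4)/U(1)$ (the group of projective unitaries on $\mathbb{C}^2\otimes\mathbb{C}^2$) such that every gate $G \in \mathcal{O}$ is by itself universal for the class BQP (polynomial time quantum computation); that is, for every $G\in\mathcal{O}$ the following two properties hold. (1) Density: for every integer $n \ge 2$, the set of projective unitaries on $(\mathbb{C}^2)^{\otimes n}$ obtained as finite compositions of copies of $G$ and of $\mathrm{Swap}$, each applied to an ordered pair of distinct qubits, is dense in $PU(2^n)$. (2) Polynomial efficiency: there is a polynomial $p$ (depending only on $G$) such that for all integers $n\ge 2$, $m\ge 1$, every real $0<\varepsilon<1$, and every unitary $U$ on $(\mathbb{C}^2)^{\otimes n}$ that is a composition of $m$ arbitrary one- and two-qubit unitary gates, there is a composition of at most $p(m,1/\varepsilon)$ gates, each a copy of $G$ or $\mathrm{Swap}$ applied to an ordered pair of distinct qubits, which is within distance $\varepsilon$ of $U$ in operator norm up to a global phase.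
   Context: $PU(d) = U(d)/U(1)$ denotes the projective unitary group, with its usual Lie group (quotient) topology; $U(1)$ is the group of scalar phases. A qubit is a copy of $\mathbb{C}^2$ with orthonormal basis $\{\uparrow,\downarrow\}$; an $n$-qubit system is $(\mathbb{C}^2)^{\otimes n}$. A two-qubit gate is a (projective) unitary on $\mathbb{C}^2\otimes\mathbb{C}^2$; applying it to an ordered pair of distinct qubits $(i,j)$ of an $n$-qubit system means acting by it on the $i$-th and $j$-th tensor factors (in that order, identified with the first and second factors of $\mathbb{C}^2\otimes\mathbb{C}^2$) and by the identity on all other factors. The gate $\mathrm{Swap}$ is the linear map $\phi\otimes\psi\mapsto\psi\otimes\phi$ on $\mathbb{C}^2\otimes\mathbb{C}^2$. Convention: the Swap gate is treated as inherent to the circuit model, i.e. it is freely available, so qubits can be permuted and a two-qubit gate can be applied to any pair of qubits in either order. ''$V$ is within distance $\varepsilon$ of $U$ up to a global phase'' means $\min_{\theta\in\mathbb{R}}\|U-e^{i\theta}\tilde V\|\le\varepsilon$, where $\tilde V$ is any unitary representative of the projective unitary $V$. *)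

(* Defs.v *)
From mathcomp Require Import all_boot all_order all_algebra.
From mathcomp Require Export complex.
From mathcomp Require Import all_classical all_reals all_analysis.
Import Order.TTheory GRing.Theory Num.Theory.
Import numFieldNormedType.Exports.

Set Implicit Arguments.
Unset Strict Implicit.
Unset Printing Implicit Defensive.

Local Open Scope classical_set_scope.
Local Open Scope complex_scope.
Local Open Scope ring_scope.

(* The field R[i], packed so that the norm topology which MathComp-Analysis
   puts on every numClosedFieldType (and entrywise on matrices) applies. *)
Definition Cplx (R : realType) : numClosedFieldType := R[i].

(* set_type carries the subspace topology inherited from 'M_d. *)
Definition U (R : realType) (d : nat) : topologicalType :=
  set_type [set A : 'M[Cplx R]_d | A \is unitarymx].

Definition mx_of (R : realType) (d : nat) (A : U R d) : 'M[Cplx R]_d :=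
  set_val A.

Definition phase_eq (R : realType) (d : nat) (A B : U R d) : bool :=
  `[< exists2 z : Cplx R, `|z| = 1 & mx_of A = z *: mx_of B >].

Lemma phase_eq_equiv (R : realType) (d : nat) :
  equiv_class_of (@phase_eq R d).
Proof.
have inv (A B : U R d) : phase_eq A B -> phase_eq B A.
  move=> /asboolP[z z1 AB]; apply/asboolP; exists z^-1.
    by rewrite normfV z1 invr1.
  by rewrite AB scalerA mulVf ?scale1r // -normr_eq0 z1 oner_eq0.
split.
- by move=> A; apply/asboolP; exists 1; rewrite ?normr1 ?scale1r.
- by move=> A B; apply/idP/idP; exact: inv.
- move=> B A C /asboolP[z z1 AB] /asboolP[w w1 BC]; apply/asboolP.
  by exists (z * w); rewrite ?normrM ?z1 ?w1 ?mulr1 // AB BC scalerA.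
Qed.

Canonical phase_equivrel (R : realType) (d : nat) :=
  EquivRelPack (phase_eq_equiv R d).

Definition PU (R : realType) (d : nat) : topologicalType :=
  quotient_topology {eq_quot phase_equivrel R d}%qT.

Definition PUclass (R : realType) (d : nat) (A : U R d) : PU R d :=
  \pi_(PU R d)%qT A.

Definition l2norm (R : realType) (d : nat) (v : 'cV[Cplx R]_d) : R :=
  Num.sqrt (\sum_(i < d) complex.Re (`|v i 0| ^+ 2)).

Definition opnorm (R : realType) (d : nat) (A : 'M[Cplx R]_d) : R :=
  sup [set l2norm (A *m v) | v in [set v | l2norm v = 1]].

Definition expi (R : realType) (t : R) : Cplx R := cos t +i* sin t.

(* As the minimum over the phase is attained, "min <= eps" is the existence of
   a suitable phase. *)
Definition within_up_to_phase (R : realType) (d : nat) (eps : R)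
    (A : U R d) (V : PU R d) : Prop :=
  forall B : U R d, PUclass B = V ->
    exists t : R, opnorm (mx_of A - expi t *: mx_of B) <= eps.

(* Matrices act on column vectors.  The x-th basis vector of C^(2^n) is the
   tensor product of the basis vectors qbit x 0, ..., qbit x (n-1) of C^2
   (0 = up, 1 = down), i.e. the digits of x in base 2, most significant digit
   first, as for the Kronecker product. *)
Definition qbit (n : nat) (x : 'I_(2 ^ n)) (k : 'I_n) : 'I_2 :=
  inord ((x %/ 2 ^ (n - k.+1)) %% 2).

Definition pair_index (a b : 'I_2) : 'I_4 := inord (2 * a + b).

Definition place1 (R : realType) (n : nat) (g : 'M[Cplx R]_2) (i : 'I_n) :
    'M[Cplx R]_(2 ^ n) :=
  \matrix_(x, y)
    if [forall k, (k != i) ==> (qbit x k == qbit y k)]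
    then g (qbit x i) (qbit y i) else 0.

(* The first (resp. second) tensor factor of g acts on qubit i (resp. j). *)
Definition place2 (R : realType) (n : nat) (g : 'M[Cplx R]_4) (i j : 'I_n) :
    'M[Cplx R]_(2 ^ n) :=
  \matrix_(x, y)
    if [forall k, (k != i) && (k != j) ==> (qbit x k == qbit y k)]
    then g (pair_index (qbit x i) (qbit x j)) (pair_index (qbit y i) (qbit y j))
    else 0.

Definition Swap (R : realType) : 'M[Cplx R]_4 :=
  \matrix_(x < 2 ^ 2, y < 2 ^ 2)
    ((qbit x 0 == qbit y 1) && (qbit x 1 == qbit y 0))%:R.

Definition compositions (R : realType) (d : nat) (S : set 'M[Cplx R]_d)
    (m : nat) : set 'M[Cplx R]_d :=
  [set A | exists2 F : 'I_m -> 'M[Cplx R]_d,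
             forall k, S (F k) & A = \prod_(k < m) F k].

Definition local_gates (R : realType) (n : nat) : set 'M[Cplx R]_(2 ^ n) :=
  [set A | (exists (g : U R 2) (i : 'I_n), A = place1 (mx_of g) i) \/
           (exists (g : U R 4) (i j : 'I_n),
              i != j /\ A = place2 (mx_of g) i j)].

(* A copy of G is represented by any unitary in the class G; different choices
   only change the compositions by a global phase. *)
Definition GSwap_gates (R : realType) (G : PU R 4) (n : nat) :
    set 'M[Cplx R]_(2 ^ n) :=
  [set A | exists i j : 'I_n, i != j /\
             ((exists2 g : U R 4, PUclass g = G & A = place2 (mx_of g) i j) \/
              A = place2 (Swap R) i j)].

Definition GSwap_circuits (R : realType) (G : PU R 4) (n m : nat) :
    set (PU R (2 ^ n)) :=
  [set V | exists2 A : U R (2 ^ n),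
             PUclass A = V & compositions (@GSwap_gates R G n) m (mx_of A)].

Definition dense_gate (R : realType) (G : PU R 4) : Prop :=
  forall n : nat, (2 <= n)%N ->
    dense [set V : PU R (2 ^ n) | exists m : nat, GSwap_circuits G m V].

Definition efficient_gate (R : realType) (G : PU R 4) : Prop :=
  exists p : {poly {poly R}},
    forall (n m : nat) (eps : R) (A : U R (2 ^ n)),
      (2 <= n)%N -> (1 <= m)%N -> 0 < eps -> eps < 1 ->
      compositions (@local_gates R n) m (mx_of A) ->
      exists (k : nat) (V : PU R (2 ^ n)),
        [/\ k%:R <= p.[m%:R, eps^-1],
            GSwap_circuits G k V
          & within_up_to_phase eps A V].

Definition BQP_universal (R : realType) (G : PU R 4) : Prop :=
  dense_gate G /\ efficient_gate G.

(* Main.v *)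
(** Call a gate good if words in it, its inverse and Swap come within a fixed
    small distance of every point of a finite net of U(4), up to phases.  This
    is an open condition.

    Good gates are universal.  Every element of U(4) near 1 is, up to third
    order, a phase times a product of boundedly many group commutators of
    elements of square root size, so a net of mesh [r ^ 2] made of words of
    length L refines to one of mesh [(r / 2) ^ 2] made of words of length K L:
    the Solovay-Kitaev step, whose repetition gives words of length polynomial
    in the inverse precision.  Inverses of the gate are replaced by powers: by
    the pigeonhole principle some power of polynomial exponent is close to 1.

    Good gates are dense.  Write Swap = 1 - w w^*.  Perturb a diagonalising
    frame of the given gate so that w has no zero coordinate in it; then the
    diagonal torus and Swap generate a dense group.  Taking as eigenvalues
    primitive roots of unity of distinct large prime orders makes the powers of
    the gate approximate each factor of the torus.

    Density of a group S of unitaries is obtained from its tangent vectors, the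
    X for which S meets the ball of radius o(t) around 1 + t X.  They form a
    real Lie algebra, and S is dense as soon as they are all the antihermitian
    matrices.  The same criterion shows that the two-qubit gates generate a
    dense group on n qubits. *)

(* The mesh below which a net can be refined depends on the dimension only, not on the gate. So
   universality follows from finitely many strict inequalities, one for each point of a fixed finite
   net, each about one finite word; a word depends continuously on its gate, and the condition is
   open.

   Phases count as letters. This replaces PU(4) by U(4), where distances involve no minimum over a
   phase, and the Lie algebra to be generated consists of all antihermitian matrices.

   One-parameter groups occur in two explicit forms: as conjugated diagonal matrices and, for Y ^ 3
   = - Y, as quadratic polynomials in Y. A tangent vector is a first order statement, which the N-th
   power of a group element near 1 turns into density.

   The price of having no inverse gate: a word of l letters at precision 1 / M tolerates an error of
   order 1 / (M l) per letter, and the pigeonhole exponent is polynomial in M l for fixed dimension.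
   As l is itself polynomial in M, so is the total length. *)
Require Import Defs.
From mathcomp Require Import all_boot all_order all_algebra.
From mathcomp Require Import all_classical all_reals all_analysis.
From mathcomp Require Import ring lra zify.
Import Order.TTheory GRing.Theory Num.Theory.
Import numFieldNormedType.Exports.

Set Implicit Arguments.
Unset Strict Implicit.
Unset Printing Implicit Defensive.

Local Open Scope classical_set_scope.
Local Open Scope complex_scope.
Local Open Scope sesquilinear_scope.
Local Open Scope ring_scope.

(** * Operator norm *)

Section Cabs.
Variable R : realType.
Implicit Types z w : Cplx R.

Definition cabs z : R := complex.Re `|z|.

Lemma cabsE z : ((cabs z)%:C : Cplx R) = `|z|.
Proof. by rewrite /cabs; case: z. Qed.

Lemma cabs_ge0 z : 0 <= cabs z.
Proof. by case: z => a b; rewrite /cabs /= sqrtr_ge0. Qed.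

Lemma cabs0 : cabs 0 = 0.
Proof. by rewrite /cabs normr0. Qed.

Lemma cabs1 : cabs 1 = 1.
Proof. by rewrite /cabs normr1. Qed.

Lemma cabsM z w : cabs (z * w) = cabs z * cabs w.
Proof. by apply: complexI; rewrite rmorphM !cabsE normrM. Qed.

Lemma cabsD z w : cabs (z + w) <= cabs z + cabs w.
Proof. by rewrite -lecR rmorphD !cabsE ler_normD. Qed.

Lemma cabsN z : cabs (- z) = cabs z.
Proof. by rewrite /cabs normrN. Qed.

Lemma cabs_real (t : R) : cabs t%:C = `|t|.
Proof. by rewrite /cabs /= expr0n /= addr0 sqrtr_sqr. Qed.

Lemma cabs_eq0 z : cabs z = 0 -> z = 0.
Proof. by move=> z0; apply: normr0_eq0; rewrite -cabsE z0. Qed.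

Lemma cabs_eq1 z : (cabs z == 1) = (`|z| == 1).
Proof. by rewrite -cabsE; apply/eqP/eqP => [->//|]; apply: (@complexI R _ 1). Qed.

Lemma cabs_sqr z : cabs z ^+ 2 = complex.Re z ^+ 2 + complex.Im z ^+ 2.
Proof.
by case: z => a b; rewrite /cabs /= sqr_sqrtr // addr_ge0 // sqr_ge0.
Qed.

Lemma Re_le_cabs z : `|complex.Re z| <= cabs z.
Proof.
rewrite -(@ler_pXn2r _ 2) ?nnegrE ?cabs_ge0 //.
by rewrite cabs_sqr -normrX ger0_norm ?sqr_ge0 // lerDl sqr_ge0.
Qed.

Lemma Im_le_cabs z : `|complex.Im z| <= cabs z.
Proof.
rewrite -(@ler_pXn2r _ 2) ?nnegrE ?cabs_ge0 //.
by rewrite cabs_sqr -normrX ger0_norm ?sqr_ge0 // lerDr sqr_ge0.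
Qed.

Lemma cabs_le_ReIm z : cabs z <= `|complex.Re z| + `|complex.Im z|.
Proof.
rewrite -(@ler_pXn2r _ 2) ?nnegrE ?cabs_ge0 ?addr_ge0 //.
rewrite cabs_sqr -[complex.Re z ^+ 2]real_normK ?num_real //.
rewrite -[complex.Im z ^+ 2]real_normK ?num_real // sqrrD lerD2r lerDl.
by rewrite mulrn_wge0 // mulr_ge0.
Qed.

Lemma cabs_sum (I : Type) (r : seq I) (F : I -> Cplx R) :
  cabs (\sum_(i <- r) F i) <= \sum_(i <- r) cabs (F i).
Proof.
apply: (big_rec2 (fun x y => cabs x <= y)); first by rewrite cabs0.
by move=> i y x _ xy; apply: le_trans (cabsD _ _) _; rewrite lerD2l.
Qed.

End Cabs.

Section Norms.
Variable R : realType.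
Local Notation C := (Cplx R).

Section L2.
Variable d : nat.
Implicit Types v w : 'cV[C]_d.

Lemma l2normE v : l2norm v = Num.sqrt (\sum_i cabs (v i 0) ^+ 2).
Proof.
congr Num.sqrt; apply: eq_bigr => i _.
by rewrite -cabsE -rmorphXn.
Qed.

Lemma l2norm_ge0 v : 0 <= l2norm v. Proof. exact: sqrtr_ge0. Qed.

Lemma l2norm_sqr v : l2norm v ^+ 2 = \sum_i cabs (v i 0) ^+ 2.
Proof. by rewrite l2normE sqr_sqrtr // sumr_ge0 // => i _; rewrite sqr_ge0. Qed.

Lemma l2norm0 : l2norm (0 : 'cV[C]_d) = 0.
Proof.
by rewrite l2normE big1 ?sqrtr0 // => i _; rewrite mxE cabs0 expr0n.
Qed.

Lemma l2norm_eq0 v : l2norm v = 0 -> v = 0.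
Proof.
move=> v0; apply/colP => i; rewrite mxE; apply: cabs_eq0.
have := l2norm_sqr v; rewrite v0 expr0n /= => /esym/eqP.
rewrite psumr_eq0; last by move=> j _; rewrite sqr_ge0.
by move=> /allP/(_ i (mem_index_enum _)); rewrite sqrf_eq0 => /eqP.
Qed.

Lemma l2normZ (z : C) v : l2norm (z *: v) = cabs z * l2norm v.
Proof.
rewrite !l2normE -[cabs z]ger0_norm ?cabs_ge0 // -sqrtr_sqr -sqrtrM ?sqr_ge0 //.
by rewrite mulr_sumr; congr Num.sqrt; apply: eq_bigr => i _; rewrite mxE cabsM exprMn.
Qed.

Lemma cabs_le_l2norm v i : cabs (v i 0) <= l2norm v.
Proof.
rewrite -(@ler_pXn2r _ 2) ?nnegrE ?cabs_ge0 ?l2norm_ge0 // l2norm_sqr.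
rewrite (bigD1 i) //= lerDl sumr_ge0 // => j _; exact: sqr_ge0.
Qed.

(** With p and q the two norms, (p + q) ^ 2 is the sum of (1 + q / p) p ^ 2 and (1 + p / q) q ^ 2,
    and with these weights the squares dominate (a + b) ^ 2 entry by entry: the difference is (q a -
    p b) ^ 2 / (p q). *)
Lemma l2normD v w : l2norm (v + w) <= l2norm v + l2norm w.
Proof.
have [p0|p0] := eqVneq (l2norm v) 0.
  by rewrite p0 (l2norm_eq0 p0) !add0r.
have [q0|q0] := eqVneq (l2norm w) 0.
  by rewrite q0 (l2norm_eq0 q0) !addr0.
have pg : 0 < l2norm v by rewrite lt0r p0 l2norm_ge0.
have qg : 0 < l2norm w by rewrite lt0r q0 l2norm_ge0.
rewrite -(@ler_pXn2r _ 2) ?nnegrE ?addr_ge0 ?l2norm_ge0 //.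
set p := l2norm v; set q := l2norm w.
have -> : (p + q) ^+ 2 = (1 + q / p) * p ^+ 2 + (1 + p / q) * q ^+ 2.
  by field; rewrite p0 q0.
rewrite !l2norm_sqr !mulr_sumr -big_split /=; apply: ler_sum => i _.
rewrite mxE; set a := cabs (v i 0); set b := cabs (w i 0).
have ab : cabs (v i 0 + w i 0) <= a + b by exact: cabsD.
have ab0 := cabs_ge0 (v i 0 + w i 0).
apply: (@le_trans _ _ ((a + b) ^+ 2)).
  by rewrite ler_pXn2r ?nnegrE // addr_ge0 // cabs_ge0.
rewrite -subr_ge0.
have -> : (1 + q / p) * a ^+ 2 + (1 + p / q) * b ^+ 2 - (a + b) ^+ 2
  = (q * a - p * b) ^+ 2 / (p * q) by field; rewrite p0 q0.
by rewrite divr_ge0 ?sqr_ge0 // mulr_ge0 // ltW.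
Qed.

End L2.

Section Op.
Variable d : nat.
Implicit Types (A B : 'M[C]_d) (v w : 'cV[C]_d).

Lemma l2norm_sum_le (I : Type) (r : seq I) (F : I -> 'cV[C]_d) :
  l2norm (\sum_(i <- r) F i) <= \sum_(i <- r) l2norm (F i).
Proof.
apply: (big_rec2 (fun x y => l2norm x <= y)); first by rewrite l2norm0.
by move=> i y x _ xy; apply: le_trans (l2normD _ _) _; rewrite lerD2l.
Qed.

(** This crude bound shows that the set in [opnorm] is bounded above, so that its supremum is an
    upper bound. *)
Lemma l2norm_mulmx_entries A v :
  l2norm (A *m v) <= (\sum_i \sum_j cabs (A i j)) * l2norm v.
Proof.
have s0 : 0 <= \sum_i \sum_j cabs (A i j).
  by apply: sumr_ge0 => i _; apply: sumr_ge0 => j _; exact: cabs_ge0.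
have l2sum w : l2norm w <= \sum_i cabs (w i 0).
  rewrite [X in l2norm X](_ : _ = \sum_i w i 0 *: (delta_mx i 0)); last first.
    apply/colP => k; rewrite summxE (bigD1 k) //= !mxE !eqxx mulr1 big1 ?addr0 //.
    by move=> i ik; rewrite !mxE eq_sym (negPf ik) mulr0.
  apply: le_trans (l2norm_sum_le _ _) _; apply: ler_sum => i _.
  rewrite l2normZ ler_piMr ?cabs_ge0 // l2normE (bigD1 i) //= !mxE !eqxx cabs1.
  rewrite big1 ?addr0 ?expr1n ?sqrtr1 // => j ji.
  by rewrite !mxE (negPf ji) cabs0 expr0n.
apply: le_trans (l2sum _) _; rewrite mulr_suml; apply: ler_sum => i _.
rewrite mxE mulr_suml; apply: le_trans (cabs_sum _ _) _; apply: ler_sum => j _.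
by rewrite cabsM ler_wpM2l ?cabs_ge0 // cabs_le_l2norm.
Qed.

Lemma l2norm_mulmx A v : l2norm (A *m v) <= opnorm A * l2norm v.
Proof.
have [v0|v0] := eqVneq (l2norm v) 0.
  by rewrite (l2norm_eq0 v0) mulmx0 l2norm0 mulr0.
have vg : 0 < l2norm v by rewrite lt0r v0 l2norm_ge0.
pose w := ((l2norm v)^-1)%:C *: v.
have w1 : l2norm w = 1.
  by rewrite l2normZ cabs_real ger0_norm ?invr_ge0 ?l2norm_ge0 // mulVf.
have vE : v = (l2norm v)%:C *: w.
  by rewrite scalerA -rmorphM mulfV // scale1r.
rewrite {1}vE -scalemxAr l2normZ cabs_real ger0_norm ?l2norm_ge0 // mulrC.
rewrite ler_pM2r //; apply: ub_le_sup; last by exists w.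
exists (\sum_i \sum_j cabs (A i j)) => _ [u u1 <-].
by apply: le_trans (l2norm_mulmx_entries _ _) _; rewrite u1 mulr1.
Qed.

Lemma opnorm_ge0 A : 0 <= opnorm A.
Proof.
rewrite /opnorm; set E := (X in sup X).
(* For d = 0 there is no unit vector, and the supremum is that of the empty set. *)
have [->|/set0P[x Ex]] := eqVneq E set0; first by rewrite sup0.
have [v v1 xE] := Ex; apply: (@le_trans _ _ x).
  by rewrite -xE l2norm_ge0.
apply: ub_le_sup => //; exists (\sum_i \sum_j cabs (A i j)) => _ [u u1 <-].
by apply: le_trans (l2norm_mulmx_entries _ _) _; rewrite u1 mulr1.
Qed.

Lemma opnorm_le A c : 0 <= c ->
  (forall v, l2norm (A *m v) <= c * l2norm v) -> opnorm A <= c.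
Proof.
move=> c0 Ac; rewrite /opnorm; set E := (X in sup X).
have [->|/set0P E0] := eqVneq E set0; first by rewrite sup0.
apply: ge_sup => // _ [v v1 <-].
by apply: le_trans (Ac v) _; rewrite v1 mulr1.
Qed.

(* Unification otherwise unfolds [opnorm] and diverges. *)
Opaque opnorm.

Lemma opnorm_entries A : opnorm A <= \sum_i \sum_j cabs (A i j).
Proof.
apply: opnorm_le; last exact: l2norm_mulmx_entries.
by apply: sumr_ge0 => i _; apply: sumr_ge0 => j _; exact: cabs_ge0.
Qed.

Lemma cabs_le_opnorm A i j : cabs (A i j) <= opnorm A.
Proof.
have := l2norm_mulmx A (delta_mx j 0).
have -> : l2norm (delta_mx j 0 : 'cV[C]_d) = 1.
  rewrite l2normE (bigD1 j) //= !mxE !eqxx cabs1.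
  rewrite big1 ?addr0 ?expr1n ?sqrtr1 // => k kj.
  by rewrite !mxE (negPf kj) cabs0 expr0n.
rewrite mulr1 -colE; apply: le_trans.
by have := cabs_le_l2norm (col j A) i; rewrite mxE.
Qed.

Lemma opnormD A B : opnorm (A + B) <= opnorm A + opnorm B.
Proof.
apply: opnorm_le; first by rewrite addr_ge0 ?opnorm_ge0.
move=> v; rewrite mulmxDl; apply: le_trans (l2normD _ _) _.
by rewrite mulrDl lerD ?l2norm_mulmx.
Qed.

Lemma opnormM A B : opnorm (A * B) <= opnorm A * opnorm B.
Proof.
apply: opnorm_le; first by rewrite mulr_ge0 ?opnorm_ge0.
move=> v; rewrite -mulmxA; apply: le_trans (l2norm_mulmx _ _) _.
by rewrite -mulrA ler_wpM2l ?opnorm_ge0 ?l2norm_mulmx.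
Qed.

Lemma opnormZ_le (z : C) A : opnorm (z *: A) <= cabs z * opnorm A.
Proof.
apply: opnorm_le; first by rewrite mulr_ge0 ?opnorm_ge0 ?cabs_ge0.
move=> v; rewrite -scalemxAl l2normZ -mulrA ler_wpM2l ?cabs_ge0 //.
exact: l2norm_mulmx.
Qed.

Lemma opnormZ_real (t : R) A : opnorm (t%:C *: A) <= `|t| * opnorm A.
Proof. by apply: le_trans (opnormZ_le _ _) _; rewrite cabs_real. Qed.

Lemma opnorm0 : opnorm (0 : 'M[C]_d) = 0.
Proof.
apply/eqP; rewrite eq_le opnorm_ge0 andbT; apply: opnorm_le => // v.
by rewrite mul0mx l2norm0 mul0r.
Qed.

Lemma opnormN A : opnorm (- A) = opnorm A.
Proof.
have le B : opnorm (- B) <= opnorm B.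
  by rewrite -scaleN1r; apply: le_trans (opnormZ_le _ _) _; rewrite cabsN cabs1 mul1r.
by apply/le_anti/andP; split; [exact: le | have := le (- A); rewrite opprK].
Qed.

Lemma opnormB A B : opnorm (A - B) = opnorm (B - A).
Proof. by rewrite -opnormN opprB. Qed.

Lemma opnorm_sum (I : Type) (r : seq I) (F : I -> 'M[C]_d) :
  opnorm (\sum_(i <- r) F i) <= \sum_(i <- r) opnorm (F i).
Proof.
apply: (big_rec2 (fun x y => opnorm x <= y)); first by rewrite opnorm0.
by move=> i y x _ xy; apply: le_trans (opnormD _ _) _; rewrite lerD2l.
Qed.

End Op.

(** * Unitary matrices and the operator norm *)

Section Unitary.
Variable d : nat.
Implicit Types (A B : 'M[C]_d).

Lemma unitarymx_mulVr A : A \is unitarymx -> A * A^t* = 1.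
Proof. by move=> /unitarymxP. Qed.

Lemma unitarymx_mulV A : A \is unitarymx -> A^t* * A = 1.
Proof.
move=> Au; rewrite -(invmx_unitary Au); apply: mulVmx.
exact: unitarymx_unit.
Qed.

Lemma dagM A B : (A * B)^t* = B^t* * A^t*.
Proof. by rewrite -[A * B]/(A *m B) trmx_mul map_mxM. Qed.

Lemma dagD A B : (A + B)^t* = A^t* + B^t*.
Proof. by rewrite linearD map_mxD. Qed.

Lemma dagN A : (- A)^t* = - A^t*.
Proof. by rewrite linearN map_mxN. Qed.

Lemma dag1 : (1 : 'M[C]_d)^t* = 1.
Proof. by rewrite trmx1 map_mx1. Qed.

Lemma dagZ (z : C) A : (z *: A)^t* = z^* *: A^t*.
Proof. by rewrite linearZ map_mxZ. Qed.

Lemma dagK A : (A^t*)^t* = A.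
Proof. by rewrite trmxCK. Qed.

Lemma unitarymx1 : (1 : 'M[C]_d) \is unitarymx.
Proof. by apply/unitarymxP; rewrite dag1 mulmx1. Qed.

Lemma unitarymxM A B : A \is unitarymx -> B \is unitarymx -> A * B \is unitarymx.
Proof. exact: mul_unitarymx. Qed.

Lemma unitarymxZ (z : C) A : `|z| = 1 -> A \is unitarymx -> z *: A \is unitarymx.
Proof.
move=> z1 Au; apply/unitarymxP; rewrite dagZ -scalemxAl -scalemxAr scalerA.
by rewrite (unitarymxP Au) -normCK z1 expr1n scale1r.
Qed.

Lemma l2norm_adj (v : 'cV[C]_d) : (l2norm v ^+ 2)%:C = (v^t* *m v) 0 0 :> C.
Proof.
rewrite l2norm_sqr rmorph_sum mxE; apply: eq_bigr => i _.
by rewrite rmorphXn /= cabsE !mxE mulrC normCK.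
Qed.

Lemma l2norm_unitary A (v : 'cV[C]_d) : A \is unitarymx -> l2norm (A *m v) = l2norm v.
Proof.
move=> Au; apply: (@pexpIrn _ 2) => //; rewrite ?nnegrE ?l2norm_ge0 //.
apply: complexI; rewrite !l2norm_adj trmx_mul map_mxM -mulmxA (mulmxA (A^t*)).
by have := unitarymx_mulV Au; rewrite -[A^t* * A]/(A^t* *m A) => ->; rewrite mul1mx.
Qed.

Lemma opnorm_unitary A : A \is unitarymx -> opnorm A <= 1.
Proof. by move=> Au; apply: opnorm_le => // v; rewrite mul1r l2norm_unitary. Qed.

Lemma adj_unitary A : A \is unitarymx -> A^t* \is unitarymx.
Proof. by rewrite trmxC_unitary. Qed.

Lemma opnormM_unitaryl A B : A \is unitarymx -> opnorm (A * B) <= opnorm B.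
Proof.
move=> Au; apply: le_trans (opnormM _ _) _.
by rewrite ler_piMl ?opnorm_ge0 ?opnorm_unitary.
Qed.

Lemma opnormM_unitaryr A B : B \is unitarymx -> opnorm (A * B) <= opnorm A.
Proof.
move=> Bu; apply: le_trans (opnormM _ _) _.
by rewrite ler_piMr ?opnorm_ge0 ?opnorm_unitary.
Qed.

Lemma opnorm_conj A B : A \is unitarymx -> opnorm (A * B * A^t*) <= opnorm B.
Proof.
move=> Au; apply: le_trans (opnormM_unitaryr _ (adj_unitary Au)) _.
exact: opnormM_unitaryl.
Qed.

(** Along a word of unitary letters errors add up without amplification; the difference telescopes
    as (A - A') B + A' (B - B'). *)
Lemma opnormM_sub A A' B B' : A' \is unitarymx -> B \is unitarymx ->
  opnorm (A * B - A' * B') <= opnorm (A - A') + opnorm (B - B').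
Proof.
move=> Au Bu.
have -> : A * B - A' * B' = (A - A') * B + A' * (B - B').
  by rewrite mulrBl mulrBr addrA subrK.
apply: le_trans (opnormD _ _) _; apply: lerD.
  exact: opnormM_unitaryr.
exact: opnormM_unitaryl.
Qed.

Lemma opnormB_trans A B D : opnorm (A - D) <= opnorm (A - B) + opnorm (B - D).
Proof. by rewrite -{1}(subrK B A) -addrA opnormD. Qed.

Lemma opnorm_adj_sub A B : A \is unitarymx -> B \is unitarymx ->
  opnorm (A^t* - B^t*) <= opnorm (A - B).
Proof.
move=> Au Bu.
have -> : A^t* - B^t* = A^t* * (B - A) * B^t*.
  rewrite mulrBr mulrBl unitarymx_mulV // mul1r -mulrA.
  by rewrite (unitarymx_mulVr Bu) mulr1.
rewrite opnormB; apply: le_trans (opnormM_unitaryr _ (adj_unitary Bu)) _.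
exact/opnormM_unitaryl/adj_unitary.
Qed.

Lemma scalar_unitary (z : C) : `|z| = 1 -> z%:M \is @unitarymx C d d.
Proof.
by move=> z1; rewrite -scalemx1; apply: unitarymxZ => //; exact: unitarymx1.
Qed.

End Unitary.

(** * Words over a set of matrices *)

Section Compositions.
Variables (d : nat).
Implicit Types (S : set 'M[C]_d) (A B : 'M[C]_d).

Lemma compositions0 S : compositions S 0 1.
Proof. by exists (fun=> 0) => [[]//|]; rewrite big_ord0. Qed.

Lemma compositions0E S A : compositions S 0 A -> A = 1.
Proof. by case=> F _ ->; rewrite big_ord0. Qed.

Lemma compositionsS S m A : compositions S m.+1 A <->
  exists B D, [/\ compositions S m B, S D & A = B * D].
Proof.
split=> [[F SF ->]|[B [D [[F SF ->] SD ->]]]].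
  rewrite big_ord_recr; exists (\prod_(i < m) F (widen_ord (leqnSn m) i)), (F ord_max).
  split=> //; by exists (fun i => F (widen_ord (leqnSn m) i)).
exists (fun i : 'I_m.+1 => if unlift ord_max i is Some j then F j else D).
  by move=> k; case: unliftP.
rewrite big_ord_recr /= unlift_none; congr (_ * _); apply: eq_bigr => i _.
have -> : widen_ord (leqnSn m) i = lift ord_max i.
  by apply: val_inj; exact: (esym (lift_max i)).
by rewrite liftK.
Qed.

Lemma compositions1 S A : S A -> compositions S 1 A.
Proof.
move=> SA; apply/compositionsS; exists 1, A; split=> //; last by rewrite mul1r.
exact: compositions0.
Qed.

Lemma compositionsD S m k A B :
  compositions S m A -> compositions S k B -> compositions S (m + k) (A * B).
Proof.
move=> SA; elim: k B => [|k IH] B.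
  by move=> /compositions0E ->; rewrite mulr1 addn0.
move=> /compositionsS[B' [D [/IH SB' SD ->]]].
rewrite addnS; apply/compositionsS; exists (A * B'), D; split=> //.
by rewrite mulrA.
Qed.

Lemma compositionsX S m A k :
  compositions S m A -> compositions S (m * k) (A ^+ k).
Proof.
move=> SA; elim: k => [|k IH]; first by rewrite muln0 expr0; exact: compositions0.
by rewrite mulnS exprS; exact: compositionsD.
Qed.

Lemma compositions_le S m k A : S 1 -> (m <= k)%N ->
  compositions S m A -> compositions S k A.
Proof.
move=> S1 /subnKC <- SA; elim: (k - m)%N => [|j IH]; first by rewrite addn0.
by rewrite addnS; apply/compositionsS; exists A, 1; rewrite mulr1.
Qed.

Lemma compositions_ind S (P : nat -> 'M[C]_d -> Prop) : P 0 1 ->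
  (forall m A B, compositions S m A -> P m A -> S B -> P m.+1 (A * B)) ->
  forall m A, compositions S m A -> P m A.
Proof.
move=> P0 PS; elim=> [A /compositions0E -> //|m IH A].
by move=> /compositionsS[B [D [SB SD ->]]]; apply: (PS) => //; exact: IH.
Qed.

Lemma compositions_sub S S' m A : S `<=` S' -> compositions S m A -> compositions S' m A.
Proof. by move=> SS' [F SF ->]; exists F => // k; exact: SS'. Qed.

Lemma compositions_unitary S m A : (forall B, S B -> B \is unitarymx) ->
  compositions S m A -> A \is unitarymx.
Proof.
move=> SU; apply: (@compositions_ind S (fun _ A => A \is unitarymx)).
  exact: unitarymx1.
by move=> {}m {}A B _ Au /SU; exact: unitarymxM.
Qed.

Lemma compositions_adj S m A : (forall B, S B -> S (B^t*)) ->
  compositions S m A -> compositions S m (A^t*).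
Proof.
move=> Sadj; apply: (@compositions_ind S (fun m A => compositions S m (A^t*))).
  by rewrite dag1; exact: compositions0.
move=> {}m {}A B _ Au SB; rewrite dagM -add1n; apply: compositionsD => //.
exact/compositions1/Sadj.
Qed.

End Compositions.
End Norms.
Opaque opnorm.

(** * Topology of the unitary and projective unitary groups *)

Section Topology.
Variables (R : realType) (d : nat).
Implicit Types A B : U R d.

Lemma mx_of_unitary A : mx_of A \is unitarymx.
Proof. exact: set_valP A. Qed.

Lemma mx_of_ex (M : 'M[Cplx R]_d) : M \is unitarymx -> exists A : U R d, mx_of A = M.
Proof. by move=> /mem_set Mu; exists (exist _ M Mu). Qed.

(** Each entry is bounded by the operator norm, and the operator norm by the sum of the entries, so
    the entrywise topology is that of the norm. *)
Lemma nbhs_matrix_opnorm (M : 'M[Cplx R]_d) (P : set 'M[Cplx R]_d) :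
  nbhs M P <-> exists2 e : R, 0 < e & forall N, opnorm (M - N) < e -> P N.
Proof.
split.
  case=> Q QM QP.
  have /choice[f fP] (ij : 'I_d * 'I_d) : exists e : R,
      0 < e /\ forall z, cabs (M ij.1 ij.2 - z) < e -> Q ij.1 ij.2 z.
    have /nbhs_ballP[e e0 eQ] := QM ij.1 ij.2.
    (* The radius of a ball is an element of [Cplx R]; being positive, it is real. *)
    exists (complex.Re e); case: e e0 eQ => a b /=; rewrite ltcE /= => /andP[/eqP -> a0] eQ.
    by split=> // z zl; apply: eQ; rewrite /ball /= -cabsE ltcR.
  pose e := \big[Num.min/1]_ij f ij.
  have e0 : 0 < e by apply: lt_bigmin => // ij _; have [] := fP ij.
  exists e => // N Ne; apply: QP => i j; have [_] := fP (i, j); apply.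
  apply: le_lt_trans (lt_le_trans Ne _); last exact: bigmin_le_cond.
  by have := cabs_le_opnorm (M - N) i j; rewrite !mxE.
(* The successor makes the sum of the d ^ 2 entry bounds strictly smaller than e, also when d =
   0. *)
case=> e e0 eP; exists (fun i j => [set z | cabs (M i j - z) < e / (d * d).+1%:R]).
  move=> i j; apply/nbhs_ballP; exists ((e / (d * d).+1%:R)%:C).
    by rewrite /= ltcR divr_gt0 // ltr0n.
  by move=> z; rewrite /ball /= -cabsE ltcR.
move=> N NQ; apply: eP.
apply: le_lt_trans (opnorm_entries _) _.
apply: (@le_lt_trans _ _ (\sum_(i < d) \sum_(j < d) e / (d * d).+1%:R)).
  by apply: ler_sum => i _; apply: ler_sum => j _; rewrite !mxE ltW // NQ.
rewrite !sumr_const !card_ord -mulrnA -[X in X < _]mulr_natr mulrAC ltr_pdivrMr ?ltr0n //.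
by rewrite ltr_pM2l // ltr_nat.
Qed.

Lemma open_opnorm (O : set (U R d)) : open O <->
  forall A, O A -> exists2 e : R, 0 < e &
    forall B, opnorm (mx_of A - mx_of B) < e -> O B.
Proof.
split.
  case=> V oV <- A VA.
  have /nbhs_matrix_opnorm[e e0 eV] := open_nbhs_nbhs (conj oV VA).
  by exists e => // B AB; exact: eV.
move=> H.
(* The ambient open set is the union of the balls that are centred in [O] and whose unitary points
   all lie in [O]. *)
pose V := [set M : 'M[Cplx R]_d | exists2 A, O A & exists2 e : R, 0 < e &
  opnorm (mx_of A - M) < e /\ forall B, opnorm (mx_of A - mx_of B) < e -> O B].
exists V.
  rewrite openE => M [A OA [e e0 [Me He]]]; apply/nbhs_matrix_opnorm.
  exists (e - opnorm (mx_of A - M)); first by rewrite subr_gt0.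
  move=> N NM; exists A; first exact: OA.
  exists e; first exact: e0.
  split; last exact: He.
  apply: le_lt_trans (opnormB_trans _ M _) _; rewrite -ltrBrDl; exact: NM.
apply/seteqP; split=> B.
  by move=> [A OA [e e0 [Be]]]; apply.
move=> OB; have [e e0 He] := H _ OB; exists B => //; exists e => //; split=> //.
by rewrite subrr opnorm0.
Qed.

Lemma PUclass_eqP A B : PUclass A = PUclass B <->
  exists2 z : Cplx R, `|z| = 1 & mx_of A = z *: mx_of B.
Proof.
have -> : (PUclass A = PUclass B) <-> phase_eq A B.
  by split=> [/eqmodP //|AB]; apply/eqmodP.
by split=> [/asboolP|AB] //; apply/asboolP.
Qed.

Lemma PUclass_surj (G : PU R d) : exists A, PUclass A = G.
Proof. by exists (repr G); rewrite /PUclass reprK. Qed.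

Lemma open_PU (O : set (PU R d)) : open O <-> open (@PUclass R d @^-1` O).
Proof. by []. Qed.

Lemma expi_norm (t : R) : `|expi t| = 1.
Proof.
by apply/eqP; rewrite -cabs_eq1 -(@eqrXn2 _ 2) ?cabs_ge0 // cabs_sqr /= cos2Dsin2 expr1n.
Qed.

Lemma expi_ex (z : Cplx R) : `|z| = 1 -> exists t : R, z = expi t.
Proof.
move=> /eqP; rewrite -cabs_eq1 => /eqP z1; have := cabs_sqr z; rewrite z1 expr1n.
case: z z1 => a b /= _ ab1.
have a1 : -1 <= a <= 1.
  by rewrite -ler_norml -(@ler_pXn2r _ 2) ?nnegrE // expr1n real_normK ?num_real // ab1 lerDl sqr_ge0.
have sb : Num.sqrt (1 - a ^+ 2) = `|b| by rewrite ab1 addrC addKr sqrtr_sqr.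
have [b0|b0] := leP 0 b.
  by exists (acos a); rewrite /expi acosK ?in_itv //= sin_acos // sb ger0_norm.
exists (- acos a); rewrite /expi cosN sinN acosK ?in_itv //= sin_acos // sb.
by rewrite ltr0_norm // opprK.
Qed.

End Topology.

(** * First order estimates *)

(* [ring] does not apply to matrices; additive identities between products are
   checked entrywise with the products taken as atoms. *)
Ltac mx_expand :=
  rewrite ?(mulrDl, mulrDr, mulrBl, mulrBr, mulNr, mulrN, mul1r, mulr1, opprK, mulrA).
Ltac mx_abel :=
  repeat match goal with |- context [@GRing.mul ?T ?A ?B] =>
    match type of (A *m B) with ?U => change (@GRing.mul T A B) with (A *m B : U) end end;
  repeat match goal with |- context [?A *m ?B] => generalize (A *m B); intro end;
  let i := fresh "i" in let j := fresh "j" in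
  apply/matrixP => i j; rewrite !mxE; ring.
Ltac mx_ring := mx_expand; mx_abel.

(* [lra] compares its atoms up to conversion, which diverges on norms. *)
Ltac norm_gen :=
  repeat match goal with H : context [@opnorm _ _ _] |- _ => revert H end;
  repeat match goal with |- context [@opnorm ?S ?n ?X] =>
    generalize (@opnorm S n X); intro end.
Ltac norm_lra := norm_gen; intros; lra.

Section FirstOrder.
Variables (R : realType) (d : nat).
Local Notation C := (Cplx R).
Implicit Types (h k A B X Y : 'M[C]_d).

(* [h k h^* k^* - 1 = ((h - 1) (k - 1) - (k - 1) (h - 1)) h^* k^*]. *)
Lemma commutator_first_order h k A B (a e : R) :
  h \is unitarymx -> k \is unitarymx ->
  opnorm (h - 1 - A) <= e -> opnorm (k - 1 - B) <= e ->
  opnorm A <= a -> opnorm B <= a ->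
  opnorm (h * k * h^t* * k^t* - 1 - (A * B - B * A))
    <= 4 * a * e + 2 * e ^+ 2 + 4 * (a + e) ^+ 3.
Proof.
move=> hu ku he ke Aa Ba.
have e0 : 0 <= e by apply: le_trans he; exact: opnorm_ge0.
have a0 : 0 <= a by apply: le_trans Aa; exact: opnorm_ge0.
have bound (E F : 'M[C]_d) (x : R) (E1 : opnorm (E - 1 - F) <= e) : opnorm F <= x -> opnorm (E - 1) <= x + e.
  by move=> Fx; rewrite -(subrK F (E - 1)) addrC; apply: le_trans (opnormD _ _) _; exact: lerD.
have Ph := bound _ _ _ he Aa; have Qk := bound _ _ _ ke Ba.
pose P := h - 1; pose Q := k - 1.
have hkE : h * k - k * h = P * Q - Q * P by rewrite /P /Q; mx_ring.
have hk1 : h * k * h^t* * k^t* - 1 = (P * Q - Q * P) * (h^t* * k^t*).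
  rewrite -hkE mulrBl !mulrA; congr (_ - _).
  by rewrite -(mulrA k) unitarymx_mulVr // mulr1 unitarymx_mulVr.
have -> : h * k * h^t* * k^t* - 1 - (A * B - B * A) =
   (P * Q - Q * P) * (h^t* * k^t* - 1) +
   ((P - A) * Q + A * (Q - B) - ((Q - B) * P + B * (P - A))).
  rewrite hk1; clear; clearbody P Q; move: (h^t* * k^t*) => g; mx_ring.
have g1 : opnorm (h^t* * k^t* - 1) <= 2 * (a + e).
  have := @opnormM_sub R d (h^t*) 1 (k^t*) 1 (unitarymx1 _ _) (adj_unitary ku).
  rewrite mulr1; move/le_trans; apply.
  have hh := @opnorm_adj_sub R d _ _ hu (unitarymx1 _ _).
  have kk := @opnorm_adj_sub R d _ _ ku (unitarymx1 _ _).
  rewrite !dag1 in hh kk.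
  apply: le_trans (lerD (le_trans hh Ph) (le_trans kk Qk)) _; norm_lra.
have opM2 (x y : R) (E F : 'M[C]_d) : opnorm E <= x -> opnorm F <= y -> opnorm (E * F) <= x * y.
  move=> Ex Fy; apply: le_trans (opnormM _ _) _.
  by apply: ler_pM => //; exact: opnorm_ge0.
have PQ := opM2 _ _ _ _ Ph Qk; have QP := opM2 _ _ _ _ Qk Ph.
have c1 := opM2 _ _ _ _ he Qk; have c2 := opM2 _ _ _ _ Aa ke.
have c3 := opM2 _ _ _ _ ke Ph; have c4 := opM2 _ _ _ _ Ba he.
have PQQP : opnorm (P * Q - Q * P) <= 2 * (a + e) ^+ 2.
  apply: le_trans (opnormD _ _) _; rewrite opnormN -/P -/Q in PQ QP *; norm_lra.
have c34 : opnorm (- ((k - 1 - B) * P + B * (h - 1 - A))) <= e * (a + e) + a * e.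
  by rewrite opnormN; exact: le_trans (opnormD _ _) (lerD c3 c4).
have c12 := le_trans (opnormD _ _) (lerD c1 c2).
apply: le_trans (opnormD _ _) _.
apply: le_trans (lerD (opM2 _ _ _ _ PQQP g1) (le_trans (opnormD _ _) (lerD c12 c34))) _.
by rewrite le_eqVlt; apply/orP; left; apply/eqP; ring.
Qed.

Lemma mul_first_order h k A B (e e' : R) :
  k \is unitarymx ->
  opnorm (h - 1 - A) <= e -> opnorm (k - 1 - B) <= e' ->
  opnorm (h * k - 1 - (A + B)) <= e + opnorm A * (opnorm B + e') + e'.
Proof.
move=> ku he ke.
have -> : h * k - 1 - (A + B) = (h - 1 - A) * k + (A * (k - 1) + (k - 1 - B)) by mx_ring.
have k1 : opnorm (k - 1) <= opnorm B + e'.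
  by rewrite -(subrK B (k - 1)) addrC; apply: le_trans (opnormD _ _) _; exact: lerD.
apply: le_trans (opnormD _ _) _; rewrite -[X in _ <= X]addrA; apply: lerD.
  exact: le_trans (opnormM_unitaryr _ ku) he.
apply: le_trans (opnormD _ _) _; apply: lerD => //.
apply: le_trans (opnormM _ _) _.
by rewrite ler_wpM2l ?opnorm_ge0.
Qed.

End FirstOrder.

(** * Generators of the unitary Lie algebra *)

Section Generators.
Variables (R : realType) (d : nat).
Local Notation C := (Cplx R).
Implicit Types (a b : 'I_d) (X Y : 'M[C]_d).

Definition iC : C := 0 +i* 1.

Lemma iC_sqr : iC * iC = -1.
Proof. exact: sqr_i. Qed.

Lemma conj_iC : (iC^* = - iC)%R.
Proof. exact: conjCi. Qed.

Lemma conj_real (t : R) : ((t%:C : C)^* = t%:C)%R.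
Proof. by apply: conj_Creal; rewrite realE !lecR; exact: le_total. Qed.

Lemma cplxE (z : C) : z = (complex.Re z)%:C + (complex.Im z)%:C * iC.
Proof. by rewrite {1}[z]complexE mulrC. Qed.

Lemma conj_cplx (z : C) : (z^* = (complex.Re z)%:C - (complex.Im z)%:C * iC)%R.
Proof. by rewrite {1}[z]cplxE rmorphD rmorphM /= !conj_real conj_iC mulrN. Qed.

Lemma Re_conj (z : C) : complex.Re (z^*)%R = complex.Re z.
Proof. by rewrite conj_cplx; case: z => x y /=; ring. Qed.

Lemma Im_conj (z : C) : complex.Im (z^*)%R = - complex.Im z.
Proof. by rewrite conj_cplx; case: z => x y /=; ring. Qed.

Definition antiherm X := X^t* = - X.

Lemma skewZ (t : R) X : antiherm X -> antiherm (t%:C *: X).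
Proof. by rewrite /antiherm dagZ conj_real => ->; rewrite scalerN. Qed.

(** For a != b these three are, on the plane of e_a and e_b, i times the Pauli matrices sigma_y,
    sigma_x and sigma_z. They multiply like the quaternion units, whence the brackets and the cubes
    below. *)
Definition genK a b : 'M[C]_d := delta_mx a b - delta_mx b a.
Definition genS a b : 'M[C]_d := iC *: (delta_mx a b + delta_mx b a).
Definition genZ a b : 'M[C]_d := iC *: (delta_mx a a - delta_mx b b).

Lemma dag_delta a b : (delta_mx a b : 'M[C]_d)^t* = delta_mx b a.
Proof. by rewrite trmx_delta map_delta_mx. Qed.

Lemma skew_genK a b : antiherm (genK a b).
Proof. by rewrite /antiherm /genK dagD dagN !dag_delta opprB. Qed.

Lemma skew_genS a b : antiherm (genS a b).
Proof. by rewrite /antiherm /genS dagZ dagD !dag_delta conj_iC scaleNr addrC. Qed.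

Lemma skew_genZ a b : antiherm (genZ a b).
Proof. by rewrite /antiherm /genZ dagZ dagD dagN !dag_delta conj_iC scaleNr. Qed.

Section Brackets.
Variables a b : 'I_d.
Hypothesis ab : a != b.
Let ba : (b == a) = false. Proof. by rewrite eq_sym; exact: negPf. Qed.

Ltac gens := rewrite /genK /genS /genZ -![_ * _]/(_ *m _)
  ?(=^~ scalemxAl, =^~ scalemxAr, mulmxDl, mulmxDr, mulmxBl, mulmxBr, mulNmx, mulmxN)
  ?mul_delta_mx_cond ?eqxx ?ba ?(negPf ab) ?mulr1n ?mulr0n
  ?(addr0, add0r, subr0, sub0r, oppr0, opprK).

Lemma genKS : genK a b * genS a b = genZ a b.
Proof. gens; by []. Qed.
Lemma genSK : genS a b * genK a b = - genZ a b.
Proof. gens; by rewrite -scalerN opprD opprK addrC. Qed.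
Lemma genZK : genZ a b * genK a b = genS a b.
Proof. gens; by []. Qed.
Lemma genKZ : genK a b * genZ a b = - genS a b.
Proof. gens; by rewrite -scalerN opprD. Qed.
Lemma genSZ : genS a b * genZ a b = genK a b.
Proof. gens; by rewrite -scalerDr scalerA iC_sqr scaleN1r opprD opprK. Qed.
Lemma genZS : genZ a b * genS a b = - genK a b.
Proof. gens; by rewrite scalerA iC_sqr scaleN1r. Qed.
End Brackets.


Lemma gen_cube a b : a != b ->
  [/\ genK a b * genK a b * genK a b = - genK a b,
      genS a b * genS a b * genS a b = - genS a b
    & genZ a b * genZ a b * genZ a b = - genZ a b].
Proof.
move=> ab; split.
- by rewrite -{2}(genSZ ab) mulrA genKS // -mulrA genZK // genZS.
- by rewrite -{2}(genZK ab) mulrA genSZ // -mulrA genKS // genKZ.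
- by rewrite -{2}(genKS ab) mulrA genZK // -mulrA genSZ // genSK.
Qed.

Lemma gen_bracket a b : a != b ->
  [/\ genK a b * genS a b - genS a b * genK a b = genZ a b *+ 2,
      genS a b * genZ a b - genZ a b * genS a b = genK a b *+ 2
    & genZ a b * genK a b - genK a b * genZ a b = genS a b *+ 2].
Proof.
move=> ab; split.
- by rewrite (genKS ab) (genSK ab) opprK mulr2n.
- by rewrite (genSZ ab) (genZS ab) opprK mulr2n.
- by rewrite (genZK ab) (genKZ ab) opprK mulr2n.
Qed.

Lemma opnorm_delta a b : opnorm (delta_mx a b : 'M[C]_d) <= 1.
Proof.
apply: le_trans (opnorm_entries _) _.
rewrite (bigD1 a) //= [X in _ + X]big1 ?addr0; last first.
  by move=> i ia; rewrite big1 // => j _; rewrite mxE (negPf ia) cabs0.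
rewrite (bigD1 b) //= big1 ?addr0 ?mxE ?eqxx ?cabs1 // => j jb.
by rewrite mxE (negPf jb) andbF cabs0.
Qed.

Lemma cabs_iC : cabs iC = 1.
Proof. by rewrite /cabs /= expr0n expr1n /= add0r sqrtr1. Qed.

Lemma opnorm_gen a b :
  [/\ opnorm (genK a b) <= 2, opnorm (genS a b) <= 2 & opnorm (genZ a b) <= 2].
Proof.
have H c c' e e' : opnorm (delta_mx c c' - delta_mx e e' : 'M[C]_d) <= 2.
  apply: le_trans (opnormD _ _) _; rewrite opnormN.
  exact: lerD (opnorm_delta _ _) (opnorm_delta _ _).
have H' c c' e e' : opnorm (delta_mx c c' + delta_mx e e' : 'M[C]_d) <= 2.
  apply: le_trans (opnormD _ _) _.
  exact: lerD (opnorm_delta _ _) (opnorm_delta _ _).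
split; first exact: H.
- by apply: le_trans (opnormZ_le _ _) _; rewrite cabs_iC mul1r.
- by apply: le_trans (opnormZ_le _ _) _; rewrite cabs_iC mul1r.
Qed.

Lemma skew_Re X i j : antiherm X -> complex.Re (X j i) = - complex.Re (X i j).
Proof.
move=> /matrixP/(_ i j); rewrite !mxE => /(congr1 (@complex.Re R)).
by rewrite Re_conj; case: (X i j).
Qed.

Lemma skew_Im X i j : antiherm X -> complex.Im (X j i) = complex.Im (X i j).
Proof.
move=> /matrixP/(_ i j); rewrite !mxE => /(congr1 (@complex.Im R)).
by rewrite Im_conj; case: (X i j) => x y /= /oppr_inj.
Qed.

(* The diagonal part rests on [d i E_aa = i 1 + \sum_b i (E_aa - E_bb)]. *)
Definition skew_part X (p : 'I_d * 'I_d) : 'M[C]_d :=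
  (complex.Re (X p.1 p.2) / 2)%:C *: genK p.1 p.2
  + ((complex.Im (X p.1 p.2) / 2)%:C *: genS p.1 p.2
  + (complex.Im (X p.1 p.1) / d%:R)%:C *: genZ p.1 p.2).

Lemma skew_part_diag X p i : p.1 != p.2 ->
  skew_part X p i i =
  (complex.Im (X p.1 p.1) / d%:R)%:C * (iC * ((i == p.1)%:R - (i == p.2)%:R)).
Proof.
case: p => a b ab; rewrite /skew_part !mxE.
case: (eqVneq i a) => [ia|_]; case: (eqVneq i b) => [ib|_]; last 3 first.
- by rewrite /= !mulr0n !(subr0, addr0, mulr0, add0r).
- by rewrite /= !mulr0n !(subr0, addr0, mulr0, add0r).
- by rewrite /= !mulr0n !(subr0, addr0, mulr0, add0r).
by move: ab; rewrite /= -ia -ib eqxx.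
Qed.

Lemma skew_diag X k : antiherm X -> X k k = (complex.Im (X k k))%:C * iC.
Proof.
move=> Xs; rewrite {1}[X k k]cplxE; have := skew_Re k k Xs.
case: (X k k) => x y /= H; have -> : x = 0 by lra.
by rewrite rmorph0 add0r.
Qed.

Lemma skew_part_offdiag X p i j : i != j -> p.1 != p.2 ->
  skew_part X p i j =
  (if p == (i, j) then (complex.Re (X i j) / 2)%:C + (complex.Im (X i j) / 2)%:C * iC else 0)
  + (if p == (j, i) then - (complex.Re (X j i) / 2)%:C + (complex.Im (X j i) / 2)%:C * iC else 0).
Proof.
case: p => a b ij ab; rewrite /skew_part !mxE !xpair_eqE !(eq_sym _ i) !(eq_sym _ j).
move: ij ab => /= /eqP ij /eqP ab.
by case: (i =P a) => [ia|_]; case: (j =P b) => [jb|_]; case: (i =P b) => [ib|_];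
  case: (j =P a) => [ja|_]; subst; rewrite /= ?mulr0n ?mulr1n //;
  rewrite !(subr0, addr0, mulr0, add0r, mulr1, sub0r, oppr0, mulrN1).
Qed.

(** Each pair of distinct indices is met in both orders, hence the halves in [skew_part]: real part
    and [genK] both change sign with the order, imaginary part and [genS] both keep it, so the two
    contributions are equal. *)
Lemma skew_decomposition X : antiherm X ->
  X = (\sum_a complex.Im (X a a) / d%:R)%:C *: (iC *: 1%:M)
      + \sum_(p : 'I_d * 'I_d | p.1 != p.2) skew_part X p :> 'M[C]_d.
Proof.
move=> Xs; apply/matrixP => i j; rewrite !mxE summxE.
have [<-{j}|ij] := eqVneq i j.
  rewrite mulr1n mulr1.
  rewrite (eq_bigr _ (fun p pp => skew_part_diag X i pp)).
  have -> : \sum_(p : 'I_d * 'I_d | p.1 != p.2) (complex.Im (X p.1 p.1) / d%:R)%:C * (iC * ((i == p.1)%:R - (i == p.2)%:R))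
    = \sum_(p : 'I_d * 'I_d) (complex.Im (X p.1 p.1) / d%:R)%:C * (iC * ((i == p.1)%:R - (i == p.2)%:R)).
    rewrite [RHS](bigID (fun p => p.1 != p.2)) /= [X in _ = _ + X]big1 ?addr0 //.
    by move=> [a b] /= /negPn/eqP ->; rewrite subrr !mulr0.
  rewrite -(pair_bigA _ (fun a b => (complex.Im (X a a) / d%:R)%:C * (iC * ((i == a)%:R - (i == b)%:R)))) /=.
  have d0 : (d%:R : R) != 0 by rewrite pnatr_eq0 -lt0n; case: d i => // -[].
  have E (a : 'I_d) : \sum_b (complex.Im (X a a) / d%:R)%:C * (iC * ((i == a)%:R - (i == b)%:R))
     = (complex.Im (X a a) / d%:R)%:C * iC * (d%:R * (i == a)%:R)
       - (complex.Im (X a a) / d%:R)%:C * iC.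
    rewrite -!mulr_sumr mulrA -[X in _ = _ - X]mulr1 -mulrBr; congr (_ * _).
    rewrite sumrB sumr_const card_ord (bigD1 i) //= eqxx big1; last first.
      by move=> b; rewrite eq_sym => /negPf ->.
    by rewrite addr0 mulr_natl.
  rewrite (eq_bigr _ (fun a _ => E a)).
  have S2 : \sum_a (complex.Im (X a a) / d%:R)%:C * iC = (\sum_a complex.Im (X a a) / d%:R)%:C * iC.
    by rewrite rmorph_sum mulr_suml.
  rewrite sumrB S2 addrC subrK.
  rewrite (bigD1 i) //= eqxx big1 ?addr0; last first.
    by move=> b; rewrite eq_sym => /negPf ->; rewrite !mulr0.
  rewrite mulr1 mulrAC -(rmorph_nat (real_complex R)) -rmorphM /= divfK //.
  exact: skew_diag.
rewrite mulr0n !mulr0 add0r.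
rewrite (eq_bigr _ (fun p pp => skew_part_offdiag X ij pp)).
rewrite big_split /= -!big_mkcondr /=.
rewrite (big_pred1 (i, j)); last first.
  by move=> [a b] /=; rewrite andbC; case: eqP => // -[-> ->].
rewrite (big_pred1 (j, i)); last first.
  by move=> [a b] /=; rewrite andbC; case: eqP => // -[-> ->]; rewrite eq_sym.
rewrite (skew_Re i j Xs) (skew_Im i j Xs) {1}[X i j]cplxE.
case: (X i j) => x y /=; rewrite -!rmorphN /=.
apply/eqP; rewrite eq_complex /=; by apply/andP; split; apply/eqP; field.
Qed.

(* [exp (t Y)] with [s = sin t], when [Y ^ 3 = - Y] and [cos t >= 0]. *)
Definition rotation Y (s : R) : 'M[C]_d :=
  1 + s%:C *: Y + (1 - Num.sqrt (1 - s ^+ 2))%:C *: (Y * Y).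

Lemma rotation_unitary Y s : antiherm Y -> Y * Y * Y = - Y -> `|s| <= 1 ->
  rotation Y s \is unitarymx.
Proof.
move=> Ys Y3 s1; apply/unitarymxP.
have r2 : Num.sqrt (1 - s ^+ 2) ^+ 2 = 1 - s ^+ 2.
  by rewrite sqr_sqrtr // subr_ge0 -real_normK ?num_real // expr_le1.
have Y4 : Y * Y * (Y * Y) = - (Y * Y) by rewrite mulrA Y3 mulNr.
have Y3' : Y * (Y * Y) = - Y by rewrite mulrA.
rewrite /rotation !dagD !dagZ dag1 dagM !conj_real Ys mulrNN scalerN.
set c := (1 - _)%:C; set t := s%:C.
(* With c = 1 - cos and t = sin this is cos ^ 2 + sin ^ 2 = 1. *)
have ct : 2 * c - c * c - t * t = 0.
  rewrite /c /t; move: (Num.sqrt _) r2 => r r2.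
  rewrite -(rmorph_nat (real_complex R)) -!rmorphM -!rmorphB /=.
  suff -> : 2 * (1 - r) - (1 - r) * (1 - r) - s * s = 0 by [].
  have := r2; nra.
rewrite -[_ *m _]/(_ * _) !mulrDl !mulrDr !mulrN !mulr1 !mul1r.
rewrite -![_ * _]/(_ *m _) -!scalemxAl -!scalemxAr -![_ *m _]/(_ * _).
rewrite Y3' Y3 Y4 !scalerA.
have tE : t * t = 2 * c - c * c by rewrite -[RHS]subr0 -ct; ring.
have lin (Z : 'M[C]_d) (x y : C) : 1 - y *: Y + x *: Z +
    (y *: Y - (2 * x - x * x) *: Z + (y * x) *: - Y) +
    (x *: Z - (x * y) *: - Y + (x * x) *: - Z) = 1.
  by apply/matrixP => i j; rewrite !mxE; ring.
by rewrite tE; exact: lin.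
Qed.

Lemma rotation_first_order Y s : `|s| <= 1 ->
  opnorm (rotation Y s - 1 - s%:C *: Y) <= s ^+ 2 * opnorm Y ^+ 2.
Proof.
move=> s1.
have -> : rotation Y s - 1 - s%:C *: Y = (1 - Num.sqrt (1 - s ^+ 2))%:C *: (Y * Y).
  by rewrite /rotation; mx_abel.
have s2 : 0 <= 1 - s ^+ 2 by rewrite subr_ge0 -real_normK ?num_real // expr_le1.
have r2 := sqr_sqrtr s2; have r0 := sqrtr_ge0 (1 - s ^+ 2).
apply: le_trans (opnormZ_le _ _) _; rewrite cabs_real expr2.
apply: ler_pM => //; rewrite ?opnorm_ge0 //; last by rewrite expr2; exact: opnormM.
rewrite ler_norml; have := sqr_ge0 s; move: r2 r0; move: (Num.sqrt _) => r r2 r0; nra.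
Qed.

End Generators.

(** * Unitary diagonalisation *)

Section Expi.
Variable R : realType.
Local Notation C := (Cplx R).

Lemma derive0_first_order (f : R -> R) (l : R) : is_derive (0 : R) 1 f l ->
  forall e : R, 0 < e -> exists2 del : R, 0 < del &
    forall t : R, `|t| < del -> `|f t - f 0 - t * l| <= e * `|t|.
Proof.
move=> [fd fl] e e0; have := fd; rewrite /derivable => /cvg_ex[l' fl'].
have l'E : l' = l by rewrite -fl /derive; apply/esym/cvg_lim.
move: fl'; rewrite l'E => /cvgrPdist_le/(_ e e0).
rewrite near_withinE => /nbhs_ballP[del /= del0 H]; exists del => // t tdel.
have [->|t0] := eqVneq t 0; first by rewrite !mul0r subrr subr0 normr0 mulr0.
have := H t; rewrite /ball /= sub0r normrN => /(_ tdel t0).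
rewrite /GRing.scale /= mulr1 addr0 => H1.
have -> : f t - f 0 - t * l = t * (- (l - t^-1 * (f t - f 0))).
  by rewrite opprB mulrBr mulrA mulfV // mul1r.
by rewrite normrM normrN mulrC ler_wpM2r.
Qed.

Lemma expi_first_order (e : R) : 0 < e -> exists2 del : R, 0 < del &
  forall t : R, `|t| < del -> cabs (expi t - 1 - t%:C * iC R) <= e * `|t|.
Proof.
move=> e0; have e20 : 0 < e / 2 by rewrite divr_gt0.
have [d1 d10 H1] := derive0_first_order (is_derive_sin 0) e20.
have [d2 d20 H2] := derive0_first_order (is_derive_cos 0) e20.
exists (Num.min d1 d2); first by rewrite lt_min d10.
move=> t; rewrite lt_min => /andP[/H1 {}H1 /H2 {}H2].
apply: le_trans (cabs_le_ReIm _) _.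
move: H1 H2; rewrite sin0 cos0 oppr0 mulr0 mulr1 !(subr0, addr0) => H1 H2.
rewrite /= !(mulr0, mul0r, mulr1, addr0, subr0, oppr0, add0r).
rewrite (splitr e) mulrDl; exact: lerD H2 H1.
Qed.

Lemma expiD (s t : R) : expi (s + t) = expi s * expi t.
Proof.
by apply/eqP; rewrite eq_complex /= cosD sinD eqxx /= addrC.
Qed.

Lemma expi0 : expi (0 : R) = 1.
Proof. by rewrite /expi cos0 sin0. Qed.

Lemma expiX (t : R) n : expi t ^+ n = expi (n%:R * t).
Proof.
elim: n => [|n IH]; first by rewrite mul0r expi0.
by rewrite exprS IH -expiD -(addn1 n) natrD mulrDl mul1r addrC.
Qed.

End Expi.

Section Diagonal.
Variables (R : realType) (d : nat).
Local Notation C := (Cplx R).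

Lemma opnormX_sub (A B : 'M[C]_d) n : A \is unitarymx -> B \is unitarymx ->
  opnorm (A ^+ n - B ^+ n) <= n%:R * opnorm (A - B).
Proof.
move=> Au Bu; have Xu (E : 'M[C]_d) k : E \is unitarymx -> E ^+ k \is unitarymx.
  by move=> Eu; elim: k => [|k IH]; [exact: unitarymx1|rewrite exprS unitarymxM].
elim: n => [|n IH]; first by rewrite !expr0 subrr opnorm0 mul0r.
rewrite !exprS; apply: le_trans (opnormM_sub _ _ Bu (Xu _ _ Au)) _.
by rewrite -add1n natrD mulrDl mul1r lerD2l.
Qed.

Definition frame (P : 'M[C]_d) (z : 'rV[C]_d) : 'M[C]_d := P^t* * diag_mx z * P.

Lemma opnorm_frame_le P z : P \is unitarymx ->
  opnorm (frame P z) <= \sum_i cabs (z 0 i).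
Proof.
move=> Pu; apply: le_trans (opnormM_unitaryr _ Pu) _.
apply: le_trans (opnormM_unitaryl _ (adj_unitary Pu)) _.
apply: le_trans (opnorm_entries _) _; apply: ler_sum => i _.
rewrite (bigD1 i) //= !mxE eqxx big1 ?addr0 // => j ji.
by rewrite !mxE eq_sym (negPf ji) cabs0.
Qed.

Lemma frameB P (z w : 'rV[C]_d) : frame P (z - w) = frame P z - frame P w.
Proof. by rewrite /frame linearB mulrBr mulrBl. Qed.

Lemma frameZ P (a : C) (z : 'rV[C]_d) : frame P (a *: z) = a *: frame P z.
Proof. by rewrite /frame linearZ -![_ * _]/(_ *m _) -scalemxAr -scalemxAl. Qed.

Lemma frame1 P : P \is unitarymx -> frame P (const_mx 1) = 1.
Proof.
by move=> Pu; rewrite /frame diag_const_mx mulr1 unitarymx_mulV.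
Qed.

Lemma frameM P (z w : 'rV[C]_d) : P \is unitarymx ->
  frame P z * frame P w = frame P (\row_i (z 0 i * w 0 i)).
Proof.
move=> Pu.
have -> : frame P z * frame P w = P^t* * (diag_mx z * (P * P^t*) * diag_mx w) * P.
  by rewrite /frame !mulrA.
by rewrite (unitarymx_mulVr Pu) mulr1 -[diag_mx z * _]/(_ *m _) mulmx_diag.
Qed.

Lemma frameX P (z : 'rV[C]_d) n : P \is unitarymx ->
  frame P z ^+ n = frame P (\row_i z 0 i ^+ n).
Proof.
move=> Pu; elim: n => [|n IH].
  rewrite expr0 -[LHS](frame1 Pu).
  have -> : \row_i z 0 i ^+ 0 = const_mx 1 by apply/rowP => i; rewrite !mxE.
  by [].
rewrite exprS IH (frameM _ _ Pu).
have -> // : \row_i (z 0 i * (\row_i0 z 0 i0 ^+ n) 0 i) = \row_i z 0 i ^+ n.+1.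
by apply/rowP => i; rewrite !mxE exprS.
Qed.

Lemma frame_dag P (z : 'rV[C]_d) : (frame P z)^t* = frame P (map_mx Num.conj z).
Proof.
rewrite /frame !dagM dagK mulrA; congr (_ * _ * _).
by rewrite tr_diag_mx map_diag_mx.
Qed.

Lemma frame_unitary P (z : 'rV[C]_d) : P \is unitarymx ->
  (forall i, `|z 0 i| = 1) -> frame P z \is unitarymx.
Proof.
move=> Pu z1; apply/unitarymxP; rewrite frame_dag -[_ *m _]/(_ * _) frameM //.
rewrite -[1%:M](frame1 Pu); congr frame; apply/rowP => i.
by rewrite !mxE -normCK z1 expr1n.
Qed.

Lemma unitary_diag (A : 'M[C]_d) : A \is unitarymx ->
  exists (P : 'M[C]_d) (z : 'rV[C]_d), [/\ P \is unitarymx, forall i, `|z 0 i| = 1 & A = frame P z].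
Proof.
move=> Au; have An : A \is normalmx.
  by rewrite qualifE; apply/eqP; rewrite (unitarymxP Au); exact/esym/unitarymx_mulV.
pose P := spectralmx A; pose z := spectral_diag A.
have Pu : P \is unitarymx := spectral_unitarymx A.
have AE : A = frame P z by rewrite {1}(orthomx_spectralP An) invmx_unitary.
exists P, z; split=> // i; have DE : diag_mx z = P * A * P^t*.
  rewrite AE /frame !mulrA unitarymx_mulVr // mul1r -mulrA unitarymx_mulVr //.
  by rewrite mulr1.
have /matrixP/(_ i i) : diag_mx z *m (diag_mx z)^t* = 1%:M.
  apply/unitarymxP; rewrite DE; apply: unitarymxM; last exact: adj_unitary.
  exact: unitarymxM.
rewrite tr_diag_mx map_diag_mx mulmx_diag !mxE eqxx !mulr1n -normCK => /eqP.
by rewrite sqrp_eq1 ?normr_ge0 // => /eqP.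
Qed.

End Diagonal.

(** * Tangent vectors of a group of unitaries *)

Section Tangent.
Variables (R : realType) (d : nat).
Local Notation C := (Cplx R).
Variable S : set 'M[C]_d.
Hypothesis SU : forall A, S A -> A \is unitarymx.
Hypothesis S1 : S 1.
Hypothesis SM : forall A B, S A -> S B -> S (A * B).
Hypothesis Sdag : forall A, S A -> S (A^t*).
Implicit Types (A B X Y : 'M[C]_d).

Definition tangent X := forall e : R, 0 < e -> exists2 del : R, 0 < del &
  forall t : R, `|t| < del ->
    exists2 h, S h & opnorm (h - 1 - t%:C *: X) <= e * `|t|.

Lemma tangentD X Y : tangent X -> tangent Y -> tangent (X + Y).
Proof.
move=> TX TY e e0.
have real_bound (u x y a b : R) : 0 <= u -> 0 <= x -> 0 <= y ->
    0 <= a -> a <= u * x -> 0 <= b -> b <= u * y ->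
    u * (x * (y + e / 4) + 1) <= e / 2 ->
    e / 4 * u + a * (b + e / 4 * u) + e / 4 * u <= e * u.
  move=> u0 x0 y0 a0 ax b0 by_ H.
  have e4 : 0 <= e / 4 * u by rewrite mulr_ge0 // divr_ge0 // ltW.
  have le1 : a * (b + e / 4 * u) <= (u * x) * (u * y + e / 4 * u).
    by apply: ler_pM => //; rewrite ?addr_ge0 // lerD2r.
  have le2 : u * (u * (x * (y + e / 4) + 1)) <= u * (e / 2) by exact: ler_wpM2l.
  have le3 : 0 <= u * u by exact: mulr_ge0.
  nra.
have e40 : 0 < e / 4 by rewrite divr_gt0.
have [d1 d10 H1] := TX _ e40; have [d2 d20 H2] := TY _ e40.
pose c := opnorm X * (opnorm Y + e / 4) + 1.
have c0 : 0 < c.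
  by rewrite /c ltr_pwDr // mulr_ge0 ?opnorm_ge0 // addr_ge0 ?opnorm_ge0 // ltW.
exists (Num.min (Num.min d1 d2) (e / 2 / c)).
  by rewrite !lt_min d10 d20 !divr_gt0.
move=> t; rewrite !lt_min => /andP[/andP[/H1[h Sh h1] /H2[k Sk k1]] tc].
exists (h * k); first exact: SM.
rewrite scalerDr; apply: le_trans (mul_first_order (SU Sk) h1 k1) _.
apply: (real_bound _ _ _ _ _ (normr_ge0 t) (opnorm_ge0 X) (opnorm_ge0 Y)
  (opnorm_ge0 _) (opnormZ_real _ _) (opnorm_ge0 _) (opnormZ_real _ _)).
by rewrite -ler_pdivlMr // ltW.
Qed.

Lemma tangentZ (c : R) X : tangent X -> tangent (c%:C *: X).
Proof.
move=> TX e e0; have c0 : 0 < `|c| + 1 by rewrite ltr_pwDr.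
have [del del0 H] := TX _ (divr_gt0 e0 c0).
exists (del / (`|c| + 1)); first by rewrite divr_gt0.
move=> t tdel; have : `|t * c| < del.
  rewrite ltr_pdivlMr // in tdel; rewrite normrM; apply: le_lt_trans tdel.
  by rewrite ler_wpM2l // lerDl.
move=> /H[h Sh h1]; exists h; first exact: Sh.
  rewrite scalerA -rmorphM; apply: le_trans h1 _.
rewrite normrM mulrAC ler_pdivrMr // -mulrA ler_wpM2l ?(ltW e0) //.
by rewrite ler_wpM2l // lerDl.
Qed.

Lemma tangent0 : tangent 0.
Proof.
move=> e e0; exists 1; first exact: ltr01.
move=> t _; exists 1; first exact: S1.
by rewrite scaler0 subr0 subrr opnorm0 mulr_ge0 // ltW.
Qed.

Lemma tangentN X : tangent X -> tangent (- X).
Proof. by move=> /(tangentZ (-1)); rewrite rmorphN1 scaleN1r. Qed.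

Lemma tangent_sum (I : Type) (r : seq I) (P : pred I) (F : I -> 'M[C]_d) :
  (forall i, P i -> tangent (F i)) -> tangent (\sum_(i <- r | P i) F i).
Proof.
by move=> TF; apply: (@big_ind _ tangent _ _ tangent0 tangentD).
Qed.

Lemma tangent_conj A X : S A -> tangent X -> tangent (A * X * A^t*).
Proof.
move=> SA TX e e0; have [del del0 H] := TX _ e0; exists del; first exact: del0.
move=> t /H[h Sh h1].
exists (A * h * A^t*); first by apply: (SM _ (Sdag SA)); exact: SM.
have -> : A * h * A^t* - 1 - t%:C *: (A * X * A^t*) =
  A * (h - 1 - t%:C *: X) * A^t*.
  rewrite !mulrBr !mulrBl mulr1 (unitarymx_mulVr (SU SA)).
  by rewrite -![_ * _]/(_ *m _) -scalemxAr -scalemxAl.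
apply: le_trans h1; exact: opnorm_conj (SU SA).
Qed.

Lemma tangent_rotation Y : (forall s, `|s| <= 1 -> S (rotation Y s)) -> tangent Y.
Proof.
move=> SY e e0; have c0 : 0 < opnorm Y ^+ 2 + 1 by rewrite ltr_pwDr // sqr_ge0.
exists (Num.min 1 (e / (opnorm Y ^+ 2 + 1))); first by rewrite lt_min ltr01 divr_gt0.
move=> t; rewrite lt_min => /andP[t1 te]; exists (rotation Y t).
  by apply: SY; exact: ltW.
apply: le_trans (rotation_first_order _ (ltW t1)) _.
rewrite -(real_normK (num_real t)) expr2 mulrAC ler_wpM2r //.
rewrite ltr_pdivlMr // in te; apply: le_trans (ltW te).
by rewrite ler_wpM2l // lerDl.
Qed.

(** The group commutator of elements of [S] at time s = sqrt t along X and along Y is 1 + t (X Y - Y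
    X) up to o(t). *)
Lemma tangent_bracket X Y : tangent X -> tangent Y -> tangent (X * Y - Y * X).
Proof.
(* The square root restricts the argument to t >= 0; negative times follow by exchanging X and Y. *)
suff half X' Y' : tangent X' -> tangent Y' -> forall e : R, 0 < e ->
    exists2 del : R, 0 < del & forall t : R, 0 <= t -> t < del ->
      exists2 h, S h & opnorm (h - 1 - t%:C *: (X' * Y' - Y' * X')) <= e * t.
  move=> TX TY e e0.
  have [d1 d10 H1] := half _ _ TX TY _ e0; have [d2 d20 H2] := half _ _ TY TX _ e0.
  exists (Num.min d1 d2); first by rewrite lt_min d10.
  move=> t; rewrite lt_min => /andP[t1 t2].
  have [t0|t0] := leP 0 t.
    by have := H1 _ t0; rewrite ger0_norm // in t1 *; apply.
  rewrite ltr0_norm // in t2 *; have nt : 0 <= - t by rewrite oppr_ge0 ltW.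
  have [h Sh h1] := H2 _ nt t2; exists h; first exact: Sh.
  by move: h1; rewrite rmorphN scaleNr -scalerN opprB.
move=> TX TY e e0.
pose A0 := opnorm X' + opnorm Y' + 1.
have A01 : 1 <= A0 by rewrite /A0 lerDr addr_ge0 // opnorm_ge0.
(* After division by s ^ 2 the error has the terms 4 A0 e1 + 2 e1 ^ 2 <= 6 A0 e1 <= e / 2, and a
   term proportional to s which the choice of [del] keeps below e / 2. *)
pose e1 := Num.min 1 (e / (12 * A0)).
have e10 : 0 < e1 by rewrite lt_min ltr01 divr_gt0 // mulr_gt0 // (lt_le_trans ltr01).
have e11 : e1 <= 1 by rewrite ge_min lexx.
have e1e : e1 * (12 * A0) <= e.
  have A12 : 0 < 12 * A0 by rewrite mulr_gt0 // (lt_le_trans ltr01).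
  by rewrite -ler_pdivlMr // /e1 ge_min lexx orbT.
have [d1 d10 H1] := TX _ e10; have [d2 d20 H2] := TY _ e10.
pose c := 8 * (A0 + 1) ^+ 3.
have c0 : 0 < c by rewrite mulr_gt0 // exprn_gt0 // addr_gt0 // (lt_le_trans ltr01).
pose del := Num.min (Num.min d1 d2) (e / c).
have del0 : 0 < del by rewrite !lt_min d10 d20 divr_gt0.
exists (del ^+ 2); first by rewrite exprn_gt0.
move=> t t0 tdel; pose s := Num.sqrt t.
have s0 : 0 <= s by exact: sqrtr_ge0.
have st : s ^+ 2 = t by rewrite sqr_sqrtr.
have sdel : `|s| < del.
  by rewrite ger0_norm // -(@ltr_pXn2r _ 2) ?nnegrE ?st // ltW.
have : `|s| < del by []; rewrite !lt_min => /andP[/andP[s1 s2] sc].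
have [h Sh h1] := H1 _ s1; have [k Sk k1] := H2 _ s2.
exists (h * k * h^t* * k^t*).
  by apply: (SM _ (Sdag Sk)); apply: (SM _ (Sdag Sh)); exact: SM.
have sX : opnorm (s%:C *: X') <= s * A0.
  apply: le_trans (opnormZ_real _ _) _; rewrite ger0_norm // ler_wpM2l //.
  by rewrite /A0 -addrA lerDl addr_ge0 ?opnorm_ge0.
have sY : opnorm (s%:C *: Y') <= s * A0.
  apply: le_trans (opnormZ_real _ _) _; rewrite ger0_norm // ler_wpM2l //.
  by rewrite /A0 addrAC lerDr addr_ge0 ?opnorm_ge0.
rewrite ger0_norm // mulrC in h1 k1 sc.
have := commutator_first_order (SU Sh) (SU Sk) h1 k1 sX sY.
have -> : s%:C *: X' * (s%:C *: Y') - s%:C *: Y' * (s%:C *: X') =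
    t%:C *: (X' * Y' - Y' * X') :> 'M[C]_d.
  rewrite -![_ * _]/(_ *m _) -!scalemxAl -!scalemxAr !scalerA -rmorphM -expr2 st.
  by rewrite scalerBr.
move/le_trans; apply.
rewrite ltr_pdivlMr // in sc; rewrite -st.
have {}sc : s * (8 * (A0 + 1) ^+ 3) < e by exact: sc.
clear - s0 A01 e1e e10 e11 sc; clearbody e1; clearbody A0; clearbody s.
have -> : 4 * (s * A0) * (s * e1) + 2 * (s * e1) ^+ 2 + 4 * (s * A0 + s * e1) ^+ 3
  = s ^+ 2 * (4 * A0 * e1 + 2 * e1 * e1 + s * (4 * (A0 + e1) ^+ 3)) by ring.
rewrite [leRHS]mulrC ler_wpM2l ?sqr_ge0 //.
have h1 : s * (4 * (A0 + e1) ^+ 3) <= e / 2.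
  rewrite ler_pdivlMr //; apply: le_trans (ltW sc).
  rewrite -mulrA ler_wpM2l // mulrC mulrA -natrM ler_wpM2l //.
  have A00 : 0 <= A0 by apply: le_trans A01.
  by rewrite ler_pXn2r ?nnegrE ?addr_ge0 // ?(ltW e10) // lerD2l.
have h2 : e1 * e1 <= e1 * A0.
  by rewrite ler_wpM2l ?(ltW e10) // (le_trans e11).
move: h1; set w := s * _ => h1; clear - h1 h2 e1e; nra.
Qed.

Lemma skew_frame (P : 'M[C]_d) (theta : 'rV[R]_d) :
  antiherm (frame P (\row_i ((theta 0 i)%:C * iC R))).
Proof.
set z := \row_i _; rewrite /antiherm frame_dag.
have -> : - frame P z = frame P (-1 *: z) by rewrite frameZ scaleN1r.
apply: (congr1 (frame P)); apply/rowP => i.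
by rewrite !mxE rmorphM /= conj_real conj_iC mulrN mulN1r.
Qed.

(** Write A = exp X in an eigenbasis and V = exp (X / N), so that V ^ N = A. For large N some h in
    [S] is within e / N of V, because both are 1 + X / N up to e / (2 N); taking N-th powers costs a
    factor N. *)
Theorem tangent_dense : (forall X, antiherm X -> tangent X) ->
  forall A (e : R), A \is unitarymx -> 0 < e -> exists2 h, S h & opnorm (A - h) <= e.
Proof.
move=> Tfull A e Au e0.
have [P [z [Pu z1 AE]]] := unitary_diag Au.
have /choice[theta zE] (i : 'I_d) : exists t : R, z 0 i = expi t.
  exact: expi_ex (z1 i).
pose X := frame P (\row_i (((\row_j theta j) 0 i)%:C * iC R)).
have TX : tangent X by apply: Tfull; exact: skew_frame.
pose W := \sum_i `|theta i| + 1.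
have W0 : 0 < W by rewrite ltr_pwDr // sumr_ge0.
have e2 : 0 < e / 2 by rewrite divr_gt0.
have [d1 d10 H1] := TX _ e2.
have [d2 d20 H2] := expi_first_order (divr_gt0 e2 W0).
pose del := Num.min d1 (d2 / W).
have del0 : 0 < del by rewrite lt_min d10 divr_gt0.
pose N := (Num.truncn del^-1).+1.
have N0 : 0 < (N%:R : R) by rewrite ltr0n.
have Ndel : (N%:R : R)^-1 < del.
  by rewrite invf_plt ?posrE //; exact: truncnS_gt.
have nN : `|(N%:R : R)^-1| = N%:R^-1 by rewrite ger0_norm // invr_ge0 ltW.
have [|h Sh h1] := H1 N%:R^-1.
  by rewrite nN; apply: lt_le_trans Ndel _; rewrite ge_min lexx.
pose V := frame P (\row_i expi (N%:R^-1 * theta i)).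
have Vu : V \is unitarymx.
  by apply: frame_unitary => // i; rewrite mxE; exact: expi_norm.
have VN : V ^+ N = A.
  rewrite AE /V (frameX _ _ Pu); apply: (congr1 (frame P)); apply/rowP => i.
  by rewrite !mxE expiX mulrA mulfV ?gt_eqF // mul1r zE.
have V1 : opnorm (V - 1 - (N%:R^-1)%:C *: X) <= e / 2 * N%:R^-1.
  rewrite -(frame1 Pu) -frameB -frameZ -frameB.
  apply: le_trans (opnorm_frame_le _ Pu) _.
  apply: (@le_trans _ _ (\sum_i e / 2 / W * `|N%:R^-1 * theta i|)).
    apply: ler_sum => i _; rewrite !mxE mulrA -rmorphM; apply: H2.
    rewrite normrM nN; apply: (@le_lt_trans _ _ (N%:R^-1 * W)).
      rewrite ler_wpM2l ?invr_ge0 ?(ltW N0) // /W (bigD1 i) //= -addrA lerDl.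
      by rewrite addr_ge0 // sumr_ge0.
    rewrite -ltr_pdivlMr //; apply: lt_le_trans Ndel _.
    by rewrite ge_min lexx orbT.
  rewrite -mulr_sumr; under eq_bigr do rewrite normrM nN.
  rewrite -mulr_sumr; set s := \sum_i _; have sW : s <= W by rewrite lerDl.
  have -> : e / 2 / W * (N%:R^-1 * s) = e / 2 * N%:R^-1 * (s / W) by ring.
  rewrite ler_piMr ?mulr_ge0 ?invr_ge0 ?(ltW N0) ?(ltW e0) //.
  by rewrite ler_pdivrMr // mul1r.
have SX B n : S B -> S (B ^+ n).
  by move=> SB; elim: n => [|n IH]; [exact: S1 | rewrite exprS; exact: SM].
exists (h ^+ N); first exact: SX.
rewrite -VN; apply: le_trans (opnormX_sub _ Vu (SU Sh)) _.
rewrite -ler_pdivlMl //.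
have -> : V - h = (V - 1 - (N%:R^-1)%:C *: X) - (h - 1 - (N%:R^-1)%:C *: X).
  by mx_abel.
apply: le_trans (opnormD _ _) _; rewrite opnormN.
apply: le_trans (lerD V1 h1) _; rewrite nN -mulrDl -splitr.
by rewrite mulrC.
Qed.

(** Vacuous for a = b. This makes the relation reflexive, so that chains of indices may contain
    repetitions. *)
Definition tangent_pair (a b : 'I_d) :=
  a != b -> tangent (genK R a b) /\ tangent (genS R a b).

Lemma tangent_pair_trans a b c :
  tangent_pair a b -> tangent_pair b c -> tangent_pair a c.
Proof.
move=> Hab Hbc ac.
have [ab|ab] := eqVneq a b; first by rewrite ab in ac *; exact: Hbc.
have [bc|bc] := eqVneq b c; first by rewrite -bc in ac *; exact: Hab.
have [Kab _] := Hab ab; have [Kbc Sbc] := Hbc bc.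
have nab := negPf ab; have nbc := negPf bc; have nac := negPf ac.
have nba : (b == a) = false by rewrite eq_sym.
have ncb : (c == b) = false by rewrite eq_sym.
have nca : (c == a) = false by rewrite eq_sym.
have D := (eqxx, nab, nbc, nac, nba, ncb, nca).
split.
  have -> : genK R a c = genK R a b * genK R b c - genK R b c * genK R a b.
    rewrite /genK -![_ * _]/(_ *m _) !(mulmxBl, mulmxBr) !mul_delta_mx_cond !D.
    by rewrite !mulr1n !mulr0n !(subr0, sub0r, opprK).
  exact: tangent_bracket.
have -> : genS R a c = genK R a b * genS R b c - genS R b c * genK R a b.
  rewrite /genK /genS -![_ * _]/(_ *m _) -!scalemxAr -!scalemxAl -scalerBr.
  rewrite !(mulmxBl, mulmxBr, mulmxDl, mulmxDr) !mul_delta_mx_cond !D.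
  by rewrite !mulr1n !mulr0n !(subr0, sub0r, addr0, add0r, opprK).
exact: tangent_bracket.
Qed.

Lemma tangent_genZ a b : a != b -> tangent_pair a b -> tangent (genZ R a b).
Proof.
move=> ab /(_ ab)[TK TS].
have [KS _ _] := gen_bracket R ab.
have -> : genZ R a b = (2^-1)%:C *: (genK R a b * genS R a b - genS R a b * genK R a b).
  rewrite KS mulr2n scalerDr -scalerDl -rmorphD.
  have -> : 2^-1 + 2^-1 = 1 :> R by field.
  by rewrite scale1r.
by apply: tangentZ; exact: tangent_bracket.
Qed.

Lemma tangent_full : tangent (iC R *: 1%:M) -> (forall a b, tangent_pair a b) ->
  forall X, antiherm X -> tangent X.
Proof.
move=> T1 Tab X /skew_decomposition ->; apply: (tangentD (tangentZ _ T1)).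
apply: tangent_sum => -[a b] /= ab; rewrite /skew_part /=.
have [TK TS] := Tab a b ab.
have TZ := tangent_genZ ab (Tab a b).
exact: tangentD (tangentZ _ TK) (tangentD (tangentZ _ TS) (tangentZ _ TZ)).
Qed.

Lemma delta_sandwich X a b :
  delta_mx a a * X * delta_mx b b = X a b *: delta_mx a b :> 'M[C]_d.
Proof.
apply/matrixP => i j; rewrite -![_ * _]/(_ *m _) !mxE (bigD1 b) //= big1; last first.
  by move=> k kb; rewrite !mxE (negPf kb) mulr0.
rewrite !mxE (bigD1 a) //= big1; last by move=> k ka; rewrite !mxE (negPf ka) andbF mul0r.
rewrite !mxE !eqxx !addr0 andbT.
by case: (i == a); case: (j == b); rewrite /= ?mulr0 ?mul0r ?mulr1 ?mul1r.
Qed.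

(* [[i E_bb, [i E_aa, X]]] is the part of X on the entries (a, b) and (b, a). *)
Lemma tangent_pair_torus X a b :
  (forall c, tangent (iC R *: delta_mx c c)) -> tangent X -> antiherm X -> X a b != 0 ->
  tangent_pair a b.
Proof.
move=> Td TX Xs Xab ab.
set z := X a b in Xab.
have zE : X b a = - z^*%R.
  by have /matrixP/(_ b a) := Xs; rewrite !mxE => /(congr1 -%R); rewrite opprK => <-.
pose x := complex.Re z; pose y := complex.Im z.
(* u is the part of X on the two entries, and w, its bracket with i E_aa, is u turned by a quarter
   in the plane of [genK] and [genS]. As z is nonzero, u and w span this plane. *)
pose u := x%:C *: genK R a b + y%:C *: genS R a b.
pose w := x%:C *: genS R a b - y%:C *: genK R a b.
have zxy : z = x%:C + y%:C * iC R by exact: cplxE.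
have i2 := iC_sqr R.
have Eab : delta_mx a a * delta_mx b b = 0 :> 'M[C]_d by exact: mul_delta_mx_0.
have Eba : delta_mx b b * delta_mx a a = 0 :> 'M[C]_d by apply: mul_delta_mx_0; rewrite eq_sym.
have br c Y : tangent Y -> tangent (iC R *: (delta_mx c c * Y - Y * delta_mx c c)).
  move=> TY; have := tangent_bracket (Td c) TY.
  by rewrite -![_ * _]/(_ *m _) -scalemxAl -scalemxAr -scalerBr.
have uE : z *: delta_mx a b + - z^*%R *: delta_mx b a = u.
  rewrite conj_cplx -/x -/y {1}zxy /u /genK /genS.
  move: (delta_mx a b) (delta_mx b a) => D1 D2.
  by apply/matrixP => i j; rewrite !mxE; move: (D1 i j) (D2 i j) => p q; ring.
have Tu : tangent u.
  have := br b _ (br a _ TX).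
  rewrite -![_ * _]/(_ *m _) -scalemxAl -scalemxAr -scalerBr scalerA i2 scaleN1r.
  rewrite !mulmxBl !mulmxBr -![_ *m _]/(_ * _) !mulrA Eba mul0r sub0r.
  rewrite -(mulrA X) Eab mulr0 subr0 opprB opprK !delta_sandwich zE -/z.
  by rewrite uE.
have Tw : tangent w.
  have := br a _ Tu.
  have nba : (b == a) = false by rewrite eq_sym; exact: negPf.
  rewrite -uE -![_ * _]/(_ *m _) mulmxDr mulmxDl -!scalemxAr -!scalemxAl.
  rewrite !mul_delta_mx_cond !eqxx nba (negPf ab) !mulr1n !mulr0n !(scaler0, addr0, add0r).
  suff -> : iC R *: (z *: delta_mx a b - - z^*%R *: delta_mx b a) = w by [].
  rewrite conj_cplx -/x -/y {1}zxy /w /genK /genS.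
  move: (delta_mx a b) (delta_mx b a) => D1 D2.
  apply/matrixP => i j; rewrite !mxE; move: (D1 i j) (D2 i j) => p q.
  transitivity (x%:C * (iC R * (p + q)) + y%:C * (iC R * iC R) * (p - q)); first by ring.
  by rewrite i2; ring.
have n0 : x ^+ 2 + y ^+ 2 != 0.
  by rewrite -cabs_sqr expf_eq0 /=; apply: contraNneq Xab => /cabs_eq0 ->.
have comb (p q : R) : tangent (p%:C *: u + q%:C *: w).
  by apply: tangentD; exact: tangentZ.
split.
  have := tangentZ (x ^+ 2 + y ^+ 2)^-1 (comb x (- y)).
  suff -> : x%:C *: u + (- y)%:C *: w = (x ^+ 2 + y ^+ 2)%:C *: genK R a b.
    by rewrite scalerA -rmorphM (mulVf n0) scale1r.
  rewrite /u /w; move: (genK R a b) (genS R a b) => K0 S0.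
  apply/matrixP => i j; rewrite !mxE !(rmorphD, rmorphXn, rmorphN) /=.
move: (K0 i j) (S0 i j) => p q; ring.
have := tangentZ (x ^+ 2 + y ^+ 2)^-1 (comb y x).
suff -> : y%:C *: u + x%:C *: w = (x ^+ 2 + y ^+ 2)%:C *: genS R a b.
  by rewrite scalerA -rmorphM (mulVf n0) scale1r.
rewrite /u /w; move: (genK R a b) (genS R a b) => K0 S0.
apply/matrixP => i j; rewrite !mxE !(rmorphD, rmorphXn, rmorphN) /=.
move: (K0 i j) (S0 i j) => p q; ring.
Qed.

End Tangent.

(** * Refinement of nets *)

Section Refinement.
Variables (R : realType) (d : nat).
Local Notation C := (Cplx R).
Implicit Types (G : set 'M[C]_d) (A B X Y : 'M[C]_d).

(** Since phases are letters, so is 1: words can be padded, and a net can be asked to consist of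
    words of one length. *)
Definition alphabet G := [/\ forall A, G A -> A \is unitarymx,
  forall A, G A -> G (A^t*) & forall z : C, `|z| = 1 -> G z%:M].

Definition is_net G L (e : R) := forall A, A \is unitarymx ->
  exists2 w, compositions G L w & opnorm (A - w) <= e.

Definition reaches G L X (e : R) :=
  exists2 w, compositions G L w & opnorm (w - 1 - X) <= e.

Definition is_gen Y := exists a b : 'I_d, a != b /\
  [\/ Y = genK R a b, Y = genS R a b | Y = genZ R a b].

Lemma is_genP Y : is_gen Y ->
  [/\ antiherm Y, Y * Y * Y = - Y, opnorm Y <= 2 &
   exists A B, [/\ is_gen A, is_gen B & A * B - B * A = Y *+ 2]].
Proof.
move=> [a [b [ab H]]].
have [K3 S3 Z3] := gen_cube R ab; have [K2 S2 Z2] := opnorm_gen R a b.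
have [KS SZ ZK] := gen_bracket R ab.
have gK : is_gen (genK R a b) by exists a, b; split=> //; constructor 1.
have gS : is_gen (genS R a b) by exists a, b; split=> //; constructor 2.
have gZ : is_gen (genZ R a b) by exists a, b; split=> //; constructor 3.
case: H => ->; split.
- exact: skew_genK.
- exact: K3.
- exact: K2.
- by exists (genS R a b), (genZ R a b); split.
- exact: skew_genS.
- exact: S3.
- exact: S2.
- by exists (genZ R a b), (genK R a b); split.
- exact: skew_genZ.
- exact: Z3.
- exact: Z2.
- by exists (genK R a b), (genS R a b); split.
Qed.

(** The constant is 4 + 1: the quadratic term of a rotation along a generator of norm at most 2, and
    the mesh. *)
Lemma net_rotation G L (r s : R) Y : is_gen Y -> 0 <= r -> r <= 1 -> `|s| <= r ->
  is_net G L (r ^+ 2) -> reaches G L (s%:C *: Y) (5 * r ^+ 2).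
Proof.
move=> /is_genP[Ys Y3 Y2 _] r0 r1 sr netL.
have s1 : `|s| <= 1 := le_trans sr r1.
have [w Gw Vw] := netL _ (rotation_unitary Ys Y3 s1).
exists w; first exact: Gw.
have -> : w - 1 - s%:C *: Y = (rotation Y s - 1 - s%:C *: Y) - (rotation Y s - w).
  by mx_abel.
apply: le_trans (opnormD _ _) _; rewrite opnormN.
apply: le_trans (lerD (rotation_first_order _ s1) Vw) _.
have s2 : s ^+ 2 <= r ^+ 2 by rewrite -(real_normK (num_real s)) ler_pXn2r ?nnegrE.
have Y4 : opnorm Y ^+ 2 <= 4.
  have -> : 4 = 2 ^+ 2 :> R by ring.
  by rewrite ler_pXn2r ?nnegrE ?opnorm_ge0.
have : s ^+ 2 * opnorm Y ^+ 2 <= r ^+ 2 * 4.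
  by apply: ler_pM; rewrite ?sqr_ge0.
by norm_lra.
Qed.

(* A generator Y is half a bracket of generators A and B, so [x Y] is obtained
   from the commutator of the rotations along A and B of sizes r and x / (2 r);
   neither size exceeds r, the square root of the mesh. *)
Lemma net_commutator : exists2 c : R, 0 <= c & forall G L (r x : R) Y,
  alphabet G -> is_gen Y ->
  0 < r -> r <= 1 -> `|x| <= r ^+ 2 -> is_net G L (r ^+ 2) ->
  reaches G (4 * L) (x%:C *: Y) (c * r ^+ 3).
Proof.
(* [commutator_first_order] with a = 2 r and e = 5 r ^ 2, where r ^ 4 <= r ^ 3 and 2 r + 5 r ^ 2 <=
   7 r, gives 40 + 50 + 4 * 343. *)
exists 1462; first exact: ler0n.
move=> G L r x Y [GU Gd _] Yg r0 r1 xr netL.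
have [_ _ _ [A [B [Ag Bg AB]]]] := is_genP Yg.
pose s := x / (2 * r).
have sr : `|s| <= r.
  rewrite /s normrM normfV (ger0_norm (x := 2 * r)) ?mulr_ge0 ?(ltW r0) //.
  rewrite ler_pdivrMr ?mulr_gt0 //; apply: le_trans xr _.
  by rewrite expr2 ler_wpM2l ?(ltW r0) // ler_peMl ?(ltW r0) // ler1n.
have rr : `|r| <= r by rewrite ger0_norm // ltW.
have [h Gh h1] := net_rotation Ag (ltW r0) r1 rr netL.
have [k Gk k1] := net_rotation Bg (ltW r0) r1 sr netL.
have hu := compositions_unitary GU Gh; have ku := compositions_unitary GU Gk.
exists (h * k * h^t* * k^t*).
  have -> : (4 * L = L + L + L + L)%N by rewrite !mulSn mul0n addn0 !addnA.
  apply: compositionsD; last exact: compositions_adj.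
  apply: compositionsD; last exact: compositions_adj.
  exact: compositionsD.
have nb (t : R) Y' : is_gen Y' -> `|t| <= r -> opnorm (t%:C *: Y') <= 2 * r.
  move=> /is_genP[_ _ Y2 _] tr; apply: le_trans (opnormZ_real _ _) _.
  by rewrite mulrC; apply: ler_pM; rewrite ?opnorm_ge0.
have := commutator_first_order hu ku h1 k1 (nb _ _ Ag rr) (nb _ _ Bg sr).
have -> : r%:C *: A * (s%:C *: B) - s%:C *: B * (r%:C *: A) = x%:C *: Y.
  rewrite -![_ * _]/(_ *m _) -!scalemxAl -!scalemxAr !scalerA -!rmorphM.
  rewrite (mulrC s) -scalerBr -![_ *m _]/(_ * _) AB mulr2n scalerDr -scalerDl -rmorphD.
  by congr (_%:C *: _); rewrite /s; field; rewrite gt_eqF.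
move/le_trans; apply.
have r3 : r ^+ 4 <= r ^+ 3 by rewrite exprS ler_piMl // exprn_ge0 // ltW.
have r5 : (2 * r + 5 * r ^+ 2) ^+ 3 <= (7 * r) ^+ 3.
  rewrite ler_pXn2r ?nnegrE ?addr_ge0 ?mulr_ge0 ?exprn_ge0 ?(ltW r0) //.
  have : r ^+ 2 <= r by rewrite expr2 ler_piMl // ltW.
  by norm_lra.
have -> : 4 * (2 * r) * (5 * r ^+ 2) + 2 * (5 * r ^+ 2) ^+ 2 = 40 * r ^+ 3 + 50 * r ^+ 4 by ring.
have E : (7 * r) ^+ 3 = 343 * r ^+ 3 by ring.
rewrite E in r5; clear - r3 r5; lra.
Qed.

(** Multiply the words of the summands. The summands are of order r ^ 2, so the cross terms of the
    product disappear in the error of order r ^ 3 which the commutators cost already. *)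
Lemma net_sum n : exists2 c : R, 0 <= c & forall G L (r : R) (F : 'I_n -> R * 'M[C]_d),
  alphabet G -> 0 < r -> r <= 1 -> is_net G L (r ^+ 2) ->
  (forall i, `|(F i).1| <= r ^+ 2) -> (forall i, is_gen (F i).2) ->
  reaches G (n * (4 * L)) (\sum_i ((F i).1)%:C *: (F i).2) (c * r ^+ 3).
Proof.
have [K K0 comm] := net_commutator.
elim: n => [|n [c c0 IH]].
  exists 0 => [//|G L r F _ _ _ _ _ _]; exists 1; first exact: compositions0.
  by rewrite big_ord0 subr0 subrr opnorm0 mul0r.
exists (c + (2 * n)%:R * (2 + K) + K).
  exact: addr_ge0 (addr_ge0 c0 (mulr_ge0 (ler0n _ _) (addr_ge0 (ler0n _ 2) K0))) K0.
move=> G L r F Ga r0 r1 netL F1 F2.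
have [w Gw w1] := IH G L r (fun i => F (widen_ord (leqnSn n) i)) Ga r0 r1 netL
  (fun i => F1 _) (fun i => F2 _).
have [k Gk k1] := comm _ _ _ _ _ Ga (F2 ord_max) r0 r1 (F1 ord_max) netL.
have [GU _ _] := Ga.
exists (w * k); first by rewrite mulSn addnC; exact: compositionsD.
rewrite big_ord_recr /=; apply: le_trans (mul_first_order (compositions_unitary GU Gk) w1 k1) _.
have nb i : opnorm (((F i).1)%:C *: (F i).2) <= 2 * r ^+ 2.
  have [_ _ Y2 _] := is_genP (F2 i); apply: le_trans (opnormZ_real _ _) _.
  by rewrite mulrC; apply: ler_pM; rewrite ?opnorm_ge0.
have r20 : 0 <= r ^+ 2 by rewrite sqr_ge0.
have r30 : 0 <= r ^+ 3 by rewrite exprn_ge0 // ltW.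
have nsum : opnorm (\sum_(i < n) ((F (widen_ord (leqnSn n) i)).1)%:C *: (F (widen_ord (leqnSn n) i)).2)
    <= (2 * n)%:R * r ^+ 2.
  apply: le_trans (opnorm_sum _ _) _; apply: le_trans (ler_sum _ (fun i _ => nb _)) _.
  rewrite sumr_const card_ord.
  have -> : 2 * r ^+ 2 *+ n = (2 * n)%:R * r ^+ 2 by rewrite -mulr_natr natrM; ring.
  exact: lexx.
have r32 : r ^+ 3 <= r ^+ 2 by rewrite exprS ler_piMl.
have r21 : r ^+ 2 <= r by rewrite expr2 ler_piMl // ltW.
have b2 : opnorm (((F ord_max).1)%:C *: (F ord_max).2) + K * r ^+ 3 <= (2 + K) * r.
  have := nb ord_max; move: (opnorm _) => y yr; clear - yr r32 r21 K0.
  have : K * r ^+ 3 <= K * r by apply: ler_wpM2l => //; apply: le_trans r21.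
  lra.
have := ler_pM (opnorm_ge0 _) (addr_ge0 (opnorm_ge0 _) (mulr_ge0 K0 r30)) nsum b2.
have -> : (2 * n)%:R * r ^+ 2 * ((2 + K) * r) = (2 * n)%:R * (2 + K) * r ^+ 3 by ring.
move=> H.
have -> : (c + (2 * n)%:R * (2 + K) + K) * r ^+ 3
  = c * r ^+ 3 + (2 * n)%:R * (2 + K) * r ^+ 3 + K * r ^+ 3 by ring.
exact: lerD (lerD (lexx _) H) (lexx _).
Qed.

(** The phase with imaginary part t is itself a letter, and its real part is within t ^ 2 <= r ^ 3
    of 1. The factor d comes from bounding the norm of a scalar matrix by the sum of its entries. *)
Lemma net_phase G (t r : R) : alphabet G -> 0 <= r -> r <= 1 -> `|t| <= r ^+ 2 ->
  reaches G 1 (t%:C *: (iC R *: 1%:M)) (d%:R * r ^+ 3).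
Proof.
move=> [_ _ Gz] r0 r1 tr.
have t1 : t ^+ 2 <= 1.
  rewrite -(real_normK (num_real t)) expr_le1 //; apply: le_trans tr _.
  by rewrite expr_le1.
have s2 : 0 <= 1 - t ^+ 2 by rewrite subr_ge0.
pose z : C := Num.sqrt (1 - t ^+ 2) +i* t.
have z1 : `|z| = 1.
  apply/eqP; rewrite -cabs_eq1 -(@eqrXn2 _ 2) ?cabs_ge0 // cabs_sqr /=.
  by rewrite sqr_sqrtr // subrK expr1n.
exists z%:M; first exact: compositions1 (Gz _ z1).
have -> : z%:M - 1 - t%:C *: (iC R *: 1%:M) = (z - 1 - t%:C * iC R)%:M :> 'M[C]_d.
  by apply/matrixP => i j; rewrite !mxE; case: (i == j); rewrite ?mulr1n ?mulr0n; ring.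
apply: le_trans (opnorm_entries _) _.
have zb : cabs (z - 1 - t%:C * iC R) <= r ^+ 3.
  have -> : z - 1 - t%:C * iC R = (Num.sqrt (1 - t ^+ 2) - 1)%:C.
    by apply/eqP; rewrite eq_complex /=; apply/andP; split; apply/eqP; ring.
  rewrite cabs_real.
  have r4 : t ^+ 2 <= r ^+ 3.
    rewrite -(real_normK (num_real t)); apply: (@le_trans _ _ ((r ^+ 2) ^+ 2)).
      by rewrite ler_pXn2r ?nnegrE ?sqr_ge0.
    by rewrite -exprM [leLHS]exprS ler_piMl // exprn_ge0.
  apply: le_trans r4; have r2 := sqr_sqrtr s2; have s0 := sqrtr_ge0 (1 - t ^+ 2).
  rewrite ler_norml; have := sqr_ge0 t; clear - r2 s0 t1.
  move: r2 s0; move: (Num.sqrt _) => s r2 s0 t0; nra.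
apply: (@le_trans _ _ (\sum_(i < d) r ^+ 3)); last first.
  by rewrite sumr_const card_ord -[X in X <= _]mulr_natl lexx.
apply: ler_sum => i _; rewrite (bigD1 i) //= big1 ?addr0; last first.
  by move=> j ji; rewrite !mxE eq_sym (negPf ji) cabs0.
by rewrite mxE eqxx mulr1n.
Qed.

Lemma net_antiherm : exists n : nat, exists2 c : R, 0 <= c & forall G L (r : R) X,
  alphabet G -> 0 < r -> r <= 1 -> is_net G L (r ^+ 2) ->
  antiherm X -> opnorm X <= r ^+ 2 ->
  reaches G (1 + n * (4 * L)) X (c * r ^+ 3).
Proof.
(* All generators are listed, including those with coefficient 0 in X, so the length of the word
   does not depend on X. *)
pose s : seq (('I_d * 'I_d) * 'I_3) :=
  [seq p <- enum {: ('I_d * 'I_d) * 'I_3} | p.1.1 != p.1.2].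
have [c c0 H] := net_sum (size s).
exists (size s); exists (d%:R + 1 * ((2 * size s)%:R + c) + c).
  by rewrite addr_ge0 // addr_ge0 // mul1r addr_ge0.
move=> G L r X Ga r0 r1 netL Xs Xr.
pose coef (p : ('I_d * 'I_d) * 'I_3) : R :=
  match val p.2 with
  | 0 => complex.Re (X p.1.1 p.1.2) / 2
  | 1 => complex.Im (X p.1.1 p.1.2) / 2
  | _ => complex.Im (X p.1.1 p.1.1) / d%:R end.
pose gen (p : ('I_d * 'I_d) * 'I_3) : 'M[C]_d :=
  match val p.2 with
  | 0 => genK R p.1.1 p.1.2
  | 1 => genS R p.1.1 p.1.2
  | _ => genZ R p.1.1 p.1.2 end.
pose t := \sum_a complex.Im (X a a) / d%:R.
have [d0|d0] := posnP d.
  exists 1; last first.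
    rewrite (_ : 1 - 1 - X = 0) ?opnorm0; last by apply/matrixP => -[i id]; exfalso; rewrite d0 in id.
    by rewrite mulr_ge0 ?exprn_ge0 ?(ltW r0) // addr_ge0 // addr_ge0 // mul1r addr_ge0.
  have [_ _ Gz] := Ga; apply: compositions_le (compositions0 _) => //.
  by apply: Gz; rewrite normr1.
have dR : 0 < (d%:R : R) by rewrite ltr0n.
have Xab a b : cabs (X a b) <= r ^+ 2 := le_trans (cabs_le_opnorm _ _ _) Xr.
have cbound p : `|coef p| <= r ^+ 2.
  have h2 (y : R) : `|y| <= r ^+ 2 -> `|y / 2| <= r ^+ 2.
    move=> yr; rewrite normrM (ger0_norm (x := 2^-1)) // ler_pdivrMr //.
    by apply: le_trans yr _; rewrite ler_peMr ?sqr_ge0 // ler1n.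
  have hd (y : R) : `|y| <= r ^+ 2 -> `|y / d%:R| <= r ^+ 2.
    move=> yr; rewrite normrM normfV (ger0_norm (ltW dR)) ler_pdivrMr //.
    by apply: le_trans yr _; rewrite ler_peMr ?sqr_ge0 // ler1n.
  rewrite /coef; case: (val p.2) => [|[|k]].
  - exact: h2 (le_trans (Re_le_cabs _) (Xab _ _)).
  - exact: h2 (le_trans (Im_le_cabs _) (Xab _ _)).
  - exact: hd (le_trans (Im_le_cabs _) (Xab _ _)).
have tr : `|t| <= r ^+ 2.
  apply: le_trans (ler_norm_sum _ _ _) _.
  apply: (@le_trans _ _ (\sum_(a < d) r ^+ 2 / d%:R)).
    apply: ler_sum => a _; rewrite normrM normfV (ger0_norm (ltW dR)).
    by rewrite ler_pM2r ?invr_gt0 //; exact: le_trans (Im_le_cabs _) (Xab _ _).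
  by rewrite sumr_const card_ord -[X in X <= _]mulr_natr divfK ?gt_eqF.
have ggen p : p.1.1 != p.1.2 -> is_gen (gen p).
  move=> ab; exists p.1.1, p.1.2; split; first exact: ab.
  by rewrite /gen; case: (val p.2) => [|[|k]]; [constructor 1|constructor 2|constructor 3].
pose F (i : 'I_(size s)) := (coef (tnth (in_tuple s) i), gen (tnth (in_tuple s) i)).
have sumF : \sum_i ((F i).1)%:C *: (F i).2 =
    \sum_(p : 'I_d * 'I_d | p.1 != p.2) skew_part X p :> 'M[C]_d.
  rewrite -(big_tnth _ _ s xpredT (fun p => (coef p)%:C *: gen p)) /s big_filter big_enum_cond /=.
  transitivity (\sum_(p : 'I_d * 'I_d | p.1 != p.2) \sum_(k < 3) (coef (p, k))%:C *: gen (p, k) : 'M[C]_d).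
    by rewrite pair_big_dep /=; apply: eq_big => [[p k]|[p k] _] //=; rewrite andbT.
  apply: eq_bigr => p _; rewrite !big_ord_recl big_ord0 addr0 /skew_part.
  by rewrite /coef /gen.
have gF i : is_gen (F i).2.
  apply: ggen; have := mem_tnth i (in_tuple s); rewrite mem_filter.
  by case/andP.
have [w Gw w1] := H G L r F Ga r0 r1 netL (fun i => cbound _) gF.
have [z Gz z1] := net_phase Ga (ltW r0) r1 tr.
have [GU _ _] := Ga.
exists (z * w); first exact: compositionsD.
rewrite {1}(skew_decomposition Xs) -/t -sumF.
have r20 : 0 <= r ^+ 2 by rewrite sqr_ge0.
have r30 : 0 <= r ^+ 3 by rewrite exprn_ge0 // ltW.
have r32 : r ^+ 3 <= r ^+ 2 by rewrite exprS ler_piMl.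
have r21 : r ^+ 2 <= r by rewrite expr2 ler_piMl // ltW.
apply: le_trans (mul_first_order (compositions_unitary GU Gw) z1 w1) _.
have nt : opnorm (t%:C *: (iC R *: 1%:M : 'M[C]_d)) <= 1 * r ^+ 2.
  apply: le_trans (opnormZ_real _ _) _; rewrite mulrC; apply: ler_pM => //.
    exact: opnorm_ge0.
  apply: le_trans (opnormZ_le _ _) _; rewrite cabs_iC mul1r.
  exact: opnorm_unitary (unitarymx1 _ _).
have nsum : opnorm (\sum_i ((F i).1)%:C *: (F i).2) + c * r ^+ 3 <= ((2 * size s)%:R + c) * r.
  rewrite mulrDl; apply: lerD; last by rewrite ler_wpM2l // (le_trans r32).
  apply: (@le_trans _ _ ((2 * size s)%:R * r ^+ 2)); last by rewrite ler_wpM2l.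
  apply: le_trans (opnorm_sum _ _) _.
  apply: (@le_trans _ _ (\sum_(i < size s) 2 * r ^+ 2)).
    apply: ler_sum => i _; have [_ _ Y2 _] := is_genP (gF i).
    apply: le_trans (opnormZ_real _ _) _; rewrite mulrC.
    by apply: ler_pM; [exact: opnorm_ge0 | exact: normr_ge0 | exact: Y2 | exact: cbound].
  rewrite sumr_const card_ord.
  have -> : 2 * r ^+ 2 *+ size s = (2 * size s)%:R * r ^+ 2 by rewrite -mulr_natr natrM; ring.
  exact: lexx.
have := ler_pM (opnorm_ge0 _) (addr_ge0 (opnorm_ge0 _) (mulr_ge0 c0 r30)) nt nsum.
have -> : 1 * r ^+ 2 * (((2 * size s)%:R + c) * r) = 1 * ((2 * size s)%:R + c) * r ^+ 3 by ring.
move=> HH.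
have -> : (d%:R + 1 * ((2 * size s)%:R + c) + c) * r ^+ 3 =
  d%:R * r ^+ 3 + 1 * ((2 * size s)%:R + c) * r ^+ 3 + c * r ^+ 3 by ring.
exact: lerD (lerD (lexx _) HH) (lexx _).
Qed.

(** Elements of size r are known to precision r ^ 2, hence their commutators, of size r ^ 2, to a
    precision of order r ^ 3. For small r this beats r ^ 2 / 4; this is why the mesh is measured by
    r ^ 2. *)
Lemma net_refine : exists K : nat, exists2 r0 : R, 0 < r0 <= 1 & forall G L (r : R),
  alphabet G -> 0 < r -> r <= r0 -> (0 < L)%N -> is_net G L (r ^+ 2) ->
  is_net G (K * L) ((r / 2) ^+ 2).
Proof.
have [n [c c0 H]] := net_antiherm.
(* A phase, n commutators of four words each, and the word w: 1 + 4 n L + L <= (2 + 4 n) L. The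
   radius is such that (c + 1) r ^ 3 <= r ^ 2 / 4. *)
exists (2 + 4 * n)%N; exists ((4 * (c + 1))^-1).
  have c1 : 1 <= 4 * (c + 1) by lra.
  have c4 : 0 < 4 * (c + 1) by lra.
  by rewrite invr_gt0 invf_le1 // c4.
move=> G L r Ga r0 rc L0 netL A Au; have [GU _ G1] := Ga.
have c4 : 0 < 4 * (c + 1) by lra.
have r1 : r <= 1.
  by apply: le_trans rc _; rewrite invf_le1 //; lra.
have [w Gw Aw] := netL A Au; have wu := compositions_unitary GU Gw.
pose D := A * w^t*; have Du : D \is unitarymx by exact: unitarymxM Au (adj_unitary wu).
have D1 : opnorm (D - 1) <= r ^+ 2.
  have -> : D - 1 = (A - w) * w^t* by rewrite mulrBl (unitarymx_mulVr wu).
  by apply: le_trans Aw; apply: opnormM_unitaryr; exact: adj_unitary.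
pose E := D - 1; pose X := (2^-1)%:C *: (E - E^t*).
have Xs : antiherm X.
  by apply: skewZ; rewrite /antiherm dagD dagN dagK; exact: esym (opprB _ _).
(* Unitarity of D = 1 + E makes twice the hermitian part of E quadratic in E. So E differs from its
   antihermitian part X by at most r ^ 4. *)
have EE : E + E^t* = - (E * E^t*).
  rewrite /E dagD dagN dag1; have := unitarymx_mulVr Du.
  move: (D^t*) => D' DD; rewrite mulrBl !mulrBr DD; mx_ring.
have Ed : opnorm (E^t*) <= r ^+ 2.
  rewrite /E dagD dagN dag1 -{1}dag1; apply: le_trans D1.
  exact: (opnorm_adj_sub Du (unitarymx1 _ _)).
have Xr : opnorm X <= r ^+ 2.
  apply: le_trans (opnormZ_real _ _) _; rewrite ger0_norm // mulrC ler_pdivrMr //.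
  apply: le_trans (opnormD _ _) _; rewrite opnormN.
  have -> : r ^+ 2 * 2 = r ^+ 2 + r ^+ 2 by ring.
  exact: lerD D1 Ed.
have EX : opnorm (D - 1 - X) <= r ^+ 3.
  have -> : D - 1 - X = - ((2^-1)%:C *: (E * E^t*)).
    have half (P Q : 'M[C]_d) : P - (2^-1)%:C *: (P - Q) = (2^-1)%:C *: (P + Q).
      have hh : (2^-1)%:C + (2^-1)%:C = 1 :> C.
        by rewrite -rmorphD; congr (_%:C); field.
      apply/matrixP => i j; rewrite !mxE; move: (P i j) (Q i j) => p q.
      by rewrite -{1}(mul1r p) -hh; ring.
    have -> : - ((2^-1)%:C *: (E * E^t*)) = (2^-1)%:C *: (E + E^t*) by rewrite EE scalerN.
    exact: half.
  rewrite opnormN; apply: le_trans (opnormZ_real _ _) _; rewrite ger0_norm //.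
  have EEr : opnorm (E * E^t*) <= r ^+ 2 * r ^+ 2.
    apply: le_trans (opnormM _ _) _.
    by apply: ler_pM; [exact: opnorm_ge0|exact: opnorm_ge0|exact: D1|exact: Ed].
  apply: le_trans (_ : 1 * (r ^+ 2 * r ^+ 2) <= _).
    apply: ler_pM; [by []|exact: opnorm_ge0| |exact: EEr].
    by rewrite invf_le1 // ler1n.
  by rewrite mul1r -exprD (exprS r 3) ler_piMl ?exprn_ge0 ?(ltW r0).
have [k Gk k1] := H G L r X Ga r0 r1 netL Xs Xr.
exists (k * w).
  have -> : ((2 + 4 * n) * L = (1 + n * (4 * L)) + L + (L - 1))%N by clear - L0; lia.
  apply: compositions_le; last exact: (compositionsD Gk Gw).
    by apply: G1; rewrite normr1.
  exact: leq_addr.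
have -> : A - k * w = (D - k) * w.
  by rewrite mulrBl /D -(mulrA A) (unitarymx_mulV wu) mulr1.
apply: le_trans (opnormM_unitaryr _ wu) _.
have -> : D - k = (D - 1 - X) - (k - 1 - X) by mx_abel.
apply: le_trans (opnormD _ _) _; rewrite opnormN; apply: le_trans (lerD EX k1) _.
have -> : r ^+ 3 + c * r ^+ 3 = (c + 1) * r * r ^+ 2 by ring.
have -> : (r / 2) ^+ 2 = 4^-1 * r ^+ 2 by field.
rewrite ler_wpM2r ?sqr_ge0 //.
have h : r * (4 * (c + 1)) <= 1 by rewrite -ler_pdivlMr // div1r.
clear - h; lra.
Qed.

End Refinement.

(** * Finite nets and almost periods *)

Section Cells.
Variables (R : realType) (d : nat).
Local Notation C := (Cplx R).
Implicit Types (A B : 'M[C]_d).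

(** A grid on the unitary matrices, for finite nets and for the pigeonhole principle. Real and
    imaginary parts of the entries lie in [-1, 1]; adding 1 and scaling by M moves them to [0, 2 M],
    whose integer parts take 2 M + 1 values. *)
Definition cell M : finType := {ffun ('I_d * 'I_d * bool) -> 'I_(2 * M).+1}.

Definition part (b : bool) (z : C) : R := if b then complex.Re z else complex.Im z.

Definition cell_of M A : cell M :=
  [ffun p => inord (Num.truncn ((part p.2 (A p.1.1 p.1.2) + 1) * M%:R))].

Lemma card_cell M : #|cell M| = ((2 * M).+1 ^ (d * d * 2))%N.
Proof. by rewrite card_ffun !card_prod !card_ord card_bool. Qed.

Lemma part_le b z : `|part b z| <= cabs z.
Proof. by case: b; [exact: Re_le_cabs | exact: Im_le_cabs]. Qed.

Lemma unitary_entry A i j : A \is unitarymx -> cabs (A i j) <= 1.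
Proof. by move=> Au; exact: le_trans (cabs_le_opnorm _ _ _) (opnorm_unitary Au). Qed.

Lemma truncn_close (x y : R) : 0 <= x -> 0 <= y -> Num.truncn x = Num.truncn y ->
  `|x - y| <= 1.
Proof.
move=> x0 y0 xy; have := truncn_itv x0; have := truncn_itv y0.
rewrite xy -natr1 => /andP[a b] /andP[c e]; rewrite ler_norml.
by clear - a b c e; apply/andP; split; lra.
Qed.

Lemma cell_close M A B : (0 < M)%N -> A \is unitarymx -> B \is unitarymx ->
  cell_of M A = cell_of M B -> opnorm (A - B) <= (2 * d * d)%:R / M%:R.
Proof.
move=> M0 Au Bu AB.
have MR : 0 < (M%:R : R) by rewrite ltr0n.
have bnd (E : 'M[C]_d) b i j : E \is unitarymx -> 0 <= (part b (E i j) + 1) * M%:R <= (2 * M)%:R.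
  move=> Eu; have := le_trans (part_le b (E i j)) (unitary_entry i j Eu).
  rewrite ler_norml => /andP[p1 p2]; apply/andP; split.
    by rewrite mulr_ge0 ?(ltW MR) // -lerBlDr sub0r.
  by rewrite natrM ler_pM2r //; clear - p2; lra.
have close b i j : `|part b (A i j) - part b (B i j)| <= M%:R^-1.
  have := congr1 (fun f : cell M => val (f (i, j, b))) AB; rewrite !ffunE /=.
  have /andP[a0 a1] := bnd A b i j Au; have /andP[b0 b1] := bnd B b i j Bu.
  rewrite !inordK; last 2 first.
  - by rewrite ltnS truncn_le_nat (le_lt_trans b1) // ltr_nat.
  - by rewrite ltnS truncn_le_nat (le_lt_trans a1) // ltr_nat.
  move=> /(truncn_close a0 b0); rewrite -mulrBl opprD addrACA subrr addr0.
  by rewrite normrM (ger0_norm (ltW MR)) -ler_pdivlMr // div1r.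
apply: le_trans (opnorm_entries _) _.
apply: (@le_trans _ _ (\sum_(i < d) \sum_(j < d) (2 / M%:R))).
  apply: ler_sum => i _; apply: ler_sum => j _; rewrite !mxE.
  apply: le_trans (cabs_le_ReIm _) _.
  have := lerD (close true i j) (close false i j); rewrite /part.
  have -> : 2 / M%:R = M%:R^-1 + M%:R^-1 :> R by ring.
  by case: (A i j) => x y; case: (B i j).
rewrite !sumr_const !card_ord -mulrnA.
have -> : 2 / M%:R *+ (d * d) = (2 * d * d)%:R / M%:R :> R by rewrite -mulr_natr !natrM; ring.
exact: lexx.
Qed.

Lemma finite_net (e : R) : 0 < e -> exists (T : finType) (u : T -> 'M[C]_d),
  (forall t, u t \is unitarymx) /\
  forall A, A \is unitarymx -> exists t, opnorm (A - u t) <= e.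
Proof.
move=> e0; pose M := (Num.truncn ((2 * d * d)%:R / e)).+1.
have /choice[u uP] (c : cell M) : exists B, B \is unitarymx /\
    forall A, A \is unitarymx -> cell_of M A = c -> cell_of M B = c.
  have [[B [Bu BC]]|no] := pselect (exists B, B \is unitarymx /\ cell_of M B = c).
    by exists B.
  (* A cell without unitary matrices gets 1 as its representative; the second condition is then
     vacuous. *)
  exists 1; split; first exact: unitarymx1.
  by move=> A Au Ac; exfalso; apply: no; exists A.
exists (cell M), u; split=> [t|A Au]; first by have [] := uP t.
exists (cell_of M A); have [Bu Bc] := uP (cell_of M A).
apply: le_trans (cell_close (ltn0Sn _) Au Bu _) _.
  exact: esym (Bc A Au erefl).
rewrite ler_pdivrMr ?ltr0n // -ler_pdivrMl // mulrC.
exact/ltW/truncnS_gt.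
Qed.

Lemma unitaryX A n : A \is unitarymx -> A ^+ n \is unitarymx.
Proof.
by move=> Au; elim: n => [|n IH]; [exact: unitarymx1 | rewrite exprS unitarymxM].
Qed.

(** Two of the powers with exponents up to the number of cells share a cell, and the smaller power
    can be cancelled from their difference. *)
Lemma dirichlet_power A M : A \is unitarymx -> (0 < M)%N -> exists N : nat,
  [/\ (0 < N)%N, (N <= (2 * M).+1 ^ (d * d * 2))%N &
      opnorm (A ^+ N - 1) <= (2 * d * d)%:R / M%:R].
Proof.
move=> Au M0; pose f (k : 'I_(#|cell M|).+1) := cell_of M (A ^+ k).
have /injectivePn[a [b ab fab]] : ~~ injectiveb f.
  apply/negP => /injectiveP/leq_card; by rewrite card_ord ltnn.
wlog lt_ab : a b ab fab / (a < b)%N.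
  move=> W; have := ab; rewrite -val_eqE neq_ltn => /orP[|] lt; first exact: (W a b).
  by apply: (W b a) => //; rewrite eq_sym.
exists (b - a)%N; split; first by rewrite subn_gt0.
  rewrite -card_cell; apply: leq_trans (leq_subr _ _) _; by rewrite -ltnS.
have Aa := unitaryX a Au.
have -> : A ^+ (b - a) - 1 = (A ^+ a)^t* * (A ^+ b - A ^+ a).
  rewrite mulrBr (unitarymx_mulV Aa) -{2}(subnKC (ltnW lt_ab)) exprD mulrA.
  by rewrite (unitarymx_mulV Aa) mul1r.
apply: le_trans (opnormM_unitaryl _ (adj_unitary Aa)) _.
exact: cell_close M0 (unitaryX b Au) Aa (esym fab).
Qed.

Lemma net_iterate : exists K : nat, exists2 r0 : R, 0 < r0 <= 1 & forall (G : set 'M[C]_d) L k,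
  alphabet G -> (0 < L)%N -> is_net G L (r0 ^+ 2) ->
  is_net G (K ^ k * L) ((r0 / 2 ^+ k) ^+ 2).
Proof.
have [K [r0 /andP[r00 r01] H]] := net_refine R d.
(* Refinement applies to words of positive length, and K may be 0; its successor keeps all lengths
   positive. *)
exists K.+1; exists r0; first by rewrite r00.
move=> G L k Ga L0 netL; have [_ _ Gz] := Ga.
have G1 : G 1 by apply: Gz; rewrite normr1.
elim: k => [|k IH]; first by rewrite mul1n expr0 divr1.
have p0 : 0 < r0 / 2 ^+ k by rewrite divr_gt0 // exprn_gt0.
have p1 : r0 / 2 ^+ k <= r0.
  by rewrite ler_pdivrMr ?exprn_gt0 // ler_peMr ?(ltW r00) // exprn_ege1 // ler1n.
have := H _ _ _ Ga p0 p1 _ IH; rewrite muln_gt0 expn_gt0 L0 => /(_ isT) N.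
move=> A Au; have [w Gw Aw] := N A Au; exists w.
  apply: compositions_le Gw; first exact: G1.
  by rewrite expnS -mulnA leq_mul2r leqnSn orbT.
have -> : r0 / 2 ^+ k.+1 = r0 / 2 ^+ k / 2 by rewrite exprSr invfM mulrA.
exact: Aw.
Qed.

End Cells.

(** * Circuits over one gate and a fixed involution *)

Section Letters.
Variables (R : realType) (d : nat).
Local Notation C := (Cplx R).
Variable T : 'M[C]_d.
Hypothesis Tu : T \is unitarymx.
Hypothesis Tdag : T^t* = T.
Implicit Types (g h A B : 'M[C]_d).

(** Every letter comes with all phases, so that the set depends only on the class of [g] modulo
    phases ([letters_scale]). The inverse of [g] is a letter, but it is not among the [gates]. *)
Definition letters g : set 'M[C]_d := [set A | exists2 z : C, `|z| = 1 &
  [\/ A = z *: g, A = z *: g^t*, A = z *: T | A = z%:M]].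

Definition gates g : set 'M[C]_d := [set A | A = g \/ A = T].

Lemma letters_alphabet g : g \is unitarymx -> alphabet (letters g).
Proof.
move=> gu; split.
- move=> A [z z1 H]; case: H => ->.
  + exact: unitarymxZ z1 gu.
  + exact: unitarymxZ z1 (adj_unitary gu).
  + exact: unitarymxZ z1 Tu.
  + exact: scalar_unitary z1.
- move=> A [z z1 H]; exists (z^*)%R; first by rewrite norm_conjC.
  case: H => ->.
  + by rewrite dagZ; constructor 2.
  + by rewrite dagZ dagK; constructor 1.
  + by rewrite dagZ Tdag; constructor 3.
  + by rewrite tr_scalar_mx map_scalar_mx; constructor 4.
- move=> z z1; exists z; first exact: z1.
  by constructor 4.
Qed.

Lemma letters_scale g (z : C) : `|z| = 1 -> letters (z *: g) = letters g.
Proof.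
move=> z1.
have z0 : z != 0 by rewrite -normr_eq0 z1 oner_eq0.
have zz : z^*%R * z = 1 by rewrite mulrC -normCK z1 expr1n.
apply/seteqP; split=> A [w w1 H].
  case: H => ->.
  - exists (w * z); first by rewrite normrM w1 z1 mulr1.
    by constructor 1; rewrite scalerA.
  - exists (w * z^*%R); first by rewrite normrM norm_conjC w1 z1 mulr1.
    by constructor 2; rewrite dagZ scalerA.
  - by exists w => //; constructor 3.
  - by exists w => //; constructor 4.
case: H => ->.
- exists (w * z^*%R); first by rewrite normrM norm_conjC w1 z1 mulr1.
  by constructor 1; rewrite scalerA -mulrA zz mulr1.
- exists (w * z); first by rewrite normrM w1 z1 mulr1.
  by constructor 2; rewrite dagZ scalerA -mulrA (mulrC z) zz mulr1.
- by exists w => //; constructor 3.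
- by exists w => //; constructor 4.
Qed.

(** Spell the same word with h in place of g; every letter moves by at most the distance of g and
    h. *)
Lemma letters_perturb g h L A : g \is unitarymx -> h \is unitarymx ->
  compositions (letters g) L A ->
  exists2 B, compositions (letters h) L B & opnorm (A - B) <= L%:R * opnorm (g - h).
Proof.
move=> gu hu; have [gU _ _] := letters_alphabet gu; have [hU _ _] := letters_alphabet hu.
move: L A; apply: compositions_ind.
  exists 1; first exact: compositions0.
  by rewrite subrr opnorm0 mul0r.
move=> L A D Aw [B Bw AB] [z z1 H].
have step D' : letters h D' -> opnorm (D - D') <= opnorm (g - h) ->
    exists2 B0, compositions (letters h) L.+1 B0 &
      opnorm (A * D - B0) <= L.+1%:R * opnorm (g - h).
  move=> hD' DD'; exists (B * D').
    by rewrite -addn1; exact: compositionsD Bw (compositions1 hD').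
  have Du : D \is unitarymx by apply: gU; exists z.
  apply: le_trans (opnormM_sub _ _ (compositions_unitary hU Bw) Du) _.
  by rewrite -natr1 mulrDl mul1r; exact: lerD.
have zle E : opnorm (z *: E) <= opnorm (E : 'M[C]_d).
  apply: le_trans (opnormZ_le _ _) _.
  by have /eqP -> : cabs z == 1; rewrite ?cabs_eq1 ?z1 // mul1r lexx.
case: H => DE.
- apply: (step (z *: h)); first by exists z; [exact: z1 | constructor 1].
  by rewrite DE -scalerBr; exact: zle.
- apply: (step (z *: h^t*)); first by exists z; [exact: z1 | constructor 2].
  by rewrite DE -scalerBr; exact: le_trans (zle _) (opnorm_adj_sub gu hu).
- apply: (step D); first by exists z; [exact: z1 | constructor 3].
  by rewrite subrr opnorm0; exact: opnorm_ge0.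
- apply: (step D); first by exists z; [exact: z1 | constructor 4].
  by rewrite subrr opnorm0; exact: opnorm_ge0.
Qed.

(** The inverse of g differs from g ^ (N - 1) by as much as g ^ N from 1, so each letter becomes at
    most N gates. The phases of all letters are collected in z. *)
Lemma letters_to_gates g N (e : R) L A : g \is unitarymx -> (0 < N)%N ->
  opnorm (g ^+ N - 1) <= e -> compositions (letters g) L A ->
  exists (k : nat) (z : C) B, [/\ (k <= L * N)%N, `|z| = 1, compositions (gates g) k B
    & opnorm (A - z *: B) <= L%:R * e].
Proof.
move=> gu N0 gN; have [gU _ _] := letters_alphabet gu.
have e0 : 0 <= e := le_trans (opnorm_ge0 _) gN.
have GU B : gates g B -> B \is unitarymx by case=> ->.
move: L A; apply: compositions_ind.
  exists 0%N, 1, 1; split; [by []|by rewrite normr1|exact: compositions0|].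
  by rewrite scale1r subrr opnorm0 mul0r.
move=> L A D Aw [k [z [B [kL z1 Bk AB]]]] [w w1 H].
have step j D' : (j <= N)%N -> compositions (gates g) j D' -> opnorm (D - w *: D') <= e ->
    exists (k' : nat) (z' : C) B', [/\ (k' <= L.+1 * N)%N, `|z'| = 1,
      compositions (gates g) k' B' & opnorm (A * D - z' *: B') <= L.+1%:R * e].
  move=> jN jD' DD'; exists (k + j)%N, (z * w), (B * D'); split.
  - by rewrite mulSn addnC leq_add.
  - by rewrite normrM z1 w1 mulr1.
  - exact: compositionsD.
  - have -> : (z * w) *: (B * D') = (z *: B) * (w *: D').
      by rewrite -[B * D']/(B *m D') -[RHS]/((z *: B) *m (w *: D')) -scalemxAr -scalemxAl scalerA mulrC.
    have Du : D \is unitarymx by apply: gU; exists w.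
    have zBu : z *: B \is unitarymx.
      by apply: (unitarymxZ z1); exact: compositions_unitary GU Bk.
    apply: le_trans (opnormM_sub _ _ zBu Du) _.
    by rewrite -natr1 mulrDl mul1r; exact: lerD.
have wle E : opnorm (w *: E) <= opnorm (E : 'M[C]_d).
  apply: le_trans (opnormZ_le _ _) _.
  by have /eqP -> : cabs w == 1; rewrite ?cabs_eq1 ?w1 // mul1r lexx.
case: H => DE.
- by apply: (step 1%N g N0); [apply: compositions1; left | rewrite DE subrr opnorm0].
- apply: (step N.-1 (g ^+ N.-1)); first exact: leq_pred.
    by rewrite -[X in compositions _ X]mul1n; apply: compositionsX; apply: compositions1; left.
  rewrite DE -scalerBr; apply: le_trans (wle _) _.
  have -> : g^t* - g ^+ N.-1 = g^t* * - (g ^+ N - 1).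
    by rewrite opprB mulrBr mulr1 -{2}(prednK N0) exprS mulrA (unitarymx_mulV gu) mul1r.
  by apply: le_trans (opnormM_unitaryl _ (adj_unitary gu)) _; rewrite opnormN.
- by apply: (step 1%N T N0); [apply: compositions1; right | rewrite DE subrr opnorm0].
- by apply: (step 0%N 1); [by []|exact: compositions0|rewrite DE scalemx1 subrr opnorm0].
Qed.

(** The inequality is strict in order to survive a small change of [g]. The lengths are left free,
    since finitely many of them have a maximum. *)
Definition good (I : finType) (u : I -> 'M[C]_d) (e : R) g := forall t,
  exists L, exists2 w, compositions (letters g) L w & opnorm (u t - w) < e.

Lemma good_net (I : finType) (u : I -> 'M[C]_d) (e : R) g : g \is unitarymx ->
  (forall A, A \is unitarymx -> exists t, opnorm (A - u t) <= e) -> good u e g ->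
  exists2 L, (0 < L)%N & is_net (letters g) L (2 * e).
Proof.
move=> gu net gg; have [_ _ Gz] := letters_alphabet gu.
have G1 : letters g 1 by apply: Gz; rewrite normr1.
have /choice[L Lw] t : exists L, exists2 w, compositions (letters g) L w & opnorm (u t - w) < e.
  exact: gg.
(* All words are padded to a common length; the successor makes it positive. *)
exists (\max_t L t).+1; first by [].
move=> A Au; have [t At] := net A Au; have [w Gw uw] := Lw t; exists w.
  by apply: compositions_le Gw; [exact: G1 | apply: leqW; exact: leq_bigmax].
apply: le_trans (opnormB_trans _ (u t) _) _.
by rewrite mulrDl mul1r; exact: lerD At (ltW uw).
Qed.

Lemma good_open (I : finType) (u : I -> 'M[C]_d) (e : R) g : g \is unitarymx ->
  good u e g -> exists2 eps : R, 0 < eps &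
    forall h, h \is unitarymx -> opnorm (g - h) < eps -> good u e h.
Proof.
move=> gu gg.
have /choice[f fP] t : exists eps : R, 0 < eps /\ forall h, h \is unitarymx ->
    opnorm (g - h) < eps -> exists L, exists2 w, compositions (letters h) L w &
    opnorm (u t - w) < e.
  have [L [w Gw uw]] := gg t.
  exists ((e - opnorm (u t - w)) / L.+1%:R); split.
    by rewrite divr_gt0 ?ltr0n // subr_gt0.
  move=> h hu gh0; have gh : opnorm (g - h) * L.+1%:R < e - opnorm (u t - w).
    by rewrite -ltr_pdivlMr // ltr0n.
  have [B Bw wB] := letters_perturb gu hu Gw; exists L, B; first exact: Bw.
  apply: le_lt_trans (opnormB_trans _ w _) _; rewrite -ltrBrDl.
  apply: le_lt_trans gh; apply: le_trans wB _.
  by rewrite mulrC ler_wpM2l ?opnorm_ge0 // ler_nat.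
exists (\big[Num.min/1]_t f t).
  by apply: lt_bigmin => // t _; have [] := fP t.
move=> h hu gh t; have [_ H] := fP t; apply: (H h hu).
by apply: lt_le_trans gh _; exact: bigmin_le_cond.
Qed.

(** After k refinements the mesh is at most 1 / 2 ^ k, while the length K ^ k L is at most (2 ^ k) ^
    K L because K < 2 ^ K. Taking 2 M <= 2 ^ k <= 4 M makes it polynomial in M. *)
Lemma net_efficient : exists2 r : R, 0 < r & forall g L,
  g \is unitarymx -> (0 < L)%N -> is_net (letters g) L (r ^+ 2) ->
  exists c P : nat, forall M A, (0 < M)%N -> A \is unitarymx ->
    exists (k : nat) (z : C) B, [/\ (k <= c * M ^ P)%N, `|z| = 1,
      compositions (gates g) k B & opnorm (A - z *: B) <= M%:R^-1].
Proof.
have [K [r /andP[r0 r1] H]] := net_iterate R d.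
exists r; first exact: r0.
move=> g L gu L0 netL; have Ga := letters_alphabet gu; have [_ _ Gz] := Ga.
have G1 : letters g 1 by apply: Gz; rewrite normr1.
pose D := (2 * d * d).+1; pose E := (d * d * 2)%N.
(* The product of the length l = (4 M) ^ K L and of the pigeonhole bound (3 D 2 M l) ^ E on the
   exponent N, sorted by powers of M. *)
exists (4 ^ K * L * (6 * D * (4 ^ K * L)) ^ E)%N, (K + (1 + K) * E)%N.
have mono a b n : (a <= b)%N -> (a ^ n <= b ^ n)%N.
  by case: n => // n ab; rewrite leq_exp2r.
move=> M A M0 Au; pose k := up_log 2 (2 * M).
have Mk : (2 * M <= 2 ^ k)%N by exact: (up_logP _ (isT : (1 < 2)%N)).
have kM : (2 ^ k <= 4 * M)%N.
  rewrite /k; case: M M0 {Mk k} => // m _.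
  have : (1 < 2 * m.+1)%N by lia.
  move=> m1; have := up_log_bounds (isT : (1 < 2)%N) m1 => /andP[].
  have := up_log_gt0 2 (2 * m.+1); rewrite m1 /=.
  case: (up_log 2 (2 * m.+1)) => // j _ /=; rewrite expnS; lia.
have [w Gw Aw] := H _ _ k Ga L0 netL A Au.
pose l := ((4 * M) ^ K * L)%N.
have l0 : (0 < l)%N by rewrite muln_gt0 expn_gt0 muln_gt0 M0 L0.
have lw : compositions (letters g) l w.
  apply: compositions_le Gw; first exact: G1.
  rewrite leq_mul2r; apply/orP; right; apply: (@leq_trans ((2 ^ K) ^ k)%N).
    exact: mono (ltnW (ltn_expl _ _)).
  by rewrite -expnM mulnC expnM; exact: mono.
(* Half of the precision is left for the inverses, that is 1 / (2 M l) per letter. With D 2 M l as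
   the grid parameter the power N of g is that close to 1, as D exceeds 2 d ^ 2. *)
have Dl0 : (0 < D * (2 * M * l))%N by rewrite muln_gt0 /= (muln_gt0 _ l) l0 muln_gt0 M0.
have [N [N0 NE gN]] := dirichlet_power gu Dl0.
have [j [z [B [jl z1 Bj wB]]]] := letters_to_gates gu N0 gN lw.
exists j, z, B; split; [ | exact: z1 | exact: Bj | ].
  apply: leq_trans jl _.
  apply: (@leq_trans (l * (3 * (D * (2 * M * l))) ^ E)%N).
    rewrite leq_mul2l; apply/orP; right; apply: leq_trans NE _.
    apply: mono; clear - Dl0; lia.
  pose q := (4 ^ K * L)%N.
  have -> : l = (q * M ^ K)%N by rewrite /l expnMn mulnAC.
  have -> : (3 * (D * (2 * M * (q * M ^ K))) = 6 * D * q * M ^ (1 + K))%N.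
    by rewrite expnS; clear; move: D (M ^ K)%N => x y; lia.
  rewrite expnMn -expnM -/q expnD; clear; move: (_ ^ E)%N (M ^ K)%N (M ^ _)%N => x y t.
  by rewrite mulnACA leqnn.
apply: le_trans (opnormB_trans _ w _) _.
have -> : M%:R^-1 = (2 * M)%:R^-1 + (2 * M)%:R^-1 :> R.
  by rewrite natrM; field; rewrite pnatr_eq0 -lt0n.
apply: lerD.
  apply: le_trans Aw _.
  have k1 : 1 <= (2 : R) ^+ k by rewrite exprn_ege1 // ler1n.
  have k0 : 0 < (2 : R) ^+ k by apply: lt_le_trans k1.
  apply: (@le_trans _ _ ((2 ^+ k)^-1)).
    rewrite -[leRHS]mulr1 expr2; apply: ler_pM.
    - by rewrite divr_ge0 ?(ltW r0) ?(ltW k0).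
    - by rewrite divr_ge0 ?(ltW r0) ?(ltW k0).
    - by rewrite ler_pdivrMr // mulVf ?gt_eqF.
    - by rewrite ler_pdivrMr // mul1r; exact: le_trans r1 k1.
  by rewrite lef_pV2 ?posrE ?ltr0n ?muln_gt0 // -natrX ler_nat.
apply: le_trans wB _.
rewrite (natrM _ D) (natrM _ (2 * M) l).
have M1 : ((2 * M)%:R : R) != 0 by rewrite pnatr_eq0 -lt0n muln_gt0.
have l1 : (l%:R : R) != 0 by rewrite pnatr_eq0 -lt0n.
have D1 : (D%:R : R) != 0 by rewrite pnatr_eq0.
have -> : l%:R * ((2 * d * d)%:R / (D%:R * ((2 * M)%:R * l%:R))) =
   (2 * d * d)%:R / D%:R * (2 * M)%:R^-1 :> R.
  move: M1 l1 D1; move: (l%:R) ((2 * M)%:R) (D%:R) ((2 * d * d)%:R) => x y t v y0 x0 t0.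
  by field; rewrite y0 x0 t0.
rewrite ler_piMl ?invr_ge0 ?ler0n //.
by rewrite ler_pdivrMr ?ltr0n // mul1r ler_nat.
Qed.

End Letters.

(** * Roots of unity *)

Section RootsOfUnity.
Variable R : realType.
Local Notation C := (Cplx R).

Lemma expi_neq1 (x : R) : 0 < x -> x < pi *+ 2 -> expi x <> 1.
Proof.
move=> x0 x2 /eqP; rewrite eq_complex /= => /andP[/eqP cx _].
have s0 : 0 < sin (x / 2).
  apply: sin_gt0_pi; rewrite divr_gt0 //= ltr_pdivrMr // mulr_natr; exact: x2.
have xE : x / 2 *+ 2 = x by rewrite -mulr_natr divfK.
have := cos_mulr2n (x / 2); rewrite xE cx cos2sin2.
have := exprn_gt0 2 s0; clear; move: (sin _ ^+ 2) => y y0; rewrite mulr2n; lra.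
Qed.

Lemma expi2pi n : expi (n%:R * (pi *+ 2) : R) = 1.
Proof. by rewrite -expiX /expi cos2pi sin2pi expr1n. Qed.

Lemma expi_prim q : (0 < q)%N -> q.-primitive_root (expi (pi *+ 2 / q%:R) : C).
Proof.
move=> q0; have qR : 0 < (q%:R : R) by rewrite ltr0n.
apply/andP; split; first exact: q0.
apply/forallP => k; apply/eqP; rewrite unity_rootE expiX.
apply/eqP/eqP => [H|kq]; last first.
  by rewrite kq mulrCA mulfV ?gt_eqF // mulr1 -[X in expi X]mul1r (expi2pi 1).
apply/eqP; rewrite eqn_leq ltn_ord /= leqNgt; apply/negP => kq.
move: H; apply: expi_neq1.
  by rewrite mulr_gt0 ?ltr0n // divr_gt0 // mulrn_wgt0 // pi_gt0.
rewrite mulrCA gtr_pMr; last by rewrite mulrn_wgt0 // pi_gt0.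
by rewrite ltr_pdivrMr // mul1r ltr_nat.
Qed.

Lemma expi_close (e : R) : 0 < e -> exists2 del : R, 0 < del &
  forall x y : R, `|x - y| < del -> cabs (expi x - expi y) <= e.
Proof.
move=> e0; have [del del0 H] := expi_first_order (ltr01 : 0 < (1 : R)).
exists (Num.min del (e / 2)); first by rewrite lt_min del0 divr_gt0.
move=> x y; rewrite lt_min => /andP[xd xe].
have -> : expi x - expi y = expi y * (expi (x - y) - 1).
  by rewrite mulrBr mulr1 -expiD (addrC y) subrK.
rewrite cabsM; have /eqP -> : cabs (expi y) == 1 by rewrite cabs_eq1 expi_norm.
rewrite mul1r -[_ - 1](subrK ((x - y)%:C * iC R)).
apply: le_trans (cabsD _ _) _; apply: le_trans (lerD (H _ xd) (lexx _)) _.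
rewrite cabsM cabs_real cabs_iC mul1r mulr1.
by clear - xe; move: (`|_|) xe => t xe; lra.
Qed.

(** Two consecutive powers of the root approximate z, one on each side, and q divides at most one of
    the two exponents. So the approximation can be a primitive root. *)
Lemma root_close (e : R) : 0 < e -> exists N0 : nat, forall q, (N0 < q)%N -> prime q ->
  forall z : C, `|z| = 1 -> exists p : nat, ~~ (q %| p)%N /\
    cabs (z - expi (pi *+ 2 / q%:R) ^+ p) <= e.
Proof.
move=> e0; have [del del0 H] := expi_close e0.
have pi0 : 0 < pi *+ 2 :> R by rewrite mulrn_wgt0 // pi_gt0.
exists (Num.truncn (pi *+ 2 / del)).+1 => q Nq qp z z1.
have qR : 0 < (q%:R : R) by rewrite ltr0n prime_gt0.
have small : pi *+ 2 / q%:R < del.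
  rewrite ltr_pdivrMr // mulrC -ltr_pdivrMr //; apply: lt_trans (truncnS_gt _) _.
  by rewrite ltr_nat.
have [t0 zt] := expi_ex z1.
(* Whole turns are added to make the angle nonnegative, where [truncn] is the integer part. *)
have [t tp zE] : exists2 t : R, 0 <= t & z = expi t.
  have [t0p|t0n] := leP 0 t0; first by exists t0.
  pose n := (Num.truncn (- t0 / (pi *+ 2))).+1.
  exists (t0 + n%:R * (pi *+ 2)); last by rewrite expiD expi2pi mulr1.
  rewrite -lerBlDl sub0r -ler_pdivrMr //; exact/ltW/truncnS_gt.
pose w : R := pi *+ 2 / q%:R; have w0 : 0 < w by rewrite divr_gt0.
have x0 : 0 <= t / w by rewrite divr_ge0 // ltW.
have /andP[p1 p2] := truncn_itv x0; pose p := Num.truncn (t / w).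
rewrite -/p ler_pdivlMr // ltr_pdivrMr // in p1 p2.
have near k : k = p \/ k = p.+1 -> cabs (z - expi w ^+ k) <= e.
  move=> kp; rewrite zE expiX; apply: H; apply: le_lt_trans small.
  rewrite -/w ler_norml; move: p2; rewrite -natr1 mulrDl mul1r => p2.
  by case: kp => ->; rewrite -?natr1 ?mulrDl ?mul1r; clear - p1 p2 w0; apply/andP; split; lra.
have [qd|qd] := boolP (q %| p)%N.
  exists p.+1; split; last by apply: near; right.
  by rewrite -addn1 (dvdn_addr _ qd) dvdn1; apply: contraTneq qp => ->.
by exists p; split=> //; apply: near; left.
Qed.

Lemma distinct_primes (N0 : nat) : exists q : nat -> nat,
  [/\ forall i, prime (q i), forall i, (N0 < q i)%N & injective q].
Proof.
pose f m := s2val (prime_above m).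
have fm m : (m < f m)%N by exact: s2valP (prime_above m).
have fp m : prime (f m) by exact: s2valP' (prime_above m).
pose q i := iter i.+1 f N0.
have qS i : (q i < q i.+1)%N by exact: fm.
have qm i j : (i < j)%N -> (q i < q j)%N.
  by elim: j => // j IH; rewrite ltnS leq_eqVlt => /orP[/eqP->//|/IH /ltn_trans]; apply.
exists q; split=> [i|i|i j qij]; first exact: fp.
  by elim: i => [|i IH]; [exact: fm | exact: ltn_trans (qS i)].
case: (ltngtP i j) => // /qm; by rewrite qij ltnn.
Qed.

(* The entries of z are primitive roots of unity of distinct prime orders, so
   an exponent divisible by the other orders moves the entry a only. *)
Lemma torus_generator d (z0 : 'rV[C]_d) (e : R) : (forall i, `|z0 0 i| = 1) -> 0 < e ->
  exists z : 'rV[C]_d, [/\ forall i, `|z 0 i| = 1,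
    forall i, cabs (z 0 i - z0 0 i) <= e &
    forall a (w : C), `|w| = 1 -> exists k : nat, cabs (z 0 a ^+ k - w) <= e /\
      forall b, b != a -> z 0 b ^+ k = 1].
Proof.
move=> z01 e0; have [N0 H] := root_close e0.
have [q [qp qN qi]] := distinct_primes N0.
pose om (i : 'I_d) : C := expi (pi *+ 2 / (q i)%:R).
have omp (i : 'I_d) : (q i).-primitive_root (om i) by apply: expi_prim; exact: prime_gt0.
have om1 (i : 'I_d) : `|om i| = 1 by exact: expi_norm.
have /choice[p pP] (i : 'I_d) : exists p : nat, ~~ (q i %| p)%N /\ cabs (z0 0 i - om i ^+ p) <= e.
  exact: H.
have zp (i : 'I_d) : (q i).-primitive_root (om i ^+ p i).
  rewrite prim_root_exp_coprime //; have [qd _] := pP i.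
  by rewrite coprime_sym prime_coprime.
exists (\row_i om i ^+ p i); split.
- by move=> i; rewrite mxE normrX om1 expr1n.
- by move=> i; rewrite mxE -cabsN opprB; have [] := pP i.
move=> a w w1.
pose m := (\prod_(b : 'I_d | b != a) q b)%N.
have co : coprime m (q a).
  apply: (big_ind (fun x => coprime x (q a))); first exact: coprime1n.
    by move=> x y xa ya; rewrite coprimeMl xa.
  move=> b ba.
  rewrite prime_coprime // dvdn_prime2 //; apply: contra ba => /eqP/qi/val_inj ->.
  by rewrite eqxx.
have mp : (q a).-primitive_root ((om a ^+ p a) ^+ m) by rewrite prim_root_exp_coprime.
have [p' [_ wp']] := H (q a) (qN _) (qp _) w w1.
have [|j jE] := prim_rootP mp (x := om a ^+ p').
  by rewrite -exprM mulnC exprM (prim_expr_order (omp a)) expr1n.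
exists (m * j)%N; split.
  by rewrite mxE exprM -jE -cabsN opprB.
move=> b ba; rewrite mxE exprM.
have : (q b %| m)%N by rewrite /m (bigD1 b) //= dvdn_mulr.
move=> /dvdnP[c ->]; rewrite mulnC exprM (prim_expr_order (zp b)).
by rewrite !expr1n.
Qed.

End RootsOfUnity.

(** * Density of the universal gates *)

Section Generic.
Variables (R : realType) (d : nat).
Local Notation C := (Cplx R).

Lemma rotation_genK_mul a b (s : R) (v : 'cV[C]_d) : a != b ->
  rotation (genK R a b) s *m v = \col_i
    (if i == a then (Num.sqrt (1 - s ^+ 2))%:C * v a 0 + s%:C * v b 0
     else if i == b then (Num.sqrt (1 - s ^+ 2))%:C * v b 0 - s%:C * v a 0 else v i 0).
Proof.
move=> ab; have ba : (b == a) = false by rewrite eq_sym; exact: negPf.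
have K2 : genK R a b * genK R a b = - (delta_mx a a + delta_mx b b) :> 'M[C]_d.
  rewrite /genK -[_ * _]/(_ *m _) !(mulmxBl, mulmxBr) !mul_delta_mx_cond.
  by rewrite !eqxx ba (negPf ab) !mulr1n !mulr0n sub0r subr0 opprD.
have dv c e : (delta_mx c e : 'M[C]_d) *m v = v e 0 *: delta_mx c 0.
  apply/colP => i; rewrite !mxE (bigD1 e) //= big1; last first.
    by move=> j je; rewrite mxE (negPf je) andbF mul0r.
  by rewrite !mxE eqxx !andbT addr0 mulrC.
rewrite /rotation K2 !mulmxDl mul1mx -!scalemxAl mulNmx mulmxDl /genK mulmxBl !dv.
have -> : (1 - Num.sqrt (1 - s ^+ 2))%:C = 1 - (Num.sqrt (1 - s ^+ 2))%:C :> C.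
  by rewrite rmorphB rmorph1.
move: ((Num.sqrt _)%:C) (s%:C) => r t; apply/colP => i; rewrite !mxE !andbT.
case: (eqVneq i a) => [->|ia]; first by rewrite (negPf ab) ?mulr1n ?mulr0n; ring.
by case: (eqVneq i b) => [->|ib]; rewrite ?mulr1n ?mulr0n; ring.
Qed.

(** Induction on the number of zero coordinates. A small rotation in the plane of a zero and a
    nonzero coordinate makes both nonzero and leaves the others alone; half of e is spent on it. *)
Lemma generic_rotation (v : 'cV[C]_d) (e : R) : v != 0 -> 0 < e ->
  exists Q : 'M[C]_d, [/\ Q \is unitarymx, opnorm (Q - 1) <= e &
    forall i, (Q *m v) i 0 != 0].
Proof.
have [n] := ubnP #|[pred i : 'I_d | v i 0 == 0]|; elim: n v e => // n IH v e.
move=> cn v0 e0.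
have [b vb] : exists b, v b 0 != 0.
  apply/existsP; apply: contraNT v0; rewrite negb_exists => /forallP v0.
  by apply/eqP/colP => i; rewrite mxE; apply/eqP; have := v0 i; rewrite negbK.
have [/existsP[a /eqP va]|/existsPn noz] := boolP [exists a, v a 0 == 0]; last first.
  exists 1; split; [exact: unitarymx1 | by rewrite subrr opnorm0 ltW | ].
  by move=> i; rewrite mul1mx; exact: noz.
have ab : a != b by apply: contraNneq vb => <-; rewrite va.
(* The first bound keeps the cosine positive. By the second, the rotation moves 1 by at most 4 s <=
   e / 3. *)
pose s := Num.min (2^-1) (e / 12).
have s0 : 0 < s by rewrite lt_min invr_gt0 ltr0n divr_gt0.
have s2 : s <= 2^-1 by rewrite ge_min lexx.
have se : s * 12 <= e by rewrite -ler_pdivlMr // ge_min lexx orbT.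
have ns : `|s| <= 1 by rewrite ger0_norm ?(ltW s0) //; apply: le_trans s2 _; rewrite invf_le1 // ler1n.
have c0 : 0 < Num.sqrt (1 - s ^+ 2).
  rewrite sqrtr_gt0; clear - s0 s2; nra.
pose Q1 := rotation (genK R a b) s.
have [Y3 _ _] := gen_cube R ab; have [Yn _ _] := opnorm_gen R a b.
have Q1u : Q1 \is unitarymx := rotation_unitary (skew_genK R a b) Y3 ns.
have Q1n : opnorm (Q1 - 1) <= e / 2.
  rewrite -[Q1 - 1](subrK (s%:C *: genK R a b)).
  apply: le_trans (opnormD _ _) _.
  apply: le_trans (lerD (rotation_first_order _ ns) (opnormZ_real _ _)) _.
  rewrite (ger0_norm (ltW s0)).
  have y0 := opnorm_ge0 (genK R a b : 'M[C]_d); move: y0 Yn; move: (opnorm _) => y y0 y2.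
  clear - s0 s2 se y0 y2.
  have h1 : s * y <= s * 2 by rewrite ler_wpM2l // ltW.
  have h2 : s ^+ 2 * y ^+ 2 <= s * 2.
    have -> : s ^+ 2 * y ^+ 2 = (s * y) * (s * y) by ring.
    have h3 : 0 <= s * y by rewrite mulr_ge0 // ltW.
    have h4 : s * y <= 1 by lra.
    by apply: le_trans h1; rewrite ler_piMr.
  lra.
have vE i : (Q1 *m v) i 0 = if i == a then s%:C * v b 0
    else if i == b then (Num.sqrt (1 - s ^+ 2))%:C * v b 0 else v i 0.
  by rewrite /Q1 rotation_genK_mul // mxE va !mulr0 add0r subr0.
have nz (t : R) : 0 < t -> (t%:C * v b 0 : C) != 0.
  move=> t0; rewrite mulf_neq0 //; apply/eqP => /complexI t00.
  by rewrite t00 ltxx in t0.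
have [|||Q [Qu Qn Qv]] := IH (Q1 *m v) (e / 2).
- rewrite -ltnS; apply: leq_trans cn; rewrite ltnS; apply: proper_card.
  apply/properP; split.
    apply/fintype.subsetP => i; rewrite !inE vE; case: ifP => [_|_].
      by rewrite (negPf (nz _ s0)).
    by case: ifP => [_|//]; rewrite (negPf (nz _ c0)).
  by exists a; rewrite inE ?va ?eqxx // vE eqxx; exact: nz.
- apply/eqP => /colP/(_ a); rewrite vE eqxx mxE => /eqP.
  by rewrite (negPf (nz _ s0)).
- by rewrite divr_gt0.
exists (Q * Q1); split.
- exact: unitarymxM.
- have -> : Q * Q1 - 1 = (Q - 1) * Q1 + (Q1 - 1) by rewrite mulrBl mul1r addrA subrK.
  apply: le_trans (opnormD _ _) _; rewrite (splitr e).
  exact: lerD (le_trans (opnormM_unitaryr _ Q1u) Qn) Q1n.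
- by move=> i; rewrite -[Q * Q1]/(Q *m Q1) -mulmxA.
Qed.

(** * The group generated by the diagonal torus and a reflection *)

Definition one_phase (a : 'I_d) (w : C) : 'rV[C]_d := \row_i (if i == a then w else 1).

Definition torus_letters (T : 'M[C]_d) : set 'M[C]_d := [set A |
  (exists a, exists2 w : C, `|w| = 1 & A = diag_mx (one_phase a w)) \/ A = T].

Lemma diag_mx_frame (z : 'rV[C]_d) : diag_mx z = frame 1 z.
Proof. by rewrite /frame dag1 mul1r mulr1. Qed.

(** The torus contributes all i E_cc. For j distinct from a and b, which exists as d > 2,
    conjugating i E_jj by T yields a tangent vector with entry i T_aj T_jb at (a, b). It is nonzero,
    the off-diagonal entries of T being products of coordinates of v and their conjugates up to
    sign; [tangent_pair_torus] isolates it. *)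
Lemma torus_reflection_dense (v : 'cV[C]_d) (T : 'M[C]_d) : (2 < d)%N ->
  T = 1 - v *m v^t* -> T \is unitarymx -> T^t* = T -> (forall i, v i 0 != 0) ->
  forall A (e : R), A \is unitarymx -> 0 < e ->
  exists L, exists2 w, compositions (torus_letters T) L w & opnorm (A - w) <= e.
Proof.
move=> d3 TE Tu Td vn.
pose S : set 'M[C]_d := [set w | exists L, compositions (torus_letters T) L w].
have LU A : torus_letters T A -> A \is unitarymx.
  case=> [[a [w w1 ->]]|->]; last exact: Tu.
  rewrite diag_mx_frame; apply: frame_unitary; first exact: unitarymx1.
  by move=> i; rewrite mxE; case: ifP; rewrite ?w1 ?normr1.
have Ld A : torus_letters T A -> torus_letters T (A^t*).
  case=> [[a [w w1 ->]]|->]; last by right.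
  left; exists a, (w^*)%R; first by rewrite norm_conjC.
  rewrite tr_diag_mx map_diag_mx; congr diag_mx; apply/rowP => i; rewrite !mxE.
  by case: ifP => // _; exact: rmorph1.
have SU A : S A -> A \is unitarymx by case=> L; exact: compositions_unitary.
have S1 : S 1 by exists 0%N; exact: compositions0.
have SM A B : S A -> S B -> S (A * B).
  by move=> [L AL] [K BK]; exists (L + K)%N; exact: compositionsD.
have Sd A : S A -> S (A^t*) by move=> [L AL]; exists L; exact: compositions_adj.
have ST : S T by exists 1%N; apply: compositions1; right.
have TD c : tangent S (iC R *: delta_mx c c).
  apply: tangent_rotation => s s1; exists 1%N; apply: compositions1; left.
  exists c, (Num.sqrt (1 - s ^+ 2) +i* s).
    apply/eqP; rewrite -cabs_eq1 -(@eqrXn2 _ 2) ?cabs_ge0 // cabs_sqr /=.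
    rewrite sqr_sqrtr ?subrK ?expr1n //.
    by rewrite subr_ge0 -(real_normK (num_real s)) expr_le1.
  have dd : (iC R *: delta_mx c c) * (iC R *: delta_mx c c) = - delta_mx c c :> 'M[C]_d.
    rewrite -[LHS]/((iC R *: delta_mx c c) *m (iC R *: delta_mx c c)).
    by rewrite -scalemxAl -scalemxAr scalerA iC_sqr mul_delta_mx scaleN1r.
  rewrite /rotation dd.
  apply/matrixP => i j; rewrite !mxE.
  have zE : Num.sqrt (1 - s ^+ 2) +i* s = (Num.sqrt (1 - s ^+ 2))%:C + s%:C * iC R :> C.
    exact: cplxE.
  have -> : (1 - Num.sqrt (1 - s ^+ 2))%:C = 1 - (Num.sqrt (1 - s ^+ 2))%:C :> C.
    by rewrite rmorphB rmorph1.
  rewrite zE; move: ((Num.sqrt _)%:C) (s%:C) => r t.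
  case: (eqVneq i j) => [->|ij]; rewrite ?mulr1n ?mulr0n.
    by case: (j == c); rewrite /= ?mulr1n ?mulr0n; ring.
  have -> : (i == c) && (j == c) = false.
    by apply: contraNF ij => /andP[/eqP -> /eqP ->].
  by rewrite mulr0n; ring.
have Tpair a b : tangent_pair S a b.
  have [->|ab] := eqVneq a b; first by move=> /eqP.
  have [j ja jb] : exists2 j : 'I_d, j != a & j != b.
    have : (0 < #|[predC [:: a; b]]|)%N.
      by rewrite -(ltn_add2l #|[:: a; b]|) cardC card_ord addn0; apply: leq_ltn_trans (card_size _) _.
    by case/card_gt0P => j; rewrite !inE negb_or => /andP[]; exists j.
  have TX := tangent_conj SU SM Sd ST (TD j).
  have Xij : (T * (iC R *: delta_mx j j) * T^t*) a b = iC R * (T a j * T j b).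
    rewrite Td -[T * _ * T]/(T *m (iC R *: delta_mx j j) *m T) -scalemxAr -scalemxAl mxE.
    congr (_ * _); rewrite !mxE (bigD1 j) //= big1; last first.
      by move=> k kj; rewrite !mxE big1 ?mul0r // => l _; rewrite !mxE (negPf kj) andbF mulr0.
    rewrite !mxE (bigD1 j) //= big1 ?addr0; last first.
      by move=> l lj; rewrite !mxE (negPf lj) mulr0.
    by rewrite !mxE !eqxx mulr1.
  have Toff (k l : 'I_d) : k != l -> T k l != 0.
    move=> kl; rewrite TE !mxE (negPf kl) mulr0n sub0r oppr_eq0 big_ord1 !mxE.
    by rewrite mulf_neq0 ?conjC_eq0.
  apply: (tangent_pair_torus SU SM Sd TD TX).
    rewrite /antiherm !dagM dagK dagZ dag_delta conj_iC scaleNr mulNr mulrN mulrA.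
    by [].
  rewrite Xij !mulf_neq0 ?Toff //; last by rewrite eq_sym.
  by apply/eqP => i0; have := iC_sqr R; rewrite i0 mulr0 => /eqP; rewrite eq_sym oppr_eq0 oner_eq0.
have Tfull : forall X, antiherm X -> tangent S X.
  apply: (tangent_full SU S1 SM Sd _ Tpair).
  have -> : 1%:M = \sum_a delta_mx a a :> 'M[C]_d.
    by rewrite scalar_mx_sum_delta; apply: eq_bigr => a _; rewrite scale1r.
  by rewrite scaler_sumr; apply: (tangent_sum SU S1 SM) => a _; exact: TD.
move=> A e Au e0; have [w [L wL] Aw] := tangent_dense SU S1 SM Tfull Au e0.
by exists L, w.
Qed.

(** The words are written in the coordinates in which the torus is diagonal, hence the conjugations
    by P. Each phase letter is replaced by one power of [frame P z], while T is reproduced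
    exactly. *)
Lemma torus_word_approx (P T : 'M[C]_d) (z : 'rV[C]_d) (del : R) L A :
  P \is unitarymx -> T \is unitarymx -> T^t* = T -> (forall i, `|z 0 i| = 1) -> 0 <= del ->
  (forall a (w : C), `|w| = 1 -> exists k : nat, cabs (z 0 a ^+ k - w) <= del /\
      forall b, b != a -> z 0 b ^+ k = 1) ->
  compositions (torus_letters (P * T * P^t*)) L A ->
  exists K, exists2 B, compositions (letters T (frame P z)) K B &
    opnorm (P^t* * A * P - B) <= L%:R * del.
Proof.
move=> Pu Tu Td z1 del0 zgen.
have gu : frame P z \is unitarymx := frame_unitary Pu z1.
have [GU _ _] := letters_alphabet Tu Td gu.
move: L A; apply: compositions_ind.
  exists 0%N, 1; first exact: compositions0.
  by rewrite mulr1 (unitarymx_mulV Pu) subrr opnorm0 mul0r.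
move=> L A D _ [K [B Bw AB]] HD.
have [j [D' jD' [Du DD']]] : exists j, exists2 D', compositions (letters T (frame P z)) j D' &
    P^t* * D * P \is unitarymx /\ opnorm (P^t* * D * P - D') <= del.
  case: HD => [[a [w w1 ->]]|->].
    have [k [zk zb]] := zgen a w w1; exists k, (frame P z ^+ k).
      rewrite -[X in compositions _ X]mul1n; apply: compositionsX; apply: compositions1.
      by exists 1; [rewrite normr1 | constructor 1; rewrite scale1r].
    rewrite -/(frame P (one_phase a w)); split.
      by apply: (frame_unitary Pu) => i; rewrite mxE; case: ifP; rewrite ?w1 ?normr1.
    rewrite (frameX _ _ Pu) -frameB; apply: le_trans (opnorm_frame_le _ Pu) _.
    rewrite (bigD1 a) //= big1 ?addr0; last first.
      by move=> i ia; rewrite !mxE (negPf ia) (zb i ia) subrr cabs0.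
    by rewrite !mxE eqxx -cabsN opprB.
  have PT : P^t* * (P * T * P^t*) * P = T.
    have -> : P^t* * (P * T * P^t*) * P = (P^t* * P) * T * (P^t* * P) by rewrite !mulrA.
    by rewrite (unitarymx_mulV Pu) mul1r mulr1.
  exists 1%N, T; last by rewrite PT subrr opnorm0; split; [exact: Tu | exact: del0].
  by apply: compositions1; exists 1; [rewrite normr1 | constructor 3; rewrite scale1r].
exists (K + j)%N, (B * D'); first exact: compositionsD Bw jD'.
have -> : P^t* * (A * D) * P = (P^t* * A * P) * (P^t* * D * P).
  have -> : (P^t* * A * P) * (P^t* * D * P) = P^t* * A * (P * P^t*) * (D * P) by rewrite !mulrA.
  by rewrite (unitarymx_mulVr Pu) mulr1 !mulrA.
apply: le_trans (opnormM_sub _ _ (compositions_unitary GU Bw) Du) _.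
by rewrite -natr1 mulrDl mul1r; exact: lerD AB DD'.
Qed.

(** The order of choices matters: first the new eigenbasis, then words in its torus and T for the
    points of the net, and only then, knowing their lengths, eigenvalues whose powers are precise
    enough. *)
Lemma good_dense (I : finType) (u : I -> 'M[C]_d) (T : 'M[C]_d) (w : 'cV[C]_d)
    (e eps : R) g0 : (2 < d)%N -> T = 1 - w *m w^t* -> T \is unitarymx -> T^t* = T ->
  w != 0 -> (forall t, u t \is unitarymx) -> 0 < e -> g0 \is unitarymx -> 0 < eps ->
  exists g, [/\ g \is unitarymx, opnorm (g0 - g) <= eps & good T u e g].
Proof.
move=> d3 TE Tu Td w0 uU e0 g0u eps0.
have [P0 [z0 [P0u z01 g0E]]] := unitary_diag g0u.
have v0 : P0 *m w != 0.
  apply: contraNneq w0 => H; rewrite -[w]mul1mx.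
  have <- : P0^t* *m P0 = 1%:M by exact: unitarymx_mulV.
  by rewrite -mulmxA H mulmx0.
have eps4 : 0 < eps / 4 by rewrite divr_gt0.
have [Q [Qu Qn Qv]] := generic_rotation v0 eps4.
pose P := Q * P0; have Pu : P \is unitarymx := unitarymxM Qu P0u.
have PP0 : opnorm (P - P0) <= eps / 4.
  have -> : P - P0 = (Q - 1) * P0 by rewrite mulrBl mul1r.
  exact: le_trans (opnormM_unitaryr _ P0u) Qn.
have vn i : (P *m w) i 0 != 0.
  by rewrite /P -[Q * P0]/(Q *m P0) -mulmxA.
clearbody P; pose v := P *m w; rewrite -/v in vn.
pose T' := P * T * P^t*.
have T'u : T' \is unitarymx := unitarymxM (unitarymxM Pu Tu) (adj_unitary Pu).
have T'd : T'^t* = T' by rewrite /T' (dagM (P * T)) (dagM P) dagK Td mulrA.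
have T'E : T' = 1 - v *m v^t*.
  rewrite /T' TE /v trmx_mul map_mxM (mulrBr P) mulr1 mulrBl (unitarymx_mulVr Pu).
  congr (1 - _); rewrite -[P * (w *m w^t*) * P^t*]/(P *m (w *m w^t*) *m P^t*).
  by rewrite !mulmxA.
have e2 : 0 < e / 2 by rewrite divr_gt0.
have /choice[L LP] t : exists L, exists2 A, compositions (torus_letters T') L A &
    opnorm (P * u t * P^t* - A) <= e / 2.
  apply: (torus_reflection_dense d3 T'E T'u T'd vn _ e2).
  exact: unitarymxM (unitarymxM Pu (uU t)) (adj_unitary Pu).
pose M := \max_t L t.
(* First bound: at most M letters, each off by [del], cost strictly less than e / 2. Second bound:
   moving d eigenvalues by [del] costs at most eps / 2; the two occurrences of the frame account for
   eps / 4 each. *)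
pose del := Num.min (e / 2 / M.+1%:R) (eps / 2 / d%:R).
have dR : 0 < (d%:R : R) by rewrite ltr0n; exact: ltn_trans d3.
have eps2 : 0 < eps / 2 by rewrite divr_gt0.
have del0 : 0 < del.
  by rewrite lt_min (divr_gt0 eps2 dR) andbT; apply: (divr_gt0 e2); exact: ltr0Sn.
have [z [z1 zz0 zgen]] := torus_generator z01 del0.
exists (frame P z); split.
- exact: frame_unitary Pu z1.
- rewrite g0E; apply: le_trans (opnormB_trans _ (frame P z0) _) _.
  rewrite (splitr eps); apply: lerD.
    have Du : diag_mx z0 \is unitarymx.
      by rewrite diag_mx_frame; exact: frame_unitary (unitarymx1 _ _) z01.
    rewrite opnormB /frame; apply: le_trans (opnormM_sub _ _ (unitarymxM (adj_unitary P0u) Du) Pu) _.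
    have : opnorm (P^t* * diag_mx z0 - P0^t* * diag_mx z0) <= eps / 4.
      rewrite -mulrBl; apply: le_trans (opnormM_unitaryr _ Du) _.
      exact: le_trans (opnorm_adj_sub Pu P0u) PP0.
    move=> h; apply: le_trans (lerD h PP0) _.
    by clear; move: eps => x; lra.
  rewrite -frameB; apply: le_trans (opnorm_frame_le _ Pu) _.
  apply: (@le_trans _ _ (\sum_(i < d) del)).
    by apply: ler_sum => i _; rewrite !mxE -cabsN opprB.
  rewrite sumr_const card_ord -[X in X <= _]mulr_natr -ler_pdivlMr //.
  by rewrite ge_min lexx orbT.
move=> t; have [A Aw At] := LP t.
have [K [B Bw AB]] := torus_word_approx Pu Tu Td z1 (ltW del0) zgen Aw.
exists K, B; first exact: Bw.
apply: le_lt_trans (opnormB_trans _ (P^t* * A * P) _) _.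
have h1 : opnorm (u t - P^t* * A * P) <= e / 2.
  have -> : u t - P^t* * A * P = P^t* * (P * u t * P^t* - A) * P.
    rewrite mulrBr mulrBl.
    have -> : P^t* * (P * u t * P^t*) * P = (P^t* * P) * u t * (P^t* * P) by rewrite !mulrA.
    by rewrite (unitarymx_mulV Pu) mul1r mulr1.
  apply: le_trans (opnormM_unitaryr _ Pu) _.
  exact: le_trans (opnormM_unitaryl _ (adj_unitary Pu)) At.
have h2 : (L t)%:R * del < e / 2.
  apply: (@le_lt_trans _ _ (M%:R * del)).
    by rewrite ler_wpM2r ?(ltW del0) // ler_nat leq_bigmax.
  apply: (@lt_le_trans _ _ (M.+1%:R * del)); first by rewrite ltr_pM2r // ltr_nat.
  by rewrite mulrC -ler_pdivlMr ?ltr0n // ge_min lexx.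
rewrite (splitr e); exact: ler_ltD h1 (le_lt_trans AB h2).
Qed.

End Generic.

(** * Gates on pairs of qubits *)

Section Bits.
Variable n : nat.
Implicit Types (x y z : 'I_(2 ^ n)) (i j k : 'I_n) (a b c : 'I_2).

Lemma qbitE x k : val (qbit x k) = ((x %/ 2 ^ (n - k.+1)) %% 2)%N.
Proof. by rewrite /qbit /= inordK // ltn_pmod. Qed.

Lemma qbit_inj x y : (forall k, qbit x k = qbit y k) -> x = y.
Proof.
move=> xy; apply: val_inj.
have H m : (m <= n)%N -> (x %/ 2 ^ (n - m) = y %/ 2 ^ (n - m))%N.
  elim: m => [_|m IH mn]; first by rewrite subn0 !divn_small.
  have E : (2 ^ (n - m) = 2 ^ (n - m.+1) * 2)%N by rewrite -expnSr subnSK.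
  have := congr1 val (xy (Ordinal mn)); rewrite !qbitE /= => b.
  have := IH (ltnW mn); rewrite E !divnMA => q.
  by rewrite (divn_eq (x %/ 2 ^ (n - m.+1)) 2) q b -divn_eq.
by have := H n (leqnn n); rewrite subnn expn0 !divn1.
Qed.

Lemma qbit_surj (f : 'I_n -> 'I_2) : exists x, forall k, qbit x k = f k.
Proof.
pose bits x := [ffun k => qbit x k].
have bi : injective bits.
  by move=> x y /ffunP xy; apply: qbit_inj => k; have := xy k; rewrite !ffunE.
have [g _ gK] : bijective bits.
  by apply: inj_card_bij => //; rewrite card_ffun !card_ord.
exists (g [ffun k => f k]) => k.
by have /ffunP/(_ k) := gK [ffun k => f k]; rewrite !ffunE.
Qed.

Lemma setbit_ex x i c : exists z, forall k, qbit z k = if k == i then c else qbit x k.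
Proof. exact: qbit_surj. Qed.

Definition setbit x i c := projT1 (cid (setbit_ex x i c)).

Lemma qbit_setbit x i c k : qbit (setbit x i c) k = if k == i then c else qbit x k.
Proof. by rewrite /setbit; case: cid. Qed.

Definition same_off x y (P : pred 'I_n) :=
  [forall k, P k ==> (qbit x k == qbit y k)].

Lemma same_offP x y (P : pred 'I_n) :
  reflect (forall k, P k -> qbit x k = qbit y k) (same_off x y P).
Proof.
apply: (iffP forallP) => H k; first by move=> Pk; apply/eqP; exact: (implyP (H k)).
by apply/implyP => /H ->.
Qed.

Lemma same_offC x y P : same_off x y P = same_off y x P.
Proof. by apply/same_offP/same_offP => H k /H. Qed.

Lemma same_off_trans y x z P : same_off x y P -> same_off y z P = same_off x z P.
Proof.
move=> /same_offP xy; apply/same_offP/same_offP => H k Pk; first by rewrite xy // H.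
by rewrite -xy // H.
Qed.

Definition pbit0 (p : 'I_4) : 'I_2 := inord (p %/ 2).
Definition pbit1 (p : 'I_4) : 'I_2 := inord (p %% 2).

Lemma pair_indexE a b : val (pair_index a b) = (2 * a + b)%N.
Proof.
rewrite /pair_index /= inordK //.
by case: a b => [a a2] [b b2] /=; lia.
Qed.

Lemma pbit0K a b : pbit0 (pair_index a b) = a.
Proof.
apply: val_inj; rewrite /pbit0 pair_indexE.
by case: a b => [a a2] [b b2] /=; rewrite inordK; lia.
Qed.

Lemma pbit1K a b : pbit1 (pair_index a b) = b.
Proof.
apply: val_inj; rewrite /pbit1 pair_indexE.
by case: a b => [a a2] [b b2] /=; rewrite inordK; lia.
Qed.

Lemma pair_bitK p : pair_index (pbit0 p) (pbit1 p) = p.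
Proof.
apply: val_inj; rewrite pair_indexE /pbit0 /pbit1; case: p => [p p4] /=.
by rewrite !inordK; lia.
Qed.

End Bits.

Section Place.
Variables (R : realType) (n : nat).
Local Notation C := (Cplx R).
Implicit Types (x y z : 'I_(2 ^ n)) (i j k : 'I_n).

Lemma place2E (g : 'M[C]_4) i j x y : place2 g i j x y =
  if same_off x y (fun k => (k != i) && (k != j))
  then g (pair_index (qbit x i) (qbit x j)) (pair_index (qbit y i) (qbit y j)) else 0.
Proof. by rewrite mxE. Qed.

Lemma place1E (g : 'M[C]_2) i x y : place1 g i x y =
  if same_off x y (fun k => k != i) then g (qbit x i) (qbit y i) else 0.
Proof. by rewrite mxE. Qed.

Lemma sum_off2 (V : nmodType) i j x (F : 'I_(2 ^ n) -> V) : i != j ->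
  \sum_(z | same_off x z (fun k => (k != i) && (k != j))) F z
  = \sum_(p : 'I_4) F (setbit (setbit x i (pbit0 p)) j (pbit1 p)).
Proof.
move=> ij.
rewrite (reindex_onto (fun p => setbit (setbit x i (pbit0 p)) j (pbit1 p))
  (fun z => pair_index (qbit z i) (qbit z j))) /=; last first.
  move=> z /same_offP xz; apply: qbit_inj => k; rewrite !qbit_setbit pbit0K pbit1K.
  case: (eqVneq k j) => [->//|kj]; case: (eqVneq k i) => [->//|ki].
  by rewrite xz // ki kj.
apply: eq_bigl => p; apply/andP; split.
  by apply/same_offP => k /andP[ki kj]; rewrite !qbit_setbit (negPf ki) (negPf kj).
by rewrite !qbit_setbit !eqxx (negPf ij) pair_bitK.
Qed.

Lemma sum_off1 (V : nmodType) i x (F : 'I_(2 ^ n) -> V) :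
  \sum_(z | same_off x z (fun k => k != i)) F z = \sum_(c : 'I_2) F (setbit x i c).
Proof.
rewrite (reindex_onto (fun c => setbit x i c) (fun z => qbit z i)) /=; last first.
  move=> z /same_offP xz; apply: qbit_inj => k; rewrite qbit_setbit.
  by case: (eqVneq k i) => [->//|ki]; rewrite xz.
apply: eq_bigl => c; apply/andP; split; last by rewrite qbit_setbit eqxx.
by apply/same_offP => k ki; rewrite qbit_setbit (negPf ki).
Qed.

Section Pair.
Variables i j : 'I_n.
Hypothesis ij : i != j.
Implicit Types g h : 'M[C]_4.

Lemma place2M g h : place2 (g * h) i j = place2 g i j * place2 h i j.
Proof.
apply/matrixP => x y; rewrite -[RHS]/((place2 g i j *m place2 h i j) x y) !mxE.
rewrite (eq_bigr (fun z => if same_off x z (fun k => (k != i) && (k != j)) then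
   g (pair_index (qbit x i) (qbit x j)) (pair_index (qbit z i) (qbit z j)) *
   place2 h i j z y else 0)); last first.
  by move=> z _; rewrite (place2E g); case: ifP => _; [|exact: mul0r].
rewrite -big_mkcond sum_off2 // -/(same_off x y _).
have off p : same_off (setbit (setbit x i (pbit0 p)) j (pbit1 p)) y
    (fun k => (k != i) && (k != j)) = same_off x y (fun k => (k != i) && (k != j)).
  apply: same_off_trans; apply/same_offP => k /andP[ki kj].
  by rewrite !qbit_setbit (negPf ki) (negPf kj).
case: ifP => xy.
  apply: eq_bigr => p _; rewrite place2E off xy !qbit_setbit !eqxx (negPf ij).
  by rewrite pair_bitK.
by rewrite big1 // => p _; rewrite place2E off xy mulr0.
Qed.

Lemma place2_1 : place2 (1 : 'M[C]_4) i j = 1.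
Proof.
apply/matrixP => x y; rewrite place2E !mxE; case: ifP => [/same_offP xy|].
  congr (_%:R); congr nat_of_bool; apply/eqP/eqP => [|->//].
  move=> E; apply: qbit_inj => k.
  have E0 := congr1 pbit0 E; have E1 := congr1 pbit1 E; rewrite !pbit0K !pbit1K in E0 E1.
  case: (eqVneq k j) => [->//|kj]; case: (eqVneq k i) => [->//|ki].
  by rewrite xy // ki kj.
case: eqP => // -> /same_offP; by case.
Qed.

Lemma place2D g h : place2 (g + h) i j = place2 g i j + place2 h i j.
Proof. by apply/matrixP => x y; rewrite !mxE; case: ifP => _; rewrite ?addr0. Qed.

Lemma place2Z (c : C) g : place2 (c *: g) i j = c *: place2 g i j.
Proof. by apply/matrixP => x y; rewrite !mxE; case: ifP => _; rewrite ?mulr0. Qed.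

Lemma place2_dag g : place2 (g^t*) i j = (place2 g i j)^t*.
Proof.
apply/matrixP => x y; rewrite place2E !mxE -/(same_off y x _) same_offC.
by case: ifP => _; rewrite ?rmorph0.
Qed.

Lemma place2_unitary g : g \is unitarymx -> place2 g i j \is unitarymx.
Proof.
move=> gu; apply/unitarymxP; rewrite -place2_dag -[_ *m _]/(_ * _) -place2M.
by rewrite (unitarymx_mulVr gu) place2_1.
Qed.

Lemma place2_0 : place2 (0 : 'M[C]_4) i j = 0.
Proof. by rewrite -(scale0r 0) place2Z scale0r. Qed.

Lemma place2_sum (I : Type) (r : seq I) (P : pred I) (F : I -> 'M[C]_4) :
  place2 (\sum_(k <- r | P k) F k) i j = \sum_(k <- r | P k) place2 (F k) i j.
Proof. by apply: (big_morph (fun g => place2 g i j)); [exact: place2D|exact: place2_0]. Qed.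

Lemma place2_rotation g s : place2 (rotation g s) i j = rotation (place2 g i j) s.
Proof. by rewrite /rotation !place2D !place2Z place2M place2_1. Qed.

(** Placed unitaries are unitary, whatever n is. So E_cc is expressed as (1 - r) / 2 with a
    reflection r, and E_ab as E_aa times the rotation by a right angle. *)
Lemma opnorm_place2_delta a b : opnorm (place2 (delta_mx a b : 'M[C]_4) i j) <= 1.
Proof.
have diag c : opnorm (place2 (delta_mx c c : 'M[C]_4) i j) <= 1.
  pose r : 'M[C]_4 := 1 - 2 *: delta_mx c c.
  have ru : r \is unitarymx.
    apply/unitarymxP; rewrite dagD dagN dagZ dag1 dag_delta conjC_nat -/r.
    rewrite mulmxBl mul1mx !mulmxBr mulmx1 -!scalemxAl -!scalemxAr mul_delta_mx.
    by rewrite scalerA; apply/matrixP => k l; rewrite !mxE; ring.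
  have -> : delta_mx c c = (2^-1)%:C *: (1 - r) :> 'M[C]_4.
    rewrite /r opprB addrCA subrr addr0 scalerA.
    have -> : (2^-1)%:C * 2 = 1 :> C.
      by rewrite -(rmorph_nat (real_complex R)) -rmorphM mulVf ?pnatr_eq0.
    by rewrite scale1r.
  rewrite place2Z -scaleN1r place2D place2Z place2_1 scaleN1r.
  apply: le_trans (opnormZ_real _ _) _; rewrite ger0_norm ?invr_ge0 //.
  rewrite ler_pdivrMl // mulr1; apply: le_trans (opnormD _ _) _; rewrite opnormN.
  exact: lerD (opnorm_unitary (unitarymx1 _ _)) (opnorm_unitary (place2_unitary ru)).
have [<-|ab] := eqVneq a b; first exact: diag.
have [K3 _ _] := gen_cube R ab.
have n1 : `|1 : R| <= 1 by rewrite normr1.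
have ru := rotation_unitary (skew_genK R a b) K3 n1.
have -> : delta_mx a b = delta_mx a a * rotation (genK R a b) 1 :> 'M[C]_4.
  have ba : (b == a) = false by rewrite eq_sym; exact: negPf.
  have aK : delta_mx a a * genK R a b = delta_mx a b :> 'M[C]_4.
    rewrite /genK -[_ * _]/(_ *m _) mulmxBr !mul_delta_mx_cond eqxx (negPf ab).
    by rewrite mulr1n mulr0n subr0.
  have abK : delta_mx a b * genK R a b = - delta_mx a a :> 'M[C]_4.
    rewrite /genK -[_ * _]/(_ *m _) mulmxBr !mul_delta_mx_cond eqxx ba.
    by rewrite mulr1n mulr0n sub0r.
  have aKK : delta_mx a a * (genK R a b * genK R a b) = - delta_mx a a :> 'M[C]_4.
    by rewrite mulrA aK.
  rewrite /rotation expr1n subrr sqrtr0 subr0 !scale1r.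
  rewrite [RHS]mulrDr [X in X + _]mulrDr mulr1 aKK aK.
  by rewrite addrAC subrr add0r.
by rewrite place2M; apply: le_trans (opnormM_unitaryr _ (place2_unitary ru)) _; exact: diag.
Qed.

(** One term for each of the 16 entries; the point is that the constant does not depend on n. *)
Lemma opnorm_place2 g : opnorm (place2 g i j) <= 16 * opnorm g.
Proof.
rewrite {1}[g]matrix_sum_delta place2_sum; apply: le_trans (opnorm_sum _ _) _.
apply: (@le_trans _ _ (\sum_(a < 4) \sum_(b < 4) opnorm g)); last first.
  by rewrite !sumr_const !card_ord -mulrnA -[X in X <= _]mulr_natl lexx.
apply: ler_sum => a _; rewrite place2_sum; apply: le_trans (opnorm_sum _ _) _.
apply: ler_sum => b _; rewrite place2Z; apply: le_trans (opnormZ_le _ _) _.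
rewrite -[leRHS]mulr1; apply: ler_pM; [exact: cabs_ge0|exact: opnorm_ge0| |].
  exact: cabs_le_opnorm.
exact: opnorm_place2_delta.
Qed.

End Pair.
End Place.

(** * Two-qubit gates generate a dense group *)

Section Controlled.
Variables (R : realType) (n : nat).
Local Notation C := (Cplx R).
Implicit Types (x y z : 'I_(2 ^ n)) (i j k : 'I_n) (f g : 'I_(2 ^ n) -> R) (s t : 'M[C]_2).

(** The tensor product of [s] with a diagonal projection on the control qubit: zero, not the
    identity, where [phi] fails, as befits Lie algebra elements. For [predT] it is [s] tensored with
    the identity. *)
Definition ctrl (s : 'M[C]_2) (phi : 'I_2 -> bool) : 'M[C]_4 := \matrix_(p, q)
  if (pbit1 p == pbit1 q) && phi (pbit1 p) then s (pbit0 p) (pbit0 q) else 0.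

(** The diagonal matrix of f times the placement of s on qubit i. *)
Definition fmx (f : 'I_(2 ^ n) -> R) (s : 'M[C]_2) i : 'M[C]_(2 ^ n) :=
  \matrix_(x, y) if same_off x y (fun k => k != i)
    then (f x)%:C * s (qbit x i) (qbit y i) else 0.

Lemma place2_ctrl s phi i k : i != k ->
  place2 (ctrl s phi) i k = fmx (fun x => (phi (qbit x k))%:R) s i.
Proof.
move=> ik; apply/matrixP => x y; rewrite place2E !mxE !pbit0K !pbit1K.
case: ifP => [/same_offP H|H]; last first.
  case: ifP => // /same_offP H'; move/negP: H; case.
  by apply/same_offP => l /andP[li _]; exact: H'.
have -> : same_off x y (fun l => l != i) = (qbit x k == qbit y k).
  apply/same_offP/eqP => [|kk l li]; first by apply; rewrite eq_sym.
  by have [->//|lk] := eqVneq l k; apply: H; rewrite li lk.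
case: (_ == _) => //=; case: (phi _) => /=; last by rewrite rmorph0 mul0r.
by rewrite rmorph1 mul1r.
Qed.

Lemma place1_ctrl s i k : i != k -> place1 s i = place2 (ctrl s predT) i k.
Proof.
move=> ik; rewrite place2_ctrl //; apply/matrixP => x y.
by rewrite place1E mxE /= rmorph1 mul1r.
Qed.

Lemma ctrl_antiherm s phi : antiherm s -> antiherm (ctrl s phi).
Proof.
move=> /matrixP sa; apply/matrixP => p q; rewrite !mxE eq_sym.
case: eqP => [<-|_] /=; last by rewrite rmorph0 oppr0.
case: ifP => _; last by rewrite rmorph0 oppr0.
by have := sa (pbit0 p) (pbit0 q); rewrite !mxE.
Qed.

Lemma ctrl_unitary s : s \is unitarymx -> ctrl s predT \is unitarymx.
Proof.
move=> su; apply/unitarymxP; apply/matrixP => p q; rewrite !mxE.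
rewrite (reindex (fun ab : 'I_2 * 'I_2 => pair_index ab.1 ab.2)) /=; last first.
  exists (fun p => (pbit0 p, pbit1 p)) => [[a b] _|r _] /=.
    by rewrite pbit0K pbit1K.
  exact: pair_bitK.
rewrite -(pair_bigA _ (fun a b => ctrl s predT p (pair_index a b) * (ctrl s predT)^t* (pair_index a b) q)) /=.
have E a b : ctrl s predT p (pair_index a b) * (ctrl s predT)^t* (pair_index a b) q =
    if b == pbit1 p then (if pbit1 p == pbit1 q then s (pbit0 p) a * s^t* a (pbit0 q) else 0) else 0.
  rewrite !mxE pbit0K pbit1K !andbT (eq_sym b (pbit1 p)) (eq_sym (pbit1 q) b).
  case: (eqVneq (pbit1 p) b) => [->|_]; last by rewrite mul0r.
  by case: ifP => _ //; rewrite rmorph0 mulr0.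
under eq_bigr do under eq_bigr do rewrite E.
under eq_bigr do rewrite -big_mkcond big_pred1_eq.
have := unitarymx_mulVr su => /matrixP/(_ (pbit0 p) (pbit0 q)).
rewrite -[s * s^t*]/(s *m s^t*) !mxE => ss.
have [b1|b1] := eqVneq (pbit1 p) (pbit1 q).
  transitivity ((pbit0 p == pbit0 q)%:R : C); first by rewrite -ss; apply: eq_bigr => a _.
  congr (nat_of_bool _)%:R; apply/eqP/eqP => [b0|->//].
  by rewrite -(pair_bitK p) b0 b1 pair_bitK.
rewrite big1 //; case: eqP => // pq; by rewrite pq eqxx in b1.
Qed.

(** As g does not depend on qubit i, its diagonal matrix commutes with s placed there. *)
Lemma fmxM f g s t i : (forall x y, same_off x y (fun k => k != i) -> g x = g y) ->
  fmx f s i * fmx g t i = fmx (fun x => f x * g x) (s * t) i.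
Proof.
move=> gi; apply/matrixP => x y; rewrite -[LHS]/((fmx f s i *m fmx g t i) x y) !mxE.
rewrite (eq_bigr (fun z => if same_off x z (fun k => k != i) then
   (f x)%:C * s (qbit x i) (qbit z i) * fmx g t i z y else 0)); last first.
  by move=> z _; rewrite mxE; case: ifP => _; [|exact: mul0r].
rewrite -big_mkcond sum_off1.
have off c : same_off x (setbit x i c) (fun k => k != i).
  by apply/same_offP => k ki; rewrite qbit_setbit (negPf ki).
have E c : same_off (setbit x i c) y (fun k => k != i) = same_off x y (fun k => k != i).
  exact: same_off_trans (off c).
case: ifP => xy; last by rewrite big1 // => c _; rewrite mxE E xy mulr0.
rewrite mulr_sumr; apply: eq_bigr => c _.
by rewrite mxE E xy qbit_setbit eqxx -(gi _ _ (off c)) rmorphM; ring.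
Qed.

End Controlled.

(** * Tangent vectors of the group generated by two-qubit gates *)

Section TwoLocal.
Variables (R : realType) (n : nat).
Hypothesis n2 : (1 < n)%N.
Local Notation C := (Cplx R).
Implicit Types (x y z : 'I_(2 ^ n)) (i j k : 'I_n) (f g : 'I_(2 ^ n) -> R) (s t : 'M[C]_2).

Definition two_local : set 'M[C]_(2 ^ n) := [set A | exists (g : 'M[C]_4) i j,
  [/\ g \is unitarymx, i != j & A = place2 g i j]].

Definition two_local_words : set 'M[C]_(2 ^ n) :=
  [set A | exists L, compositions two_local L A].

Let S := two_local_words.

Lemma two_local_unitary A : S A -> A \is unitarymx.
Proof.
case=> L; apply: compositions_unitary => B [g [i [j [gu ij ->]]]].
exact: place2_unitary.
Qed.

Lemma two_local1 : S 1. Proof. by exists 0%N; exact: compositions0. Qed.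

Lemma two_localM A B : S A -> S B -> S (A * B).
Proof. by move=> [L AL] [K BK]; exists (L + K)%N; exact: compositionsD. Qed.

Lemma two_local_dag A : S A -> S (A^t*).
Proof.
move=> [L AL]; exists L; apply: compositions_adj AL => B [g [i [j [gu ij ->]]]].
exists (g^t*), i, j; split; [exact: adj_unitary | exact: ij | exact: esym (place2_dag i j g)].
Qed.

Let SU := two_local_unitary.
Let S1 := two_local1.
Let SM := two_localM.
Let Sd := two_local_dag.

Lemma tangent_place2_cube Y i j : i != j -> antiherm Y -> Y * Y * Y = - Y ->
  tangent S (place2 Y i j).
Proof.
move=> ij Ya Y3; apply: tangent_rotation => s s1; exists 1%N; apply: compositions1.
exists (rotation Y s), i, j; split; [exact: rotation_unitary | exact: ij |].
by rewrite place2_rotation.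
Qed.

Lemma tangent_place2_1 i j : i != j -> tangent S (place2 (iC R *: 1%:M) i j).
Proof.
move=> ij; apply: (tangent_place2_cube ij).
  by rewrite /antiherm dagZ conj_iC scaleNr dag1.
have E (X : 'M[C]_4) : (iC R *: 1%:M) * X = iC R *: X.
  by rewrite -[LHS]/((iC R *: 1%:M) *m X) -scalemxAl mul1mx.
by rewrite -mulrA !E scalerA iC_sqr scaleN1r.
Qed.

Lemma tangent_place2 Y i j : i != j -> antiherm Y -> tangent S (place2 Y i j).
Proof.
move=> ij /skew_decomposition ->; rewrite place2D place2Z // place2_sum //.
apply: (tangentD SU SM); first exact: tangentZ (tangent_place2_1 ij).
apply: (tangent_sum SU S1 SM) => -[a b] /= ab; rewrite /skew_part /=.
rewrite (place2D i j (_ *: genK R a b)) (place2D i j (_ *: genS R a b)).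
rewrite (place2Z i j _ (genK R a b)) (place2Z i j _ (genS R a b)) (place2Z i j _ (genZ R a b)).
have [K3 S3 Z3] := gen_cube R ab.
apply: (tangentD SU SM); last apply: (tangentD SU SM); apply: tangentZ.
- exact: (tangent_place2_cube ij (skew_genK R a b) K3).
- exact: (tangent_place2_cube ij (skew_genS R a b) S3).
- exact: (tangent_place2_cube ij (skew_genZ R a b) Z3).
Qed.

(* As su(2) equals its derived algebra, the functions f such that f times su(2)
   on qubit i is tangent are closed under products. *)
Definition bit_free i (f : 'I_(2 ^ n) -> R) :=
  (forall x y, same_off x y (fun k => k != i) -> f x = f y) /\
  [/\ tangent S (fmx f (genK R 0 1) i), tangent S (fmx f (genS R 0 1) i)
    & tangent S (fmx f (genZ R 0 1) i)].

Lemma fmxZ (c : C) f s i : fmx f (c *: s) i = c *: fmx f s i.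
Proof. by apply/matrixP => x y; rewrite !mxE; case: ifP => _; rewrite ?mulr0 // mulrCA. Qed.

Lemma fmxB f s t i : fmx f (s - t) i = fmx f s i - fmx f t i.
Proof. by apply/matrixP => x y; rewrite !mxE; case: ifP => _; rewrite ?subr0 // mulrBr. Qed.

Lemma bit_free_ctrl i k (phi : 'I_2 -> bool) : i != k ->
  bit_free i (fun x => (phi (qbit x k))%:R).
Proof.
move=> ik; split.
  by move=> x y /same_offP H; rewrite (H k) // eq_sym.
by split; rewrite -place2_ctrl //; apply: (tangent_place2 ik); apply: ctrl_antiherm;
  [exact: skew_genK | exact: skew_genS | exact: skew_genZ].
Qed.

Lemma bit_freeM i f g : bit_free i f -> bit_free i g -> bit_free i (fun x => f x * g x).
Proof.
move=> [fi [fK fS fZ]] [gi [gK gS gZ]]; split.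
  by move=> x y xy; rewrite (fi _ _ xy) (gi _ _ xy).
have n01 : (0 : 'I_2) != 1 by [].
have [KS SZ ZK] := gen_bracket R n01.
have half s t u : s * t - t * s = u *+ 2 :> 'M[C]_2 ->
    tangent S (fmx f s i) -> tangent S (fmx g t i) -> tangent S (fmx (fun x => f x * g x) u i).
  move=> st Ts Tt.
  have -> : u = (2^-1)%:C *: (s * t - t * s).
    rewrite st mulr2n scalerDr -scalerDl -rmorphD.
    have -> : 2^-1 + 2^-1 = 1 :> R by field.
    by rewrite scale1r.
  rewrite fmxZ fmxB -(fmxM _ _ _ gi).
  have -> : fmx (fun x => f x * g x) (t * s) i = fmx g t i * fmx f s i.
    rewrite (fmxM _ _ _ fi); apply/matrixP => x y; rewrite !mxE.
    by rewrite (mulrC (f x)).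
  exact: (tangentZ _ (tangent_bracket SU SM Sd Ts Tt)).
by split; [exact: half SZ fS gZ | exact: half ZK fZ gK | exact: half KS fK gS].
Qed.

Lemma other_bit i : exists k, i != k.
Proof.
have : (0 < #|predC1 i|)%N by rewrite cardC1 card_ord; lia.
by case/card_gt0P => k; rewrite !inE eq_sym; exists k.
Qed.

(** Fixing all qubits other than i is a product of conditions on one qubit each, and a single
    condition is a two-qubit matter. The resulting functions turn matrix units of qubit i into
    matrix units of the whole system ([fmx_delta]). *)
Lemma bit_free_indicator i x0 :
  bit_free i (fun x => (same_off x x0 (fun k => k != i))%:R).
Proof.
have one : bit_free i (fun _ => 1).
  by have [k ik] := other_bit i; exact: (bit_free_ctrl predT ik).
have H (r : seq 'I_n) : bit_free i (fun x => \prod_(k <- r | k != i) (qbit x k == qbit x0 k)%:R).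
  elim: r => [|k r IH].
    by have -> : (fun x => \prod_(k <- [::] | k != i) (qbit x k == qbit x0 k)%:R) = (fun=> 1) :> (_ -> R)
      by apply: funext => x; rewrite big_nil.
  have [ki|ki] := boolP (k != i).
    have -> : (fun x => \prod_(k <- k :: r | k != i) (qbit x k == qbit x0 k)%:R)
      = (fun x => (qbit x k == qbit x0 k)%:R * \prod_(k <- r | k != i) (qbit x k == qbit x0 k)%:R) :> (_ -> R).
      by apply: funext => x; rewrite big_cons ki.
    apply: bit_freeM IH; apply: (bit_free_ctrl (fun c => c == qbit x0 k)).
    by rewrite eq_sym.
  have -> // : (fun x => \prod_(k <- k :: r | k != i) (qbit x k == qbit x0 k)%:R)
      = (fun x => \prod_(k <- r | k != i) (qbit x k == qbit x0 k)%:R) :> (_ -> R).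
  by apply: funext => x; rewrite big_cons (negPf ki).
have -> : (fun x => (same_off x x0 (fun k => k != i))%:R) =
  (fun x => \prod_(k | k != i) (qbit x k == qbit x0 k)%:R) :> (_ -> R).
  apply: funext => x; have [/same_offP xx|] := boolP (same_off _ _ _).
    by rewrite big1 // => k ki; rewrite xx ?eqxx.
  rewrite negb_forall => /existsP[k]; rewrite negb_imply => /andP[ki kx].
  by rewrite (bigD1 k) //= (negPf kx) mul0r.
exact: H.
Qed.

Lemma eq_setbit x i (c : 'I_2) y :
  (y == setbit x i c) = same_off y x (fun k => k != i) && (qbit y i == c).
Proof.
apply/eqP/andP => [->|[/same_offP H /eqP yc]].
  split; last by rewrite qbit_setbit eqxx.
  by apply/same_offP => k ki; rewrite qbit_setbit (negPf ki).
by apply: qbit_inj => k; rewrite qbit_setbit; case: (eqVneq k i) => [->//|/H].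
Qed.

Lemma fmx_delta x0 i (c e : 'I_2) :
  fmx (fun x => (same_off x x0 (fun k => k != i))%:R) (delta_mx c e) i
  = delta_mx (setbit x0 i c) (setbit x0 i e) :> 'M[C]_(2 ^ n).
Proof.
apply/matrixP => y z; rewrite !mxE !eq_setbit.
have [yx|yx] := boolP (same_off y x0 _) => /=; last first.
  by rewrite mulr0n rmorph0; case: ifP => _; rewrite ?mul0r.
have -> : same_off z x0 (fun k => k != i) = same_off y z (fun k => k != i).
  by rewrite same_offC; exact: same_off_trans yx.
rewrite rmorph1 mul1r; case: ifP => _; last by rewrite andbF.
by [].
Qed.

Lemma fmxD f s t i : fmx f (s + t) i = fmx f s i + fmx f t i.
Proof. by apply/matrixP => x y; rewrite !mxE; case: ifP => _; rewrite ?addr0 // mulrDr. Qed.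

Lemma tangent_pair_bit i x : tangent_pair S (setbit x i 0) (setbit x i 1).
Proof.
move=> _; have [_ [TK TS _]] := bit_free_indicator i x.
have KE : fmx (fun y => (same_off y x (fun k => k != i))%:R) (genK R 0 1) i
    = genK R (setbit x i 0) (setbit x i 1) by rewrite /genK fmxB !fmx_delta.
have SE : fmx (fun y => (same_off y x (fun k => k != i))%:R) (genS R 0 1) i
    = genS R (setbit x i 0) (setbit x i 1) by rewrite /genS fmxZ fmxD !fmx_delta.
by rewrite -KE -SE.
Qed.

Lemma tangent_pair_sym x y : tangent_pair S x y -> tangent_pair S y x.
Proof.
move=> H yx; have [TK TS] := H (contra_neq esym yx).
split; last by move: TS; rewrite /genS addrC.
have -> : genK R y x = - genK R x y by rewrite /genK opprB.
exact: tangentN TK.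
Qed.

Lemma tangent_pair_off i x y : same_off x y (fun k => k != i) -> tangent_pair S x y.
Proof.
move=> xy.
have xE : x = setbit x i (qbit x i).
  by apply/eqP; rewrite eq_setbit eqxx andbT; apply/same_offP.
have yE : y = setbit x i (qbit y i).
  by apply/eqP; rewrite eq_setbit eqxx andbT same_offC.
have I2 (c : 'I_2) : c = 0 \/ c = 1.
  by case: c => -[|[|//]] ?; [left|right]; exact: val_inj.
have TP := @tangent_pair_bit i x.
case: (I2 (qbit x i)) => cx; case: (I2 (qbit y i)) => cy; rewrite cx in xE; rewrite cy in yE.
- by move=> /eqP; case; rewrite yE -xE.
- by have := TP; rewrite -xE -yE.
- by have := tangent_pair_sym TP; rewrite -xE -yE.
- by move=> /eqP; case; rewrite yE -xE.
Qed.

Lemma tangent_pair_all x y : tangent_pair S x y.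
Proof.
(* A path from x to y that changes one digit at a time: z m has the first m digits of y and the
   others of x. *)
have /choice[z zP] (m : nat) : exists z, forall k : 'I_n,
    qbit z k = if (k < m)%N then qbit y k else qbit x k by exact: qbit_surj.
have H m : (m <= n)%N -> tangent_pair S x (z m).
  elim: m => [_|m IH mn].
    have -> : z 0%N = x by apply: qbit_inj => k; rewrite zP.
    by move=> /eqP.
  apply: (tangent_pair_trans SU SM Sd (IH (ltnW mn))).
  apply: (@tangent_pair_off (Ordinal mn)); apply/same_offP => k.
  rewrite -val_eqE /= => km; rewrite !zP.
  have -> // : (k < m.+1)%N = (k < m)%N.
  by rewrite ltnS leq_eqVlt (negPf km).
have <- : z n = y by apply: qbit_inj => k; rewrite zP ltn_ord.
exact: H (leqnn n).
Qed.

Theorem two_local_dense A (e : R) : A \is unitarymx -> 0 < e ->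
  exists L, exists2 w, compositions two_local L w & opnorm (A - w) <= e.
Proof.
move=> Au e0.
have [j ij] := other_bit (Ordinal n2).
have T1 : tangent S (iC R *: 1%:M).
  by have := tangent_place2_1 ij; rewrite place2Z place2_1.
have [w [L wL] Aw] := tangent_dense SU S1 SM (tangent_full SU S1 SM Sd T1 tangent_pair_all) Au e0.
by exists L, w.
Qed.

End TwoLocal.

(** * Universality *)

Section SwapGate.
Variable R : realType.
Local Notation C := (Cplx R).

(** The unnormalised singlet state. [Swap] negates it and fixes its orthogonal complement; since its
    squared norm is 2, the reflection is 1 - w w^*. *)
Definition singlet : 'cV[C]_4 := \col_(i < 4) ((val i == 1%N)%:R - (val i == 2%N)%:R).

Lemma SwapE : Swap R = 1 - singlet *m singlet^t*.
Proof.
apply/matrixP => x y; rewrite !mxE big_ord1 !mxE -!val_eqE !qbitE.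
rewrite rmorphB !rmorph_nat.
case: x => -[|[|[|[|//]]]] ?; case: y => -[|[|[|[|//]]]] ?; rewrite /= ?(mulr0n, mulr1n); ring.
Qed.

Lemma Swap_dag : (Swap R)^t* = Swap R.
Proof.
apply/matrixP => x y; rewrite !mxE rmorph_nat.
by congr (nat_of_bool _)%:R; rewrite andbC; congr andb; exact: eq_sym.
Qed.

Lemma Swap_unitary : Swap R \is unitarymx.
Proof.
apply/unitarymxP; rewrite Swap_dag SwapE.
have ww : singlet^t* *m singlet = 2%:M.
  apply/matrixP => i j; rewrite !ord1 !mxE !big_ord_recl big_ord0 !mxE /=.
  rewrite !rmorphB !rmorph_nat /= ?(mulr0n, mulr1n); ring.
rewrite mulmxBl mul1mx mulmxBr mulmx1 -mulmxA (mulmxA (singlet^t*)) ww mul_scalar_mx -scalemxAr.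
move: (singlet *m _) => X; apply/matrixP => i j; rewrite !mxE; ring.
Qed.

Lemma singlet_neq0 : singlet != 0.
Proof.
apply/eqP => /colP/(_ (@Ordinal 4 1 isT)); rewrite !mxE /= subr0 => /eqP.
by rewrite oner_eq0.
Qed.

End SwapGate.

Section Universality.
Variable R : realType.
Local Notation C := (Cplx R).
Let T : 'M[C]_4 := Swap R.

Definition efficient_for (g : 'M[C]_4) (c P : nat) := forall (M : nat) (A : 'M[C]_4),
  (0 < M)%N -> A \is unitarymx ->
  exists (k : nat) (z : C) B, [/\ (k <= c * M ^ P)%N, `|z| = 1,
    compositions (gates T g) k B & opnorm (A - z *: B) <= M%:R^-1].

Lemma place2_gates (G : PU R 4) (g : U R 4) n (i j : 'I_n) k B : PUclass g = G -> i != j ->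
  compositions (gates T (mx_of g)) k B ->
  compositions (@GSwap_gates R G n) k (place2 B i j).
Proof.
move=> gG ij; move: k B; apply: compositions_ind.
  by rewrite place2_1 //; exact: compositions0.
move=> k A B _ IH HB; rewrite place2M // -(addn1 k); apply: (compositionsD IH).
apply: compositions1; exists i, j; split; first exact: ij.
by case: HB => ->; [left; exists g | right].
Qed.

Lemma GSwap_unitary (G : PU R 4) n A : GSwap_gates (n := n) G A -> A \is unitarymx.
Proof.
case=> i [j [ij [[g _ ->]|->]]]; apply: (place2_unitary ij).
  exact: mx_of_unitary.
exact: Swap_unitary.
Qed.

Lemma local_gate_two_local n (A : 'M[C]_(2 ^ n)) : (1 < n)%N -> local_gates A -> two_local A.
Proof.
move=> n2 [[g [i ->]]|[g [i [j [ij ->]]]]].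
  have [k ik] := other_bit n2 i; exists (ctrl (mx_of g) predT), i, k; split.
  - exact/ctrl_unitary/mx_of_unitary.
  - exact: ik.
  - exact: place1_ctrl.
by exists (mx_of g), i, j; split; [exact: mx_of_unitary | exact: ij |].
Qed.

(** Each two-qubit gate is approximated as a 4 by 4 matrix before it is placed, and placing
    multiplies the error by at most 16. This keeps n out of the bounds. *)
Lemma circuit_approx (G : PU R 4) (g : U R 4) n c P l M (A : 'M[C]_(2 ^ n)) :
  PUclass g = G -> efficient_for (mx_of g) c P -> (0 < M)%N ->
  compositions (@two_local R n) l A ->
  exists (k : nat) (z : C) B, [/\ (k <= l * (c * M ^ P))%N, `|z| = 1,
    compositions (@GSwap_gates R G n) k B & opnorm (A - z *: B) <= l%:R * (16 * M%:R^-1)].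
Proof.
move=> gG eff M0; move: l A; apply: compositions_ind.
  exists 0%N, 1, 1; split; [by []|by rewrite normr1|exact: compositions0|].
  by rewrite scale1r subrr opnorm0 mul0r.
move=> l A D _ [k [z [B [kl z1 Bk AB]]]] [u [i [j [uu ij DE]]]].
have [k' [w [B' [kl' w1 Bk' AB']]]] := eff M u M0 uu.
exists (k + k')%N, (z * w), (B * place2 B' i j); split.
- by rewrite mulSn addnC leq_add.
- by rewrite normrM z1 w1 mulr1.
- exact: compositionsD Bk (place2_gates gG ij Bk').
have -> : (z * w) *: (B * place2 B' i j) = (z *: B) * (w *: place2 B' i j).
  rewrite -[B * _]/(B *m place2 B' i j) -[RHS]/((z *: B) *m (w *: place2 B' i j)).
  by rewrite -scalemxAr -scalemxAl scalerA mulrC.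
have Bu : z *: B \is unitarymx.
  by apply: (unitarymxZ z1); apply: compositions_unitary Bk; exact: GSwap_unitary.
have Du : D \is unitarymx by rewrite DE; exact: place2_unitary.
apply: le_trans (opnormM_sub _ _ Bu Du) _.
rewrite -natr1 mulrDl mul1r; apply: lerD AB _.
have -> : D - w *: place2 B' i j = place2 (u - w *: B') i j.
  by rewrite DE -[- (w *: B')]scaleNr place2D place2Z scaleNr.
apply: le_trans (opnorm_place2 ij _) _.
by rewrite ler_wpM2l // ler0n.
Qed.

Lemma efficient_universal (G : PU R 4) (g : U R 4) c P : PUclass g = G ->
  efficient_for (mx_of g) c P -> BQP_universal G.
Proof.
move=> gG eff; split.
  move=> n n2 W [V0 WV0] oW.
  have [A0 A0V] := PUclass_surj V0.
  have /open_opnorm/(_ A0)[|e e0 He] : open (@PUclass R (2 ^ n) @^-1` W) by exact: oW.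
    by rewrite /= A0V.
  have e2 : 0 < e / 2 by rewrite divr_gt0.
  have [l [w wl A0w]] := two_local_dense n2 (mx_of_unitary A0) e2.
  pose M := (Num.truncn (l%:R * 16 / (e / 2))).+1.
  have [k [z [B [_ z1 Bk wB]]]] := circuit_approx gG eff (ltn0Sn _ : (0 < M)%N) wl.
  have Bu : B \is unitarymx by apply: compositions_unitary Bk; exact: GSwap_unitary.
  have [B1 B1E] := mx_of_ex Bu.
  have [B2 B2E] := mx_of_ex (unitarymxZ z1 Bu).
  (* B2 carries the phase that brings the word B1 close to A0; their classes agree. *)
  exists (PUclass B2); split; last first.
    exists k, B1; last by rewrite B1E.
    apply/esym/PUclass_eqP; exists z; first exact: z1.
    by rewrite B1E B2E.
  apply: He; rewrite B2E; apply: le_lt_trans (opnormB_trans _ w _) _.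
  rewrite (splitr e); apply: (ler_ltD A0w); apply: le_lt_trans wB _.
  rewrite mulrA ltr_pdivrMr ?ltr0n // (mulrC (e / 2)) -ltr_pdivrMr //.
  exact: truncnS_gt.
(* With M = 16 m q and q <= 2 / eps, the count m c M ^ P is at most c 32 ^ P m ^ (P + 1) (1 / eps) ^
   P. The outer variable stands for m, the inner one for 1 / eps. *)
exists (((c * 32 ^ P)%N%:R *: 'X^P : {poly R})%:P * 'X^(P.+1) : {poly {poly R}}).
move=> n m eps A n2 m1 e0 e1 Am.
(* Each of the m gates is off by at most 16 / M, which adds up to 1 / q < eps. *)
pose q := (Num.truncn eps^-1).+1; pose M := (16 * m * q)%N.
have q1 : eps^-1 < q%:R by exact: truncnS_gt.
have M0 : (0 < M)%N by rewrite !muln_gt0 m1.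
have Am' : compositions (@two_local R n) m (mx_of A).
  by apply: compositions_sub Am => D; exact: local_gate_two_local.
have [k [z [B [km z1 Bk AB]]]] := circuit_approx gG eff M0 Am'.
have Bu : B \is unitarymx by apply: compositions_unitary Bk; exact: GSwap_unitary.
have [B1 B1E] := mx_of_ex Bu.
exists k, (PUclass B1); split.
- have q2 : (q%:R : R) <= 2 * eps^-1.
    have ei : 1 <= eps^-1 by rewrite invf_ge1 // ltW.
    have := truncn_itv (le_trans ler01 ei) => /andP[t1 _].
    rewrite /q -natr1; clear - t1 ei; lra.
  apply: (@le_trans _ _ (m * (c * M ^ P))%:R); first by rewrite ler_nat.
  rewrite !hornerE /=.
  have MX : (M%:R : R) ^+ P <= (32 * (m%:R * eps^-1)) ^+ P.
    rewrite lerXn2r ?nnegrE ?ler0n ?mulr_ge0 ?ler0n ?invr_ge0 ?(ltW e0) //.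
    have := ler_wpM2l (mulr_ge0 (ler0n R 16) (ler0n R m)) q2.
    rewrite /M !natrM; clear; move: (eps^-1) (q%:R : R) (m%:R : R) => x y t; lra.
  rewrite !natrM natrX -mulrA.
  apply: (@le_trans _ _ (m%:R * (c%:R * (32 * (m%:R * eps^-1)) ^+ P))).
    by rewrite !ler_wpM2l ?ler0n.
  rewrite natrX exprS !exprMn; rewrite le_eqVlt; apply/orP; left; apply/eqP.
  by move: (_ ^+ P) (_ ^+ P) (_ ^+ P) => x y t; ring.
- by exists B1; rewrite ?B1E.
- move=> B2 /PUclass_eqP[w w1 B2E].
  have zw : `|z * w^*%R| = 1 by rewrite normrM norm_conjC z1 w1 mulr1.
  have [t tE] := expi_ex zw.
  exists t; rewrite -tE B2E B1E scalerA -mulrA (mulrC _ w) -normCK w1 expr1n mulr1.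
  apply: le_trans AB _.
  rewrite /M !natrM.
  have m0 : (m%:R : R) != 0 by rewrite pnatr_eq0 -lt0n.
  have q0 : 0 < (q%:R : R) by rewrite ltr0n.
  have -> : m%:R * (16 * (16 * m%:R * q%:R)^-1) = q%:R^-1 :> R.
    by field; rewrite m0 gt_eqF.
  by rewrite invf_ple ?posrE // ltW.
Qed.

End Universality.

Theorem theorem1 (R : realType) :
  exists O : set (PU R 4),
    [/\ open O, dense O & forall G : PU R 4, O G -> BQP_universal G].
Proof.
pose T := Swap R; have Tu : T \is unitarymx := Swap_unitary R.
have Td : T^t* = T := Swap_dag R.
have [r r0 eff] := net_efficient Tu Td.
(* Half of the mesh required by [net_efficient], because [good_net] doubles it. *)
have e0 : 0 < r ^+ 2 / 2 by rewrite divr_gt0 // exprn_gt0.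
have [I [u [uU net]]] := finite_net 4 e0.
pose Good (g : U R 4) := good T u (r ^+ 2 / 2) (mx_of g).
have GoodP g h : PUclass g = PUclass h -> Good g -> Good h.
  move=> /esym/PUclass_eqP[z z1 hE]; rewrite /Good hE => H t.
  by rewrite letters_scale; [exact: H | exact: z1].
exists [set G | exists2 g, PUclass g = G & Good g]; split.
- apply/open_PU/open_opnorm => h [g gh /(GoodP _ _ gh) Gh].
  have [eps eps0 H] := good_open Tu Td (mx_of_unitary h) Gh.
  exists eps; first exact: eps0.
  move=> k hk; exists k; first by [].
  exact: (H _ (mx_of_unitary k) hk).
- move=> W [V0 WV0] oW; have [A0 A0V] := PUclass_surj V0.
  have /open_opnorm/(_ A0)[|e e1 He] : open (@PUclass R 4 @^-1` W) by exact: oW.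
    by rewrite /= A0V.
  have e2 : 0 < e / 2 by rewrite divr_gt0.
  have [g [gu A0g gg]] := good_dense (isT : (2 < 4)%N) (SwapE R) Tu Td (singlet_neq0 R) uU e0 (mx_of_unitary A0) e2.
  have [h hE] := mx_of_ex gu.
  exists (PUclass h); split; last by exists h; [by [] | rewrite /Good hE].
  apply: He; rewrite hE; apply: le_lt_trans A0g _.
  by rewrite ltr_pdivrMr // ltr_pMr // ltr1n.
move=> G [g gG Gg].
have [L L0 netL] := good_net Tu Td (mx_of_unitary g) net Gg.
rewrite mulrC divfK in netL; last by rewrite pnatr_eq0.
have [c [P H]] := eff _ _ (mx_of_unitary g) L0 netL.
exact: efficient_universal gG H.
Qed.
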